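(* Let $A$ be a closed commutative infinite dimensional ${}^*$-subalgebra of $L(s',s)$. Then $A$ has a (canonical) Schauder basis $\{P_n\}_{n\in\mathbb N}$ consisting of pairwise orthogonal finite dimensional minimal projections such that $$A=\operatorname{alg}(\{P_n\}_{n\in\mathbb N})\cong\lambda^1(\|P_n\|_q)=\lambda^\infty(\|P_n\|_q)$$ as Fréchet ${}^*$-algebras. Moreover, there is an operator $x\in A$ with the spectral representation $x=\sum_{n=1}^\infty\lambda_nP_n$ such that $A=\operatorname{alg}(x)$.
   Context: $\mathbb N=\{1,2,\dots\}$, $\mathbb N_0=\mathbb N\cup\{0\}$. $s$ is the Fréchet space of complex sequences $\xi=(\xi_j)_{j\in\mathbb N}$ with $|\xi|_q:=(\sum_{j}|\xi_j|^2j^{2q})^{1/2}<\infty$ for all $q\in\mathbb N_0$, with the topology of the norms $(|\cdot|_q)_{q\in\mathbb N_0}$. $s'$ is the space of complex sequences with $|\xi|'_q:=(\sum_j|\xi_j|^2j^{-2q})^{1/2}<\infty$ for some $q\in\mathbb N_0$, with the inductive limit topology. Note $s\subset l_2\subset s'$ continuously. $L(s',s)$ is the Fréchet space of continuous linear operators $x:s'\to s$ with norms $\|x\|_q:=\sup_{|\xi|'_q\le1}|x\xi|_q$, $q\in\mathbb N_0$. It is an algebra under composition (using $s\subset s'$). Restriction to $l_2$ embeds $L(s',s)$ into the compact operators $K(l_2)$; via this embedding $L(s',s)$ is regarded as a subalgebra of $K(l_2)$, closed under the Hilbert space adjoint $x\mapsto x^*$, which is its (continuous) involution. A projection is a continuous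 orthogonal (self-adjoint) projection on $l_2$; $P,Q$ are orthogonal if $PQ=0$. For a commutative subalgebra $A$, let $\mathcal P$ be the set of nonzero projections belonging to $A$, ordered by $P\preceq Q\Leftrightarrow PQ=QP=P$; ''minimal projection'' means a minimal element of $(\mathcal P,\preceq)$. The canonical Schauder basis of a closed commutative ${}^*$-subalgebra $A$ is the set of all minimal projections of $A$ (enumerated as a sequence). A Schauder basis of a Fréchet space $E$ is a sequence $(e_n)$ such that every $x\in E$ has a unique expansion $x=\sum_n\mu_ne_n$ convergent in $E$. $\operatorname{alg}(Z)$ is the closed ${}^*$-subalgebra of $L(s',s)$ generated by $Z$ (and $\operatorname{alg}(x)=\operatorname{alg}(\{x\})$). For a matrix $(a_{n,q})_{n\in\mathbb N,q\in\mathbb N_0}$, $\lambda^1(a_{n,q})$ is the space of complex sequences $\xi$ with $\sum_n|\xi_n|a_{n,q}<\infty$ for all $q\in\mathbb N_0$, and $\lambda^\infty(a_{n,q})$ the space of those with $\sup_n|\xi_n|a_{n,q}<\infty$ for all $q\in\mathbb N_0$, with the topologies given by these norms; here they carry pointwise multiplication and complex conjugation as involution. An isomorphism of Fréchet ${}^*$-algebras is a linear homeomorphism that is multiplicative and ${}^*$-preserving. The spectral representation of an infinite rank normal $x\in L(s',s)$ is $x=\sum_{n=1}^\infty\lambda_nP_n$ with $\lambda_n$ nonzero, pairwise different, $|\lambda_1|\ge|\lambda_2|\ge\cdots$, $(\lambda_n)\in s$, $P_n$ nonzero pairwise orthogonal finite dimensional projections in $L(s',s)$, the series converging absolutely in $L(s',s)$.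 *)

(* Defs.v *)
From HB Require Import structures.
From mathcomp Require Import all_boot all_order all_algebra ring lra.
From mathcomp Require Import all_classical all_reals all_analysis.
From mathcomp Require Export complex.
Set Implicit Arguments.
Unset Strict Implicit.
Unset Printing Implicit Defensive.
Import Order.TTheory GRing.Theory Num.Theory.
Import numFieldNormedType.Exports.
Export ComplexField.Normc.
Local Open Scope classical_set_scope.
Local Open Scope ring_scope.

Section linear_notions.
Context {K : numDomainType} {E : lmodType K}.

Definition finite_dim (A : set E) : Prop :=
  exists (n : nat) (v : 'I_n -> E),
    A = [set \sum_(i < n) c i *: v i | c in [set: 'I_n -> K]].

Definition absolutely_convex (V : set E) : Prop :=
  V !=set0 /\
  forall (a b : K) x y, `|a| + `|b| <= 1 -> V x -> V y -> V (a *: x + b *: y).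

End linear_notions.

(* Neighbourhood filter of [x] in the locally convex topology defined by a
   sequence of seminorms.  The seminorms are extended-real valued, so that they
   may be defined on a space larger than the one they topologize. *)
Definition seminorm_nbhs {R : realType} {E : zmodType} (p : nat -> E -> \bar R)
    (x : E) : set_system E :=
  [set U | exists (r : nat) (e : R), 0 < e /\
    [set y | forall k, (k <= r)%N -> (p k (y - x)%R < e%:E)%E] `<=` U].

Section sequence_spaces.
Context {R : realType}.
Local Notation C := R[i].

(* Sequences are indexed from 0: the term of index j is the (j+1)-st one,
   hence the weight j.+1. *)
Definition wnorm (w : int) (xi : nat -> C) : \bar R :=
  sqrte (\sum_(0 <= j <oo) (normc (xi j) ^+ 2 * j.+1%:R ^ (w *+ 2))%:E)%E.

Definition in_s : {pred nat -> C} :=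
  [pred xi | `[< forall q : nat, (wnorm q%:Z xi < +oo)%E >]].
Definition in_l2 : {pred nat -> C} := [pred xi | `[< (wnorm 0 xi < +oo)%E >]].
Definition in_sdual : {pred nat -> C} :=
  [pred xi | `[< exists q : nat, (wnorm (- q%:Z) xi < +oo)%E >]].

Let normc_ge0 (z : C) : 0 <= normc z.
Proof. by case: z => a b; exact: sqrtr_ge0. Qed.

Lemma wnorm_lty w xi : (wnorm w xi < +oo)%E <->
  (\sum_(0 <= j <oo) (normc (xi j) ^+ 2 * j.+1%:R ^ (w *+ 2))%:E < +oo)%E.
Proof. by rewrite /wnorm; case: (limn _) => [r| |] /=; rewrite ?ltry. Qed.

Let term_ge0 w (xi : nat -> C) j :
  (0 <= (normc (xi j) ^+ 2 * j.+1%:R ^ (w *+ 2))%:E)%E.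
Proof. by rewrite lee_fin mulr_ge0 ?sqr_ge0// exprz_ge0. Qed.

Lemma wnorm0 w : (wnorm w 0%R < +oo)%E.
Proof.
apply/wnorm_lty; rewrite eseries0 ?ltry// => j _ _.
by rewrite normc0 expr0n mul0r.
Qed.

Lemma wnorm_lin w (a : C) (xi eta : nat -> C) :
  (wnorm w xi < +oo)%E -> (wnorm w eta < +oo)%E ->
  (wnorm w (a *: xi + eta)%R < +oo)%E.
Proof.
move=> /wnorm_lty hx /wnorm_lty hy; apply/wnorm_lty.
pose u (z : nat -> C) j := (normc (z j) ^+ 2 * j.+1%:R ^ (w *+ 2))%:E.
apply: (@le_lt_trans _ _ (\sum_(0 <= j <oo)
  ((2 * normc a ^+ 2)%R%:E * u xi j + 2%:E * u eta j))%E); last first.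
  have c_ge0 : (0 <= (2 * normc a ^+ 2)%R%:E)%E
    by rewrite lee_fin mulr_ge0 ?sqr_ge0.
  have two_ge0 : (0 <= (2 : R)%:E)%E by rewrite lee_fin.
  rewrite nneseriesD;
    [|by move=> j _ _; apply: mule_ge0 => //; exact: term_ge0..].
  rewrite !nneseriesZl; [|by move=> j _; exact: term_ge0..].
  by apply: lte_add_pinfty; apply: lte_mul_pinfty.
apply: lee_nneseries => j _; [by move=> _; exact: term_ge0|].
rewrite -!EFinM -EFinD lee_fin !mulrA -mulrDl ler_wpM2r ?exprz_ge0//.
have h : normc ((a *: xi + eta) j) <= normc a * normc (xi j) + normc (eta j).
  rewrite -normcM; exact: le_normcD.
apply: (@le_trans _ _ ((normc a * normc (xi j) + normc (eta j)) ^+ 2)).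
  by rewrite ler_sqr ?nnegrE ?addr_ge0 ?mulr_ge0 ?normc_ge0.
rewrite -subr_ge0; have := sqr_ge0 (normc a * normc (xi j) - normc (eta j)).
by congr (_ <= _); ring.
Qed.

Lemma in_s_submod : submod_closed in_s.
Proof.
split=> [|a xi eta]; first by apply/asboolP => q; exact: wnorm0.
by move=> /asboolP hx /asboolP hy; apply/asboolP => q; exact: wnorm_lin.
Qed.

Lemma in_l2_submod : submod_closed in_l2.
Proof.
split=> [|a xi eta]; first by apply/asboolP; exact: wnorm0.
by move=> /asboolP hx /asboolP hy; apply/asboolP; exact: wnorm_lin.
Qed.

Lemma wnorm_le (v w : int) (xi : nat -> C) : v <= w ->
  (wnorm w xi < +oo)%E -> (wnorm v xi < +oo)%E.
Proof.
move=> vw /wnorm_lty h; apply/wnorm_lty; apply: le_lt_trans h.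
apply: lee_nneseries => j _; [by move=> _; exact: term_ge0|].
rewrite lee_fin ler_wpM2l ?sqr_ge0// ler_weXz2l ?ler1n//.
by rewrite ler_wMn2r.
Qed.

Lemma in_sdual_submod : submod_closed in_sdual.
Proof.
split=> [|a xi eta]; first by apply/asboolP; exists 0; exact: wnorm0.
move=> /asboolP[q hx] /asboolP[r hy]; apply/asboolP; exists (maxn q r).
by apply: wnorm_lin; [move: hx|move: hy]; apply: wnorm_le;
  rewrite lerN2 lez_nat (leq_maxl, leq_maxr).
Qed.

HB.instance Definition _ := GRing.isSubmodClosed.Build _ _ in_s in_s_submod.
HB.instance Definition _ := GRing.isSubmodClosed.Build _ _ in_l2 in_l2_submod.
HB.instance Definition _ :=
  GRing.isSubmodClosed.Build _ _ in_sdual in_sdual_submod.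

Record sspace := SSpace { s_val : nat -> C; s_valP : s_val \in in_s }.
Record l2space := L2Space { l2_val : nat -> C; l2_valP : l2_val \in in_l2 }.
Record sdual :=
  Sdual { sdual_val : nat -> C; sdual_valP : sdual_val \in in_sdual }.

HB.instance Definition _ := [isSub for s_val].
HB.instance Definition _ := [Choice of sspace by <:].
HB.instance Definition _ := [SubChoice_isSubLmodule of sspace by <:].
HB.instance Definition _ := [isSub for l2_val].
HB.instance Definition _ := [Choice of l2space by <:].
HB.instance Definition _ := [SubChoice_isSubLmodule of l2space by <:].
HB.instance Definition _ := [isSub for sdual_val].
HB.instance Definition _ := [Choice of sdual by <:].
HB.instance Definition _ := [SubChoice_isSubLmodule of sdual by <:].

End sequence_spaces.
Arguments sspace R : clear implicits.
Arguments l2space R : clear implicits.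
Arguments sdual R : clear implicits.

Section operators.
Context {R : realType}.
Local Notation C := R[i].
Local Notation op := (sdual R -> sspace R).

Lemma s_in_l2 (xi : sspace R) : s_val xi \in in_l2.
Proof. by apply/asboolP; have /asboolP h := s_valP xi; exact: (h 0). Qed.

Lemma l2_in_sdual (xi : l2space R) : l2_val xi \in in_sdual.
Proof. by apply/asboolP; exists 0; rewrite oppr0; apply/asboolP/l2_valP. Qed.

Definition s_to_l2 (xi : sspace R) : l2space R := L2Space (s_in_l2 xi).
Definition l2_to_sdual (xi : l2space R) : sdual R := Sdual (l2_in_sdual xi).

Definition s_norm (q : nat) (xi : sspace R) : \bar R := wnorm q%:Z (s_val xi).
Definition l2_norm (xi : l2space R) : \bar R := wnorm 0 (l2_val xi).
(* infinite outside of the q-th step of the inductive limit *)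
Definition sdual_norm (q : nat) (xi : sdual R) : \bar R :=
  wnorm (- q%:Z) (sdual_val xi).

(* The inner product of l2, linear in the first argument; the complex series is
   summed through its real and imaginary parts. *)
Definition inner (xi eta : l2space R) : C :=
  let u j := l2_val xi j * (l2_val eta j)^*%C in
  Complex (limn (series (fun j => complex.Re (u j))))
    (limn (series (fun j => complex.Im (u j)))).

(* The locally convex inductive limit topology of the steps
   { xi | sdual_norm q xi < +oo }: an absolutely convex set is a neighbourhood
   of 0 iff its trace on each step is a neighbourhood of 0 in that step. *)
Definition sdual_nbhs (xi : sdual R) : set_system (sdual R) :=
  [set U | exists V : set (sdual R), [/\ absolutely_convex V,
    forall q : nat, exists2 e : R, 0 < e &
      [set eta | (sdual_norm q eta < e%:E)%E] `<=` V &
    [set xi + eta | eta in V] `<=` U]].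

Definition Lss : set op :=
  [set x | linear x /\
    forall xi, x eta @[eta --> sdual_nbhs xi] --> seminorm_nbhs s_norm (x xi)].

Definition op_norm (q : nat) (x : op) : \bar R :=
  ereal_sup [set s_norm q (x xi) | xi in [set xi | (sdual_norm q xi <= 1)%E]].

Definition op_mul (x y : op) : op := x \o l2_to_sdual \o s_to_l2 \o y.

(* the embedding of L(s', s) into K(l2) *)
Definition restr (x : op) : l2space R -> l2space R :=
  s_to_l2 \o x \o l2_to_sdual.

Definition adjoint (x y : op) : Prop :=
  forall xi eta : l2space R, inner (restr x xi) eta = inner xi (restr y eta).

Definition normal (x : op) : Prop :=
  exists2 y, Lss y /\ adjoint x y & op_mul x y = op_mul y x.

Definition finite_rank (x : op) : Prop := finite_dim (range (restr x)).

Definition orthogonal_projection (p : l2space R -> l2space R) : Prop :=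
  [/\ linear p,
      forall xi, p eta @[eta --> seminorm_nbhs (fun=> l2_norm) xi]
        --> seminorm_nbhs (fun=> l2_norm) (p xi),
      forall xi, p (p xi) = p xi &
      forall xi eta, inner (p xi) eta = inner xi (p eta)].

Definition nonzero_projections (A : set op) : set op :=
  [set P | [/\ A P, orthogonal_projection (restr P) & P != 0]].

Definition proj_le (P Q : op) : Prop := op_mul P Q = P /\ op_mul Q P = P.

Definition minimal_projections (A : set op) : set op :=
  [set P | nonzero_projections A P /\
    forall Q, nonzero_projections A Q -> proj_le Q P -> Q = P].

Record star_subalgebra (A : set op) : Prop := {
  star_subalgebra_sub : A `<=` Lss ;
  star_subalgebra_0 : A 0 ;
  star_subalgebra_lin : forall (a : C) x y, A x -> A y -> A (a *: x + y) ;
  star_subalgebra_mul : forall x y, A x -> A y -> A (op_mul x y) ;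
  star_subalgebra_adj : forall x, A x -> exists2 y, A y & adjoint x y }.

Definition closed_in_Lss (A : set op) : Prop :=
  forall x, Lss x ->
    (forall U, seminorm_nbhs op_norm x U -> A `&` U !=set0) -> A x.

Definition closed_star_subalgebra (A : set op) : Prop :=
  star_subalgebra A /\ closed_in_Lss A.

Definition alg (Z : set op) : set op :=
  smallest closed_star_subalgebra Z.

Definition commutative_op (A : set op) : Prop :=
  forall x y, A x -> A y -> op_mul x y = op_mul y x.

Definition schauder_basis (A : set op) (e : nat -> op) : Prop :=
  (forall n, A (e n)) /\
  forall x, A x -> exists! mu : nat -> C,
    (\sum_(i < n) mu i *: e i) @[n --> \oo] --> seminorm_nbhs op_norm x.

Definition canonical_schauder_basis (A : set op) (e : nat -> op) : Prop :=
  [/\ injective e, range e = minimal_projections A & schauder_basis A e].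

Definition spectral_representation (x : op) (lambda : nat -> C)
    (P : nat -> op) : Prop :=
  [/\ [/\ Lss x, normal x & ~ finite_rank x],
      [/\ forall n, lambda n != 0, injective lambda,
          forall m n, (m <= n)%N -> normc (lambda n) <= normc (lambda m) &
          lambda \in in_s],
      forall n, [/\ Lss (P n), orthogonal_projection (restr (P n)),
          P n != 0 & finite_rank (P n)],
      forall m n, m != n -> op_mul (P m) (P n) = 0 &
      (forall q, (\sum_(0 <= n <oo) op_norm q (lambda n *: P n) < +oo)%E) /\
      (\sum_(i < n) lambda i *: P i) @[n --> \oo] --> seminorm_nbhs op_norm x].

End operators.

(* A Frechet *-algebra realized on a subset of an ambient vector space; the
   operations and the seminorms are only meaningful on the carrier, and the
   involution is given by its graph: [fstar x y] means that y = x^*. *)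
Record frechet_star (R : realType) (E : lmodType R[i]) := FrechetStar {
  fcarrier : set E ;
  fseminorm : nat -> E -> \bar R ;
  fmul : E -> E -> E ;
  fstar : E -> E -> Prop }.

Section frechet_star_algebras.
Context {R : realType}.
Local Notation C := R[i].
Local Notation op := (sdual R -> sspace R).

Definition fnbhs {E : lmodType C} (A : frechet_star E) (x : E) : set_system E :=
  within (fcarrier A) (seminorm_nbhs (@fseminorm _ _ A) x).

Definition same_frechet_star {E : lmodType C} (A B : frechet_star E) : Prop :=
  [/\ fcarrier A = fcarrier B,
      forall x, fcarrier A x -> fnbhs A x = fnbhs B x,
      {in fcarrier A &, forall x y, fmul A x y = fmul B x y} &
      {in fcarrier A &, forall x y, fstar A x y <-> fstar B x y}].

Definition frechet_star_iso {E F : lmodType C} (A : frechet_star E)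
    (B : frechet_star F) : Prop :=
  exists (T : E -> F) (S : F -> E),
  [/\ [/\ forall x, fcarrier A x -> fcarrier B (T x),
          forall y, fcarrier B y -> fcarrier A (S y),
          {in fcarrier A, cancel T S} & {in fcarrier B, cancel S T}],
      (forall x, fcarrier A x -> T y @[y --> fnbhs A x] --> fnbhs B (T x)) /\
      (forall x, fcarrier B x -> S y @[y --> fnbhs B x] --> fnbhs A (S x)),
      forall a, {in fcarrier A &, forall x y, T (a *: x + y) = a *: T x + T y},
      {in fcarrier A &, forall x y, T (fmul A x y) = fmul B (T x) (T y)} &
      {in fcarrier A &, forall x y, fstar A x y -> fstar B (T x) (T y)}].

Definition op_star_algebra (A : set op) : frechet_star op :=
  FrechetStar A op_norm op_mul adjoint.

Definition conj_graph (xi eta : nat -> C) : Prop :=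
  forall n, eta n = (xi n)^*%C.

Definition lambda1_norm (a : nat -> nat -> R) (q : nat) (xi : nat -> C) :
    \bar R :=
  (\sum_(0 <= n <oo) (normc (xi n) * a n q)%:E)%E.

Definition lambdaoo_norm (a : nat -> nat -> R) (q : nat) (xi : nat -> C) :
    \bar R :=
  ereal_sup (range (fun n => (normc (xi n) * a n q)%:E)).

Definition lambda1 (a : nat -> nat -> R) : frechet_star (nat -> C) :=
  FrechetStar [set xi | forall q, (lambda1_norm a q xi < +oo)%E]
    (lambda1_norm a) (fun xi eta n => xi n * eta n) conj_graph.

Definition lambdaoo (a : nat -> nat -> R) : frechet_star (nat -> C) :=
  FrechetStar [set xi | forall q, (lambdaoo_norm a q xi < +oo)%E]
    (lambdaoo_norm a) (fun xi eta n => xi n * eta n) conj_graph.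

End frechet_star_algebras.

(* Main.v *)
Require Import Defs.
From HB Require Import structures.
From mathcomp Require Import all_boot all_order all_algebra.
From mathcomp Require Import all_classical all_reals all_analysis.
From mathcomp Require Import ring lra zify.
Set Implicit Arguments.
Unset Strict Implicit.
Unset Printing Implicit Defensive.
Import Order.TTheory GRing.Theory Num.Theory.
Import numFieldNormedType.Exports.
Local Open Scope classical_set_scope.
Local Open Scope ring_scope.

(* A Hilbert space argument replaces the spectral theorem.  For a self-adjoint
   x <> 0 in A with l2-operator norm r, the powers (x / r)^(2k) decrease, hence
   converge strongly on l2; they stay bounded in every seminorm, so by
   interpolation they converge in L(s', s), and the limit is a nonzero
   projection p in A with x^2 p = r^2 p.  Ranges of projections only carry
   orthonormal systems of bounded size, so below p there is a minimal projection
   of A.  Minimal projections are pairwise orthogonal, countably many by Bessel's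
   inequality, each x in A acts on them by scalars, and an element of A killed by
   all of them vanishes.

   Nuclearity is explicit.  For a projection P with unit vector f in its range,
   1 / ||P||_q <= |f|'_q ^ 2, whose sum over an orthonormal system is at most
   sum_j j^(-2q), while ||P||_q ^ 2 <= ||P||_(4q); and x P = mu P implies
   |mu| ||P||_q <= ||x||_(2q).  Hence the coordinates of x are absolutely summable
   against the norms ||P_n||_q and x is the sum of its expansion.

   A generator is any sum of lambda_n P_n with lambda_n > 0 strictly decreasing
   fast enough: (x / lambda_0)^k tends to P_0, and one continues with
   x - lambda_0 P_0. *)

(** * Weighted l2-norms of sequences *)

(** An operator in L(s', s) is determined by its values on s, because truncations of a functional
    converge to it once one index of the dual norms is given up; hence identities between operators,
    adjoints and projections can be checked on l2. Limits cannot: the topology is much finer than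
    that of the l2-operator norm, and L(s', s) has no unit, so each limit is produced directly and
    controlled in every norm. Two inequalities do this. First, ||x z y||_q <= ||x||_q ||z||_0
    ||y||_q, so that the powers of an l2-contraction stay bounded in every norm. Second, |v|_q^2 <=
    |v|_0 |v|_(2q), which turns smallness in l2 into smallness in |.|_q. The second one is also the
    source of the index losses below: 2q after one interpolation, 4q after two. The recurring
    constant 2 is a bound for the sum of all j^(-2). *)

Section weighted_norms.
Context {R : realType}.
Local Notation C := R[i].
Implicit Types (xi eta : nat -> C) (w : int) (a : C) (c : R).

Lemma normc_ge0 (a : C) : 0 <= normc a.
Proof. by case: a => x y; exact: sqrtr_ge0. Qed.

Lemma normr_normc a : `|a| = (normc a)%:C%C.
Proof. by case: a. Qed.

Lemma normc_real (r : R) : normc (r%:C)%C = `|r|.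
Proof. by rewrite /normc /= expr0n addr0 sqrtr_sqr. Qed.

Lemma normc_conj a : normc (a^*)%C = normc a.
Proof. by case: a => x y; rewrite /normc /= sqrrN. Qed.

Lemma normc_opp a : normc (- a) = normc a.
Proof. by case: a => x y; rewrite /normc /= !sqrrN. Qed.

Lemma normc_eq0 a : (normc a == 0) = (a == 0).
Proof. by apply/eqP/eqP => [/eq0_normc//|->]; rewrite normc0. Qed.

Lemma normc_gt0 a : (0 < normc a) = (a != 0).
Proof. by rewrite lt_neqAle normc_ge0 andbT eq_sym normc_eq0. Qed.

Lemma normc_sq a : normc a ^+ 2 = complex.Re a ^+ 2 + complex.Im a ^+ 2.
Proof. by case: a => x y; rewrite /normc sqr_sqrtr ?addr_ge0 ?sqr_ge0. Qed.

Lemma mul_conj a : a * (a^*)%C = (normc a ^+ 2)%:C%C.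
Proof.
by rewrite normc_sq; case: a => x y; apply/eqP; rewrite eq_complex /=;
   apply/andP; split; apply/eqP; ring.
Qed.

Lemma Re_le_normc a : `|complex.Re a| <= normc a.
Proof.
rewrite -[normc a]ger0_norm ?normc_ge0// -ler_sqr ?nnegrE// !real_normK ?num_real//.
by rewrite normc_sq lerDl sqr_ge0.
Qed.

Lemma Im_le_normc a : `|complex.Im a| <= normc a.
Proof.
rewrite -[normc a]ger0_norm ?normc_ge0// -ler_sqr ?nnegrE// !real_normK ?num_real//.
by rewrite normc_sq lerDr sqr_ge0.
Qed.

(** Cauchy-Schwarz, with upper bounds A and B in place of square roots so that norms can be plugged
    in directly. *)
Lemma sum_mul_le n (u v : nat -> R) (A B : R) : 0 <= A -> 0 <= B ->
  \sum_(0 <= j < n) u j ^+ 2 <= A ^+ 2 -> \sum_(0 <= j < n) v j ^+ 2 <= B ^+ 2 ->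
  \sum_(0 <= j < n) u j * v j <= A * B.
Proof.
move=> A0 B0 hu hv.
have CS : (\sum_(0 <= j < n) u j * v j) ^+ 2 <=
    (\sum_(0 <= j < n) u j ^+ 2) * (\sum_(0 <= j < n) v j ^+ 2).
  elim: n {hu hv} => [|n IH]; first by rewrite !big_nil expr0n mul0r.
  rewrite !big_nat_recr//=.
  have p0 : 0 <= \sum_(0 <= j < n) u j ^+ 2 by apply: sumr_ge0 => j _; exact: sqr_ge0.
  have q0 : 0 <= \sum_(0 <= j < n) v j ^+ 2 by apply: sumr_ge0 => j _; exact: sqr_ge0.
  move: IH p0 q0; set S := \sum_(0 <= j < n) u j * v j.
  set p := \sum_(0 <= j < n) u j ^+ 2; set q := \sum_(0 <= j < n) v j ^+ 2.
  move=> IH p0 q0.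
  set s := u n; set t := v n.
  (* After squaring and using the induction hypothesis this is [(p t^2 - q s^2)^2 >= 0]. *)
  have key : 2 * (S * (s * t)) <= p * t ^+ 2 + q * s ^+ 2.
    have r0 : 0 <= p * t ^+ 2 + q * s ^+ 2 by rewrite addr_ge0// mulr_ge0// sqr_ge0.
    apply: le_trans (ler_norm _) _.
    rewrite -ler_sqr ?nnegrE// real_normK ?num_real//.
    apply: (@le_trans _ _ (4 * (p * q * (s * t) ^+ 2))).
      have -> : (2 * (S * (s * t))) ^+ 2 = 4 * (S ^+ 2 * (s * t) ^+ 2) by ring.
      by rewrite ler_wpM2l// ler_wpM2r// sqr_ge0.
    rewrite -subr_ge0; have := sqr_ge0 (p * t ^+ 2 - q * s ^+ 2).
    by congr (_ <= _); ring.
  nra.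
apply: le_trans (ler_norm _) _.
rewrite -ler_sqr ?nnegrE ?mulr_ge0// real_normK ?num_real//.
apply: le_trans CS _; rewrite exprMn ler_pM//.
- by apply: sumr_ge0 => j _; exact: sqr_ge0.
- by apply: sumr_ge0 => j _; exact: sqr_ge0.
Qed.

Definition psum w xi n : R :=
  \sum_(0 <= j < n) normc (xi j) ^+ 2 * j.+1%:R ^ (w *+ 2).

Definition fin w xi := (wnorm w xi < +oo)%E.
(** The value is 0 on sequences of infinite norm, which is why most lemmas below assume [fin]. *)
Definition nrm w xi : R := fine (wnorm w xi).

Lemma weight_gt0 (j : nat) w : 0 < j.+1%:R ^ w :> R.
Proof. by rewrite exprz_gt0. Qed.

Lemma weight_ge0 (j : nat) w : 0 <= j.+1%:R ^ w :> R.
Proof. exact/ltW/weight_gt0. Qed.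

Lemma psum_term_ge0 w xi j : 0 <= normc (xi j) ^+ 2 * j.+1%:R ^ (w *+ 2).
Proof. by rewrite mulr_ge0 ?sqr_ge0 ?weight_ge0. Qed.

Lemma psum_ge0 w xi n : 0 <= psum w xi n.
Proof. by apply: sumr_ge0 => j _; exact: psum_term_ge0. Qed.

Lemma psumE w xi n :
  psum w xi n = \sum_(0 <= j < n) (normc (xi j) * j.+1%:R ^ w) ^+ 2.
Proof.
apply: eq_bigr => j _; rewrite exprMn; congr (_ * _).
by rewrite mulr2n expfzDr ?pnatr_eq0// expr2.
Qed.

Lemma wnorm_ge0 w xi : (0 <= wnorm w xi)%E.
Proof. exact: sqrte_ge0. Qed.

Lemma wnorm_leP w xi c : 0 <= c ->
  (wnorm w xi <= c%:E)%E <-> forall n, psum w xi n <= c ^+ 2.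
Proof.
move=> c0; have -> : c%:E = sqrte (c ^+ 2)%:E by rewrite /= sqrtr_sqr ger0_norm.
rewrite /wnorm lee_sqrt ?lee_fin ?sqr_ge0//.
have t0 n : (0 <= n)%N -> xpredT n ->
  (0 <= (normc (xi n) ^+ 2 * n.+1%:R ^ (w *+ 2))%:E)%E.
  by move=> _ _; rewrite lee_fin psum_term_ge0.
split=> [h n|h].
  rewrite -lee_fin; apply: le_trans h.
  by rewrite /psum -sumEFin; exact: nneseries_lim_ge.
apply: lime_le; first exact: is_cvg_nneseries.
by apply: nearW => n; rewrite sumEFin lee_fin; exact: h.
Qed.

Lemma nrm_ge0 w xi : 0 <= nrm w xi.
Proof. by rewrite /nrm fine_ge0// wnorm_ge0. Qed.

Lemma wnormE w xi : fin w xi -> wnorm w xi = (nrm w xi)%:E.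
Proof. by move=> h; rewrite /nrm fineK// ge0_fin_numE ?wnorm_ge0. Qed.

(** The working form of a norm estimate: partial sums give finiteness and the bound at once, without
    extended reals. *)
Lemma fin_leP w xi c : 0 <= c -> (forall n, psum w xi n <= c ^+ 2) ->
  fin w xi /\ nrm w xi <= c.
Proof.
move=> c0 /(wnorm_leP _ _ c0) h.
have f : fin w xi by apply: le_lt_trans h (ltry _).
by split=> //; rewrite -lee_fin -wnormE.
Qed.

Lemma psum_le_nrm w xi n : fin w xi -> psum w xi n <= nrm w xi ^+ 2.
Proof.
move=> f; move: n; apply/wnorm_leP; first exact: nrm_ge0.
by rewrite wnormE.
Qed.

Lemma fin_sqleP w xi c : (forall n, psum w xi n <= c) ->
  fin w xi /\ nrm w xi ^+ 2 <= c.
Proof.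
move=> h; have c0 : 0 <= c := le_trans (psum_ge0 w xi 0) (h 0).
have [|f le_] := @fin_leP w xi (Num.sqrt c) (sqrtr_ge0 _).
  by move=> n; rewrite sqr_sqrtr.
split=> //; rewrite -(sqr_sqrtr c0) ler_sqr ?nnegrE ?nrm_ge0 ?sqrtr_ge0//.
Qed.

Lemma fin0 w : fin w 0.
Proof. exact: wnorm0. Qed.

Lemma finD w xi eta : fin w xi -> fin w eta -> fin w (xi + eta).
Proof. by move=> hx hy; have := wnorm_lin 1 hx hy; rewrite scale1r. Qed.

Lemma finZ w a xi : fin w xi -> fin w (a *: xi).
Proof. by move=> hx; have := wnorm_lin a hx (wnorm0 w); rewrite addr0. Qed.

Lemma finN w xi : fin w xi -> fin w (- xi).
Proof. by move=> h; rewrite -scaleN1r; exact: finZ. Qed.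

Lemma finB w xi eta : fin w xi -> fin w eta -> fin w (xi - eta).
Proof. by move=> hx hy; apply: finD => //; exact: finN. Qed.

Lemma nrmD w xi eta : fin w xi -> fin w eta ->
  nrm w (xi + eta) <= nrm w xi + nrm w eta.
Proof.
move=> hx hy; apply: (@fin_leP _ _ _ _ _).2.
  by rewrite addr_ge0 ?nrm_ge0.
move=> n; have := psum_le_nrm n hx; have := psum_le_nrm n hy.
rewrite !psumE => sy sx.
have sxy := sum_mul_le (nrm_ge0 w xi) (nrm_ge0 w eta) sx sy.
apply: (@le_trans _ _ (\sum_(0 <= j < n)
   ((normc (xi j) * j.+1%:R ^ w) + (normc (eta j) * j.+1%:R ^ w)) ^+ 2)).
  apply: ler_sum => j _.
  rewrite ler_sqr ?nnegrE ?addr_ge0 ?mulr_ge0 ?normc_ge0 ?weight_ge0//.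
  rewrite -mulrDl ler_wpM2r ?weight_ge0//; exact: le_normcD.
rewrite (eq_bigr (fun j => (normc (xi j) * j.+1%:R ^ w) ^+ 2 +
  (normc (xi j) * j.+1%:R ^ w * (normc (eta j) * j.+1%:R ^ w)) *+ 2 +
  (normc (eta j) * j.+1%:R ^ w) ^+ 2)); last by move=> j _; exact: sqrrD.
rewrite big_split/= (big_split _ _ _ (fun j => (normc (xi j) * _) ^+ 2)) sumrMnl sqrrD.
by apply: lerD => //; apply: lerD => //; rewrite lerMn2r/= sxy.
Qed.

Lemma nrmZ w a xi : fin w xi -> nrm w (a *: xi) = normc a * nrm w xi.
Proof.
have le_Z b eta : fin w eta -> nrm w (b *: eta) <= normc b * nrm w eta.
  move=> h; apply: (@fin_leP _ _ _ _ _).2.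
    by rewrite mulr_ge0 ?nrm_ge0 ?normc_ge0.
  move=> n; rewrite exprMn; apply: le_trans (ler_wpM2l (sqr_ge0 _) (psum_le_nrm n h)).
  rewrite /psum mulr_sumr; apply: ler_sum => j _.
  by rewrite [(b *: eta) j]/(b * eta j) normcM exprMn -mulrA.
move=> h; apply/eqP; rewrite eq_le le_Z//=.
have [->|a0] := eqVneq a 0; first by rewrite normc0 mul0r nrm_ge0.
rewrite -ler_pdivlMl ?normc_gt0// -normcV.
by have := le_Z a^-1 (a *: xi) (finZ _ h); rewrite scalerA mulVf// scale1r.
Qed.

Lemma nrm0 w : nrm w 0 = 0.
Proof. by rewrite -(scale0r (0 : nat -> C)) nrmZ ?normc0 ?mul0r//; exact: fin0. Qed.

Lemma nrmN w xi : fin w xi -> nrm w (- xi) = nrm w xi.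
Proof. by move=> h; rewrite -scaleN1r nrmZ// normc_opp normc1 mul1r. Qed.

Lemma nrmB w xi eta : fin w xi -> fin w eta ->
  nrm w (xi - eta) <= nrm w xi + nrm w eta.
Proof. by move=> hx hy; rewrite -(nrmN hy); apply: nrmD => //; exact: finN. Qed.

Lemma nrm_eq0 w xi : fin w xi -> nrm w xi = 0 -> xi = 0.
Proof.
move=> h h0; apply/funext => j.
have := psum_le_nrm j.+1 h; rewrite h0 expr0n/= /psum big_nat_recr//=.
have := psum_ge0 w xi j; rewrite /psum => s0 s1.
have : normc (xi j) ^+ 2 * j.+1%:R ^ (w *+ 2) <= 0 by lra.
rewrite pmulr_lle0 ?weight_gt0// => h1; apply: eq0_normc.
by apply/eqP; rewrite -sqrf_eq0 eq_le h1 sqr_ge0.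
Qed.

Lemma coord_le_nrm w xi j : fin w xi ->
  normc (xi j) * j.+1%:R ^ w <= nrm w xi.
Proof.
move=> h; rewrite -ler_sqr ?nnegrE ?nrm_ge0 ?mulr_ge0 ?normc_ge0 ?weight_ge0//.
apply: le_trans (psum_le_nrm j.+1 h).
by rewrite psumE big_nat_recr//= lerDr; apply: sumr_ge0 => k _; exact: sqr_ge0.
Qed.

Lemma fin_mono (v w : int) xi : v <= w -> fin w xi -> fin v xi.
Proof. exact: wnorm_le. Qed.

Lemma nrm_mono (v w : int) xi : v <= w -> fin w xi -> nrm v xi <= nrm w xi.
Proof.
move=> vw h; apply: (@fin_leP _ _ _ _ _).2; first exact: nrm_ge0.
move=> n; apply: le_trans (psum_le_nrm n h).
apply: ler_sum => j _; rewrite ler_wpM2l ?sqr_ge0// ler_weXz2l ?ler1n//.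
by rewrite ler_wMn2r.
Qed.

(** The weights w and -w cancel term by term; this is the duality between s and s'. *)
Lemma sum_pairing_le w xi eta n : fin w xi -> fin (- w) eta ->
  \sum_(0 <= j < n) normc (xi j) * normc (eta j) <= nrm w xi * nrm (- w) eta.
Proof.
move=> hx hy; have := psum_le_nrm n hx; have := psum_le_nrm n hy.
rewrite !psumE => sy sx.
apply: le_trans (sum_mul_le (nrm_ge0 _ _) (nrm_ge0 _ _) sx sy).
apply: ler_sum => j _; rewrite mulrACA -expfzDr ?pnatr_eq0//.
by rewrite subrr expr0z mulr1.
Qed.

(** Split each [(|xi_j| j^w)^2] as [|xi_j|] times [|xi_j| j^(2w)] and apply Cauchy-Schwarz. *)
Lemma nrm_interpolation w xi : 0 <= w -> fin (w *+ 2) xi ->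
  nrm w xi ^+ 2 <= nrm 0 xi * nrm (w *+ 2) xi.
Proof.
move=> w0 h; have h0 : fin 0 xi by apply: fin_mono h; rewrite mulrn_wge0.
apply: (@fin_sqleP _ _ _ _).2 => n.
have := psum_le_nrm n h; have := psum_le_nrm n h0.
rewrite !psumE => sx sy.
apply: le_trans (sum_mul_le (nrm_ge0 _ _) (nrm_ge0 _ _) sx sy).
apply: ler_sum => j _; rewrite expr0z mulr1 mulr2n expfzDr ?pnatr_eq0//.
rewrite le_eqVlt; apply/orP; left; apply/eqP; ring.
Qed.

End weighted_norms.

(** * The inner product of l2 *)

Section inner_product.
Context {R : realType}.
Local Notation C := R[i].

Lemma limn_le_cst (u : nat -> R) (l c : R) :
  u n @[n --> \oo] --> l -> (forall n, u n <= c) -> l <= c.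
Proof.
by move=> ul uc; rewrite -(cvg_lim _ ul)//; apply: limr_le;
   [apply/cvg_ex; exists l|exact: nearW].
Qed.

Lemma s_valD (u v : sspace R) : s_val (u + v) = s_val u + s_val v.
Proof. by []. Qed.
Lemma s_valZ a (u : sspace R) : s_val (a *: u) = a *: s_val u.
Proof. by []. Qed.
Lemma s_val0 : s_val (0 : sspace R) = 0.
Proof. by []. Qed.
Lemma l2_valD (u v : l2space R) : l2_val (u + v) = l2_val u + l2_val v.
Proof. by []. Qed.
Lemma l2_valZ a (u : l2space R) : l2_val (a *: u) = a *: l2_val u.
Proof. by []. Qed.
Lemma sdual_valD (u v : sdual R) : sdual_val (u + v) = sdual_val u + sdual_val v.
Proof. by []. Qed.
Lemma sdual_valZ a (u : sdual R) : sdual_val (a *: u) = a *: sdual_val u.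
Proof. by []. Qed.
Lemma s_val_inj : injective (@s_val R).
Proof. exact: val_inj. Qed.
Lemma l2_val_inj : injective (@l2_val R).
Proof. exact: val_inj. Qed.
Lemma sdual_val_inj : injective (@sdual_val R).
Proof. exact: val_inj. Qed.

Lemma s_fin q (u : sspace R) : fin q%:Z (s_val u).
Proof. by have /asboolP := s_valP u; exact. Qed.

Lemma l2_fin (u : l2space R) : fin 0 (l2_val u).
Proof. by have /asboolP := l2_valP u. Qed.

Lemma sdual_fin (u : sdual R) : exists q : nat, fin (- q%:Z) (sdual_val u).
Proof. by have /asboolP := sdual_valP u. Qed.

(** Here f is the real or the imaginary part. [inner] is made of two unguarded limits, so its
    linearity rests on this convergence. *)
Lemma inner_term_summable (xi eta : l2space R) (f : C -> R) :
  (forall z, `|f z| <= normc z) ->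
  cvgn (series (fun j => f (l2_val xi j * (l2_val eta j)^*%C))).
Proof.
move=> hf; apply: normed_cvg.
apply: nondecreasing_is_cvgn.
  by apply: nondecreasing_series => n _ _; exact: normr_ge0.
exists (nrm 0 (l2_val xi) * nrm 0 (l2_val eta)) => _ [n _ <-].
have := @sum_pairing_le _ 0 _ _ n (l2_fin xi).
rewrite oppr0 => /(_ _ (l2_fin eta)); apply: le_trans.
rewrite /series/=; apply: ler_sum => j _.
by apply: le_trans (hf _) _; rewrite normcM normc_conj.
Qed.

Lemma lim_series_eq (u v : nat -> R) : u =1 v ->
  limn (series u) = limn (series v).
Proof. by move=> /funext ->. Qed.

Lemma lim_seriesD (u v : nat -> R) : cvgn (series u) -> cvgn (series v) ->
  limn (series (fun j => u j + v j)) = limn (series u) + limn (series v).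
Proof.
move=> hu hv; rewrite -limD// (_ : series _ = series u \+ series v)//.
by apply/funext => n; rewrite /series/= big_split.
Qed.

Lemma seriesZ (a : R) (u : nat -> R) :
  series (fun j => a * u j) = (fun=> a) \* series u.
Proof. by apply/funext => n; rewrite /series/= -mulr_sumr. Qed.

Lemma cvg_seriesZ (a : R) (u : nat -> R) : cvgn (series u) ->
  cvgn (series (fun j => a * u j)).
Proof. by move=> hu; rewrite seriesZ; exact: is_cvgMr. Qed.

Lemma lim_seriesZ (a : R) (u : nat -> R) : cvgn (series u) ->
  limn (series (fun j => a * u j)) = a * limn (series u).
Proof.
move=> hu; rewrite seriesZ; apply/cvg_lim => //.
by apply: cvgM => //; exact: cvg_cst.
Qed.

Let ReP (xi eta : l2space R) := @inner_term_summable xi eta _ (@Re_le_normc R).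
Let ImP (xi eta : l2space R) := @inner_term_summable xi eta _ (@Im_le_normc R).

Lemma complex_ext (a b : C) : complex.Re a = complex.Re b ->
  complex.Im a = complex.Im b -> a = b.
Proof. by case: a b => [x y] [z t] /= -> ->. Qed.

Lemma Re_inner (xi eta : l2space R) : complex.Re (inner xi eta) =
  limn (series (fun j => complex.Re (l2_val xi j * (l2_val eta j)^*%C))).
Proof. by []. Qed.

Lemma Im_inner (xi eta : l2space R) : complex.Im (inner xi eta) =
  limn (series (fun j => complex.Im (l2_val xi j * (l2_val eta j)^*%C))).
Proof. by []. Qed.

Lemma innerDl (xi zeta eta : l2space R) :
  inner (xi + zeta) eta = inner xi eta + inner zeta eta.
Proof.
have E j : l2_val (xi + zeta) j * (l2_val eta j)^*%C =
    l2_val xi j * (l2_val eta j)^*%C + l2_val zeta j * (l2_val eta j)^*%C.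
  by rewrite l2_valD -mulrDl.
have ReD : {morph @complex.Re R : b c / b + c} by move=> [p q] [r s].
have ImD : {morph @complex.Im R : b c / b + c} by move=> [p q] [r s].
apply: complex_ext.
  rewrite ReD !Re_inner -(lim_seriesD (@ReP xi eta) (@ReP zeta eta)).
  by apply: lim_series_eq => j; rewrite E ReD.
rewrite ImD !Im_inner -(lim_seriesD (@ImP xi eta) (@ImP zeta eta)).
by apply: lim_series_eq => j; rewrite E ImD.
Qed.

Lemma innerZl a (xi eta : l2space R) : inner (a *: xi) eta = a * inner xi eta.
Proof.
have E j : l2_val (a *: xi) j * (l2_val eta j)^*%C = a * (l2_val xi j * (l2_val eta j)^*%C).
  by rewrite l2_valZ mulrA.
have ReE (b c : C) : complex.Re (b * c) =
  complex.Re b * complex.Re c + - complex.Im b * complex.Im c.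
  by case: b c => [p q] [r s]; rewrite mulNr.
have ImE (b c : C) : complex.Im (b * c) =
  complex.Re b * complex.Im c + complex.Im b * complex.Re c.
  by case: b c => [p q] [r s].
apply: complex_ext.
  rewrite ReE !Re_inner !Im_inner.
  rewrite -(lim_seriesZ _ (@ReP xi eta)) -(lim_seriesZ _ (@ImP xi eta)).
  rewrite -(lim_seriesD (cvg_seriesZ (@ReP xi eta)) (cvg_seriesZ (@ImP xi eta))).
  by apply: lim_series_eq => j; rewrite E ReE.
rewrite ImE !Re_inner !Im_inner.
rewrite -(lim_seriesZ _ (@ReP xi eta)) -(lim_seriesZ _ (@ImP xi eta)).
rewrite -(lim_seriesD (cvg_seriesZ (@ImP xi eta)) (cvg_seriesZ (@ReP xi eta))).
by apply: lim_series_eq => j; rewrite E ImE.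
Qed.

Lemma inner_conj (xi eta : l2space R) : inner eta xi = (inner xi eta)^*%C.
Proof.
rewrite /inner; apply: complex_ext => /=.
  apply: lim_series_eq => j.
  by case: (l2_val xi j) => a b; case: (l2_val eta j) => c d /=; ring.
rewrite -mulN1r -lim_seriesZ; last exact: ImP.
apply: lim_series_eq => j.
by case: (l2_val xi j) => a b; case: (l2_val eta j) => c d /=; ring.
Qed.

Lemma innerDr (xi zeta eta : l2space R) :
  inner eta (xi + zeta) = inner eta xi + inner eta zeta.
Proof. rewrite inner_conj innerDl (inner_conj xi) (inner_conj zeta); exact: rmorphD. Qed.

Lemma innerZr a (xi eta : l2space R) : inner eta (a *: xi) = a^*%C * inner eta xi.
Proof. rewrite inner_conj innerZl (inner_conj xi); exact: rmorphM. Qed.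

Lemma innerNl (xi eta : l2space R) : inner (- xi) eta = - inner xi eta.
Proof. by rewrite -scaleN1r innerZl mulN1r. Qed.

Lemma innerNr (xi eta : l2space R) : inner eta (- xi) = - inner eta xi.
Proof. by rewrite -scaleN1r innerZr rmorphN1 mulN1r. Qed.

Lemma innerBl (xi zeta eta : l2space R) :
  inner (xi - zeta) eta = inner xi eta - inner zeta eta.
Proof. by rewrite innerDl innerNl. Qed.

Lemma innerBr (xi zeta eta : l2space R) :
  inner eta (xi - zeta) = inner eta xi - inner eta zeta.
Proof. by rewrite innerDr innerNr. Qed.

Lemma inner0l (eta : l2space R) : inner 0 eta = 0.
Proof. by rewrite -(scale0r 0) innerZl mul0r. Qed.

Lemma inner0r (eta : l2space R) : inner eta 0 = 0.
Proof. by rewrite inner_conj inner0l rmorph0. Qed.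

Lemma inner_suml (I : Type) (r : seq I) (P : pred I) (F : I -> l2space R) eta :
  inner (\sum_(i <- r | P i) F i) eta = \sum_(i <- r | P i) inner (F i) eta.
Proof. by elim/big_rec2: _ => [|i y z _ <-]; rewrite ?inner0l ?innerDl. Qed.

Lemma inner_self (xi : l2space R) : inner xi xi = (nrm 0 (l2_val xi) ^+ 2)%:C%C.
Proof.
have termE j : l2_val xi j * (l2_val xi j)^*%C = (normc (l2_val xi j) ^+ 2)%:C%C.
  exact: mul_conj.
have psE : series (fun j => complex.Re (l2_val xi j * (l2_val xi j)^*%C)) =
    psum 0 (l2_val xi).
  apply/funext => n; rewrite /series/= /psum; apply: eq_bigr => j _.
  by rewrite termE/= mul0rn expr0z mulr1.
have cv := @ReP xi xi; rewrite psE in cv.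
rewrite /inner psE; apply: complex_ext => /=.
  apply/eqP; rewrite eq_le; apply/andP; split.
    by apply: (limn_le_cst cv) => n; exact: psum_le_nrm (l2_fin xi).
  apply: (@fin_sqleP _ _ _ _ _).2 => n; apply: nondecreasing_cvgn_le => //.
  apply/nondecreasing_seqP => m; rewrite /psum big_nat_recr//= lerDl.
  exact: psum_term_ge0.
rewrite (_ : series _ = fun=> 0) ?lim_cst//.
by apply/funext => n; rewrite /series/= big1// => j _; rewrite termE.
Qed.

(** The bound is passed to the limit for the squared modulus, as only the real and imaginary parts
    are known to converge. *)
Lemma inner_le w (xi eta : l2space R) : fin w (l2_val xi) ->
  fin (- w) (l2_val eta) ->
  normc (inner xi eta) <= nrm w (l2_val xi) * nrm (- w) (l2_val eta).
Proof.
move=> hx hy; have c0 : 0 <= nrm w (l2_val xi) * nrm (- w) (l2_val eta).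
  by rewrite mulr_ge0 ?nrm_ge0.
rewrite -ler_sqr ?nnegrE ?normc_ge0// normc_sq /inner/=.
set A := series _; set B := series _.
have cA : A n @[n --> \oo] --> limn A := @ReP xi eta.
have cB : B n @[n --> \oo] --> limn B := @ImP xi eta.
have cAB : (A n * A n + B n * B n) @[n --> \oo] --> limn A * limn A + limn B * limn B.
  by apply: cvgD; apply: cvgM.
apply: (limn_le_cst cAB) => n.
have -> : A n * A n + B n * B n =
    normc (\sum_(0 <= j < n) l2_val xi j * (l2_val eta j)^*%C) ^+ 2.
  by rewrite normc_sq !raddf_sum.
rewrite ler_sqr ?nnegrE ?normc_ge0//.
apply: le_trans (sum_pairing_le n hx hy).
elim: n => [|n IH]; first by rewrite !big_nil normc0.
rewrite !big_nat_recr//=; apply: le_trans (le_normcD _ _) _.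
by rewrite lerD// normcM normc_conj.
Qed.

Lemma cauchy_schwarz (xi eta : l2space R) :
  normc (inner xi eta) <= nrm 0 (l2_val xi) * nrm 0 (l2_val eta).
Proof.
by have := @inner_le 0 xi eta (l2_fin xi); rewrite oppr0; apply; exact: l2_fin.
Qed.

Lemma inner_self_eq0 (xi : l2space R) : inner xi xi = 0 -> xi = 0.
Proof.
rewrite inner_self => -[] /eqP; rewrite sqrf_eq0 => /eqP h.
by apply: l2_val_inj; apply: (nrm_eq0 (l2_fin xi)).
Qed.

Lemma inner_inj (xi zeta : l2space R) :
  (forall eta, inner xi eta = inner zeta eta) -> xi = zeta.
Proof.
move=> h; apply/eqP; rewrite -subr_eq0; apply/eqP/inner_self_eq0.
by rewrite innerBl h subrr.
Qed.

End inner_product.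

(** * Operators from s' to s *)

Section operators.
Context {R : realType}.
Local Notation C := R[i].
Local Notation op := (sdual R -> sspace R).
Implicit Types (x y z : op).

(** Truncations lie in s, hence in l2; they connect an arbitrary element of s' with the Hilbert
    space. *)
Definition trunc (N : nat) (xi : nat -> C) : nat -> C :=
  fun j => if (j < N)%N then xi j else 0.

Lemma fin_trunc w N xi : fin w (trunc N xi).
Proof.
apply: (@fin_sqleP _ w _ (psum w xi N) _).1.
have E n : psum w (trunc N xi) n = psum w xi (minn n N).
  elim: n => [|n IH]; first by rewrite min0n /psum !big_nil.
  rewrite {1}/psum big_nat_recr//= -/(psum w (trunc N xi) n) IH /trunc.
  case: ifPn => h; last first.
    move: h; rewrite -leqNgt => h.
    by rewrite normc0 expr0n mul0r addr0 (minn_idPr h) (minn_idPr (leqW h)).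
  by rewrite (minn_idPl h) (minn_idPl (ltnW h)) /psum [in RHS]big_nat_recr.
move=> n; rewrite E /psum [X in _ <= X](big_cat_nat (n := minn n N))//=; last exact: geq_minr.
by rewrite lerDl; apply: sumr_ge0 => j _; exact: psum_term_ge0.
Qed.

Lemma nrm_trunc w N xi : fin w xi -> nrm w (trunc N xi) <= nrm w xi.
Proof.
move=> h; apply: (@fin_leP _ _ _ _ (nrm_ge0 _ _) _).2 => n.
apply: le_trans (psum_le_nrm n h); apply: ler_sum => j _.
rewrite /trunc; case: ifP => // _.
by rewrite normc0 expr0n mul0r psum_term_ge0.
Qed.

(** Beyond N the weight j + 1 is at least N + 1, so lowering the exponent by one gains the factor 1
    / (N + 1), uniformly on bounded sets. *)
Lemma nrm_tail (w : int) N xi : fin w xi ->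
  nrm (w - 1) (xi - trunc N xi) <= nrm w xi / N.+1%:R.
Proof.
move=> h; have d0 : 0 <= nrm w xi / N.+1%:R by rewrite divr_ge0 ?nrm_ge0.
apply: (@fin_leP _ _ _ _ d0 _).2 => n.
rewrite expr_div_n ler_pdivlMr ?exprn_gt0//.
apply: le_trans (psum_le_nrm n h); rewrite !psumE mulr_suml.
apply: ler_sum => j _; rewrite -exprMn.
rewrite ler_sqr ?nnegrE ?mulr_ge0 ?normc_ge0 ?weight_ge0//.
have E : (xi - trunc N xi) j = xi j - trunc N xi j by [].
rewrite -mulrA E /trunc; case: ltnP => hj.
  by rewrite subrr normc0 mul0r mulr_ge0 ?normc_ge0 ?weight_ge0.
rewrite subr0 ler_wpM2l ?normc_ge0// expfzDr ?pnatr_eq0// -mulrA.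
by rewrite ler_piMr ?weight_ge0// mulrC ler_pdivrMr// mul1r ler_nat.
Qed.

Lemma trunc_in_s N xi : trunc N xi \in in_s.
Proof. by apply/asboolP => q; exact: fin_trunc. Qed.

Definition strunc N (xi : nat -> C) : sspace R := SSpace (trunc_in_s N xi).

Definition s_to_sdual (u : sspace R) : sdual R := l2_to_sdual (s_to_l2 u).

Lemma s_to_sdual_fin (w : int) u : fin w (sdual_val (s_to_sdual u)).
Proof.
apply: (@fin_mono _ w `|w|%N%:Z); last exact: s_fin.
by rewrite abszE ler_norm.
Qed.

Lemma linear_opD x (u v : sdual R) : linear x -> x (u + v) = x u + x v.
Proof. by move=> lx; have := lx 1 u v; rewrite !scale1r. Qed.

Lemma linear_op0 x : linear x -> x 0 = 0.
Proof.
by move=> lx; have := linear_opD 0 0 lx; rewrite addr0 => /eqP;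
   rewrite eq_sym -subr_eq0 addrK => /eqP.
Qed.

Lemma linear_opZ x a (u : sdual R) : linear x -> x (a *: u) = a *: x u.
Proof. by move=> lx; have := lx a u 0; rewrite !addr0 (linear_op0 lx) addr0. Qed.

Lemma linear_opN x (u : sdual R) : linear x -> x (- u) = - x u.
Proof. by move=> lx; rewrite -scaleN1r linear_opZ// scaleN1r. Qed.

Lemma linear_opB x (u v : sdual R) : linear x -> x (u - v) = x u - x v.
Proof. by move=> lx; rewrite linear_opD// linear_opN. Qed.

Definition opn q x : R := fine (op_norm q x).

Lemma op_norm_ge0 q x : (0 <= op_norm q x)%E.
Proof.
apply: (@le_trans _ _ (s_norm q (x 0))); first exact: wnorm_ge0.
apply: ereal_sup_ubound; exists 0 => //=.
by rewrite /sdual_norm wnormE ?nrm0 ?lee_fin//; exact: fin0.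
Qed.

Lemma opn_ge0 q x : 0 <= opn q x.
Proof. by rewrite fine_ge0// op_norm_ge0. Qed.

Lemma op_norm_le q x (c : R) : 0 <= c ->
  (forall eta, fin (- q%:Z) (sdual_val eta) ->
     nrm q%:Z (s_val (x eta)) <= c * nrm (- q%:Z) (sdual_val eta)) ->
  (op_norm q x <= c%:E)%E.
Proof.
move=> c0 h; apply: ge_ereal_sup => _ [eta /= e1 <-].
have f : fin (- q%:Z) (sdual_val eta) by apply: le_lt_trans e1 (ltry _).
rewrite /s_norm wnormE ?lee_fin; last exact: s_fin.
apply: le_trans (h _ f) _; rewrite ler_piMr//.
by move: e1; rewrite /sdual_norm wnormE.
Qed.

Lemma opnE q x : (op_norm q x < +oo)%E -> op_norm q x = (opn q x)%:E.
Proof. by move=> h; rewrite /opn fineK// ge0_fin_numE ?op_norm_ge0. Qed.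

(** Homogeneity, with an arbitrary radius d because continuity only provides a bound on some small
    sphere. *)
Lemma scaled_bound q x (d c : R) : linear x -> 0 < d -> 0 <= c ->
  (forall eta, fin (- q%:Z) (sdual_val eta) -> nrm (- q%:Z) (sdual_val eta) = d ->
     nrm q%:Z (s_val (x eta)) <= c) ->
  forall eta, fin (- q%:Z) (sdual_val eta) ->
    nrm q%:Z (s_val (x eta)) <= c / d * nrm (- q%:Z) (sdual_val eta).
Proof.
move=> lx d0 c0 h eta f.
have [e0|ne0] := eqVneq (nrm (- q%:Z) (sdual_val eta)) 0.
  have -> : eta = 0 by apply: sdual_val_inj; exact: nrm_eq0 e0.
  by rewrite linear_op0// s_val0 nrm0 mulr_ge0 ?nrm_ge0// divr_ge0// ltW.
have n0 : 0 < nrm (- q%:Z) (sdual_val eta) by rewrite lt_neqAle eq_sym ne0 nrm_ge0.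
set t := d / nrm (- q%:Z) (sdual_val eta).
have t0 : 0 < t by rewrite divr_gt0.
have := h (t%:C%C *: eta); rewrite sdual_valZ nrmZ// normc_real gtr0_norm//.
rewrite linear_opZ// s_valZ nrmZ ?s_fin// normc_real gtr0_norm//.
rewrite divfK// => /(_ (finZ _ f) erefl).
rewrite -ler_pdivlMl// invf_div => /le_trans; apply.
by rewrite mulrC mulrA mulrAC.
Qed.

Lemma op_bound q x : linear x -> (op_norm q x < +oo)%E ->
  forall eta, fin (- q%:Z) (sdual_val eta) ->
    nrm q%:Z (s_val (x eta)) <= opn q x * nrm (- q%:Z) (sdual_val eta).
Proof.
move=> lx h eta f; rewrite -[opn q x]divr1.
apply: scaled_bound => //; first exact: opn_ge0.
move=> zeta fz z1; rewrite -lee_fin -opnE// -wnormE; last exact: s_fin.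
by apply: ereal_sup_ubound; exists zeta => //=; rewrite /sdual_norm wnormE// z1.
Qed.

Lemma Lss_linear x : Lss x -> linear x.
Proof. by case. Qed.

Lemma Lss_op_norm q x : Lss x -> (op_norm q x < +oo)%E.
Proof.
move=> [lx cx].
pose U := [set y : sspace R | forall k, (k <= q)%N -> (s_norm k (y - x 0)%R < 1%:E)%E].
have HU : seminorm_nbhs s_norm (x 0) U by exists q, 1; split.
have [V [_ Vb VU]] := cx 0 U HU.
have [e e0 eV] := Vb q.
(* V contains the open ball of radius e of the q-th step, hence its sphere of radius e / 2. *)
have sb : forall eta, fin (- q%:Z) (sdual_val eta) ->
    nrm q%:Z (s_val (x eta)) <= 1 / (e / 2) * nrm (- q%:Z) (sdual_val eta).
  apply: scaled_bound => //; first by rewrite divr_gt0.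
  move=> eta f n_eta.
  have /VU/(_ q (leqnn q)) : [set 0 + eta | eta in V] eta.
    exists eta; last by rewrite add0r.
    apply: eV; rewrite /= /sdual_norm wnormE// n_eta lte_fin.
    by rewrite ltr_pdivrMr// ltr_pMr// ltr1n.
  rewrite linear_op0// subr0 /s_norm wnormE ?lte_fin; last exact: s_fin.
  exact: ltW.
apply: le_lt_trans (op_norm_le _ sb) (ltry _).
by rewrite divr_ge0// divr_ge0// ltW.
Qed.

Lemma Lss_bound q x eta : Lss x -> fin (- q%:Z) (sdual_val eta) ->
  nrm q%:Z (s_val (x eta)) <= opn q x * nrm (- q%:Z) (sdual_val eta).
Proof. by move=> Lx f; apply: op_bound (Lss_linear Lx) (Lss_op_norm _ Lx) _ f. Qed.

Lemma s_norm_real q (u : sspace R) : s_norm q u = (nrm q%:Z (s_val u))%:E.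
Proof. by rewrite /s_norm wnormE//; exact: s_fin. Qed.

(** The preimage of a seminorm ball is absolutely convex and contains a ball of each step, which is
    what the inductive limit topology asks for. *)
Lemma Lss_intro x : linear x -> (forall q, (op_norm q x < +oo)%E) -> Lss x.
Proof.
move=> lx bx; split => // xi U [r [e [e0 HU]]].
exists [set eta | forall k, (k <= r)%N -> (s_norm k (x eta) < e%:E)%E]; split.
- split.
    by exists 0 => k _; rewrite linear_op0// s_norm_real s_val0 nrm0 lte_fin.
  move=> a b u v; rewrite !normr_normc -raddfD/= lecR => ab Vu Vv k kr.
  have := Vu k kr; have := Vv k kr; rewrite !s_norm_real !lte_fin.
  rewrite linear_opD// !linear_opZ// s_valD !s_valZ.
  have fu := s_fin k (x u); have fv := s_fin k (x v).
  have := nrmD (finZ a fu) (finZ b fv); rewrite !nrmZ// => le1 lv lu.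
  apply: le_lt_trans le1 _.
  set p := nrm _ (s_val (x u)) in lu *; set p' := nrm _ (s_val (x v)) in lv *.
  have hm : Num.max p p' < e by rewrite gt_max lu lv.
  have h1 : normc a * p <= normc a * Num.max p p'.
    by rewrite ler_wpM2l ?normc_ge0// le_max lexx.
  have h2 : normc b * p' <= normc b * Num.max p p'.
    by rewrite ler_wpM2l ?normc_ge0// le_max lexx orbT.
  have h3 : (normc a + normc b) * Num.max p p' <= Num.max p p'.
    by rewrite ler_piMl// le_max nrm_ge0.
  lra.
(* The index Q serves both sides: [s_norm Q] dominates the seminorms up to r, and [sdual_norm Q] is
   dominated by [sdual_norm q]. *)
- move=> q; pose Q := maxn q r; have M0 := opn_ge0 Q x.
  have M1 : 0 < opn Q x + 1 by lra.
  exists (e / (opn Q x + 1)); first by rewrite divr_gt0.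
  move=> eta /= h k kr.
  have f : fin (- q%:Z) (sdual_val eta) by apply: lt_le_trans h (leey _).
  have qQ : - Q%:Z <= - q%:Z by rewrite lerN2 lez_nat leq_maxl.
  have fQ := fin_mono qQ f.
  move: h; rewrite /sdual_norm wnormE// lte_fin ltr_pdivlMr// => h.
  rewrite s_norm_real lte_fin; apply: le_lt_trans h.
  apply: (@le_trans _ _ (nrm Q%:Z (s_val (x eta)))).
    by apply: nrm_mono (s_fin _ _); rewrite lez_nat (leq_trans kr)// leq_maxr.
  apply: le_trans (op_bound lx (bx Q) fQ) _.
  rewrite mulrC; apply: ler_pM; rewrite ?nrm_ge0//; last lra.
  exact: nrm_mono.
- move=> _ [eta Veta <-]; apply: HU => k kr.
  by rewrite linear_opD// addrC addKr; exact: Veta.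
Qed.

Lemma opn_le q x (c : R) : 0 <= c ->
  (forall eta, fin (- q%:Z) (sdual_val eta) ->
     nrm q%:Z (s_val (x eta)) <= c * nrm (- q%:Z) (sdual_val eta)) ->
  opn q x <= c.
Proof.
move=> c0 h; have h1 := op_norm_le c0 h.
by rewrite -lee_fin -opnE//; apply: le_lt_trans h1 (ltry _).
Qed.

Lemma Lss_bounded x (c : nat -> R) : linear x -> (forall q, 0 <= c q) ->
  (forall q eta, fin (- q%:Z) (sdual_val eta) ->
     nrm q%:Z (s_val (x eta)) <= c q * nrm (- q%:Z) (sdual_val eta)) ->
  Lss x.
Proof.
move=> lx c0 h; apply: Lss_intro => // q.
by apply: le_lt_trans (op_norm_le (c0 q) (h q)) (ltry _).
Qed.

Lemma op_addE x y eta : (x + y) eta = x eta + y eta.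
Proof. by []. Qed.
Lemma op_scaleE a x eta : (a *: x) eta = a *: x eta.
Proof. by []. Qed.
Lemma op_subE x y eta : (x - y) eta = x eta - y eta.
Proof. by []. Qed.
Lemma op_0E eta : (0 : op) eta = 0.
Proof. by []. Qed.

Lemma Lss_lin a x y : Lss x -> Lss y -> Lss (a *: x + y).
Proof.
move=> Lx Ly; have lx := Lss_linear Lx; have ly := Lss_linear Ly.
apply: (@Lss_bounded _ (fun q => normc a * opn q x + opn q y)).
- move=> b u v; rewrite !op_addE !op_scaleE lx ly.
  rewrite !scalerDr !scalerA [a * b]mulrC -!addrA; congr (_ + _).
  by rewrite addrCA.
- by move=> q; rewrite addr_ge0 ?opn_ge0// mulr_ge0 ?opn_ge0 ?normc_ge0.
- move=> q eta f; rewrite op_addE op_scaleE s_valD s_valZ.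
  apply: le_trans (nrmD (finZ _ (s_fin _ _)) (s_fin _ _)) _.
  rewrite nrmZ ?s_fin// mulrDl -mulrA; apply: lerD; last exact: Lss_bound.
  by rewrite ler_wpM2l ?normc_ge0//; exact: Lss_bound.
Qed.

Lemma linear_op_null : linear (0 : op).
Proof. by move=> a u v; rewrite !op_0E scaler0 addr0. Qed.

Lemma Lss0 : Lss (0 : op).
Proof.
apply: (@Lss_bounded _ (fun=> 0)) => // [|q eta f]; first exact: linear_op_null.
by rewrite op_0E s_val0 nrm0 mul0r.
Qed.

Lemma LssZ a x : Lss x -> Lss (a *: x).
Proof. by move=> Lx; rewrite -[_ *: _]addr0; exact: Lss_lin Lx Lss0. Qed.

Lemma LssD x y : Lss x -> Lss y -> Lss (x + y).
Proof. by move=> Lx Ly; rewrite -[x]scale1r; exact: Lss_lin. Qed.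

Lemma LssB x y : Lss x -> Lss y -> Lss (x - y).
Proof. by move=> Lx Ly; rewrite addrC -scaleN1r; exact: Lss_lin. Qed.

Lemma Lss_sum (I : Type) (r : seq I) (P : pred I) (F : I -> op) :
  (forall i, P i -> Lss (F i)) -> Lss (\sum_(i <- r | P i) F i).
Proof.
by move=> h; elim/big_rec: _ => [|i y Pi Ly]; [exact: Lss0|exact: LssD (h i Pi) Ly].
Qed.

Lemma opnZ q a x : Lss x -> opn q (a *: x) <= normc a * opn q x.
Proof.
move=> Lx; apply: opn_le => [|eta f]; first by rewrite mulr_ge0 ?normc_ge0 ?opn_ge0.
rewrite op_scaleE s_valZ nrmZ ?s_fin// -mulrA.
by rewrite ler_wpM2l ?normc_ge0//; exact: Lss_bound.
Qed.

Lemma opnZE q a x : Lss x -> opn q (a *: x) = normc a * opn q x.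
Proof.
move=> Lx; apply/eqP; rewrite eq_le opnZ//=.
have [->|a0] := eqVneq a 0; first by rewrite normc0 mul0r opn_ge0.
rewrite -ler_pdivlMl ?normc_gt0// -normcV.
by have := opnZ q a^-1 (LssZ a Lx); rewrite scalerA mulVf// scale1r.
Qed.

Lemma opnD q x y : Lss x -> Lss y -> opn q (x + y) <= opn q x + opn q y.
Proof.
move=> Lx Ly; apply: opn_le => [|eta f]; first by rewrite addr_ge0 ?opn_ge0.
rewrite op_addE s_valD.
apply: le_trans (nrmD (s_fin _ _) (s_fin _ _)) _.
by rewrite mulrDl lerD//; exact: Lss_bound.
Qed.

Lemma opn0 q : opn q 0 = 0.
Proof.
apply/eqP; rewrite eq_le opn_ge0 andbT; apply: opn_le => // eta _.
by rewrite op_0E s_val0 nrm0 mul0r.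
Qed.

Lemma opnN q x : Lss x -> opn q (- x) = opn q x.
Proof. by move=> Lx; rewrite -scaleN1r opnZE// normc_opp normc1 mul1r. Qed.

Lemma opnB q x y : Lss x -> Lss y -> opn q (x - y) <= opn q x + opn q y.
Proof.
move=> Lx Ly; have LNy : Lss (- y) by rewrite -scaleN1r; exact: LssZ.
by have := opnD q Lx LNy; rewrite (opnN q Ly).
Qed.

Lemma opn_distC q x y : Lss x -> Lss y -> opn q (x - y) = opn q (y - x).
Proof. by move=> Lx Ly; rewrite -opprB; exact: opnN (LssB Ly Lx). Qed.

Lemma opn_mono p q x : (p <= q)%N -> Lss x -> opn p x <= opn q x.
Proof.
move=> pq Lx; apply: opn_le => [|eta f]; first exact: opn_ge0.
have pq' : - q%:Z <= - p%:Z by rewrite lerN2 lez_nat.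
apply: (@le_trans _ _ (nrm q%:Z (s_val (x eta)))).
  by apply: nrm_mono (s_fin _ _); rewrite lez_nat.
apply: le_trans (Lss_bound Lx (fin_mono pq' f)) _.
by rewrite ler_wpM2l ?opn_ge0//; exact: nrm_mono.
Qed.

Lemma op_mulE x y eta : op_mul x y eta = x (s_to_sdual (y eta)).
Proof. by []. Qed.

Lemma op_mulA x y z : op_mul x (op_mul y z) = op_mul (op_mul x y) z.
Proof. by []. Qed.

Lemma s_to_sdual_linear a u v :
  s_to_sdual (a *: u + v) = a *: s_to_sdual u + s_to_sdual v.
Proof. exact: sdual_val_inj. Qed.

Lemma op_mulDl x y z : op_mul (x + y) z = op_mul x z + op_mul y z.
Proof. by []. Qed.
Lemma op_mulZl a x z : op_mul (a *: x) z = a *: op_mul x z.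
Proof. by []. Qed.
Lemma op_mulBl x y z : op_mul (x - y) z = op_mul x z - op_mul y z.
Proof. by []. Qed.
Lemma op_mul_linr x a y z : Lss x ->
  op_mul x (a *: y + z) = a *: op_mul x y + op_mul x z.
Proof.
move=> /Lss_linear lx; apply/funext => eta.
by rewrite op_mulE s_to_sdual_linear lx.
Qed.

Lemma op_mulDr x y z : Lss x -> op_mul x (y + z) = op_mul x y + op_mul x z.
Proof. by move=> Lx; rewrite -[y in LHS]scale1r op_mul_linr// scale1r. Qed.

Lemma op_mul0r x : Lss x -> op_mul x 0 = 0.
Proof.
move=> Lx; have := op_mulDr 0 0 Lx; rewrite addr0 => /eqP.
by rewrite eq_sym -subr_eq0 addrK => /eqP.
Qed.

Lemma op_mulZr x a y : Lss x -> op_mul x (a *: y) = a *: op_mul x y.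
Proof. by move=> Lx; rewrite -[_ *: _]addr0 op_mul_linr// op_mul0r// addr0. Qed.

Lemma op_mulNr x y : Lss x -> op_mul x (- y) = - op_mul x y.
Proof. by move=> Lx; rewrite -scaleN1r op_mulZr// scaleN1r. Qed.

Lemma op_mulBr x y z : Lss x -> op_mul x (y - z) = op_mul x y - op_mul x z.
Proof. by move=> Lx; rewrite op_mulDr// op_mulNr. Qed.

Lemma op_mul_suml x (I : Type) (r : seq I) (P : pred I) (F : I -> op) :
  op_mul (\sum_(i <- r | P i) F i) x = \sum_(i <- r | P i) op_mul (F i) x.
Proof. by elim/big_rec2: _ => [|i y z _ <-]. Qed.

(** Both the output of y and the input of x are controlled through l2, so the middle factor only
    costs its l2-operator norm. *)
Lemma op_bound_mul3 q x z y eta : Lss x -> Lss z -> Lss y ->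
  fin (- q%:Z) (sdual_val eta) ->
  nrm q%:Z (s_val (op_mul x (op_mul z y) eta)) <=
    opn q x * opn 0 z * opn q y * nrm (- q%:Z) (sdual_val eta).
Proof.
move=> Lx Lz Ly f; rewrite op_mulE.
apply: le_trans (Lss_bound Lx (s_to_sdual_fin _ _)) _.
rewrite -!mulrA ler_wpM2l ?opn_ge0//.
have le0 : nrm (- q%:Z) (s_val (op_mul z y eta)) <= nrm 0 (s_val (op_mul z y eta)).
  by apply: nrm_mono (s_fin 0 _); rewrite oppr_le0.
apply: le_trans le0 _; rewrite op_mulE.
apply: le_trans (Lss_bound (q := 0) Lz (s_to_sdual_fin _ _)) _.
rewrite ler_wpM2l ?opn_ge0// oppr0.
apply: le_trans (Lss_bound Ly f).
by apply: nrm_mono (s_fin _ _).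
Qed.

Lemma opn_mul3 q x z y : Lss x -> Lss z -> Lss y ->
  opn q (op_mul x (op_mul z y)) <= opn q x * opn 0 z * opn q y.
Proof.
move=> Lx Lz Ly; apply: opn_le => [|eta f]; first by rewrite !mulr_ge0 ?opn_ge0.
exact: op_bound_mul3.
Qed.

Lemma op_bound_mul q x y eta : Lss x -> Lss y -> fin (- q%:Z) (sdual_val eta) ->
  nrm q%:Z (s_val (op_mul x y eta)) <=
    opn q x * opn q y * nrm (- q%:Z) (sdual_val eta).
Proof.
move=> Lx Ly f; rewrite op_mulE.
apply: le_trans (Lss_bound Lx (s_to_sdual_fin _ _)) _.
rewrite -!mulrA ler_wpM2l ?opn_ge0//.
apply: le_trans (Lss_bound Ly f).
by apply: nrm_mono (s_fin _ _); rewrite lerNl (@le_trans _ _ 0)// oppr_le0.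
Qed.

Lemma opn_mul q x y : Lss x -> Lss y -> opn q (op_mul x y) <= opn q x * opn q y.
Proof.
move=> Lx Ly; apply: opn_le => [|eta f]; first by rewrite !mulr_ge0 ?opn_ge0.
exact: op_bound_mul.
Qed.

Lemma Lss_mul x y : Lss x -> Lss y -> Lss (op_mul x y).
Proof.
move=> Lx Ly; apply: (@Lss_bounded _ (fun q => opn q x * opn q y)).
- move=> a u v; rewrite !op_mulE (Lss_linear Ly) s_to_sdual_linear.
  exact: (Lss_linear Lx).
- by move=> q; rewrite mulr_ge0 ?opn_ge0.
- by move=> q eta f; exact: op_bound_mul.
Qed.

Lemma ler_add_inv (a c K : R) : (forall N : nat, a <= c + K / N.+1%:R) -> a <= c.
Proof.
move=> h; rewrite -subr_ge0; rewrite leNgt; apply/negP => ac.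
have d0 : 0 < a - c by lra.
have := h (Num.truncn (`|K| / (a - c))).
have K0 : 0 <= `|K| / (a - c) by rewrite divr_ge0// ltW.
have /andP[_] := Num.Theory.truncn_itv K0.
set N := Num.truncn _ => hN hK.
have N0 : 0 < N.+1%:R :> R by [].
have : `|K| < N.+1%:R * (a - c) by rewrite -ltr_pdivrMr.
have : (a - c) * N.+1%:R <= K by rewrite -ler_pdivlMr// lerBlDl.
by have := ler_norm K; lra.
Qed.

(** The tail is small only in the dual norm of index q + 1, so x has to be estimated with that
    index. *)
Lemma trunc_density q N x eta : Lss x -> fin (- q%:Z) (sdual_val eta) ->
  nrm q%:Z (s_val (x eta - x (s_to_sdual (strunc N (sdual_val eta))))) <=
    opn q.+1 x * nrm (- q%:Z) (sdual_val eta) / N.+1%:R.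
Proof.
move=> Lx f; rewrite -linear_opB; last exact: Lss_linear.
set z := eta - _.
have zE : sdual_val z = sdual_val eta - trunc N (sdual_val eta) by [].
have qS : - q.+1%:Z = - q%:Z - 1 by rewrite -addn1 PoszD opprD.
have fz : fin (- q.+1%:Z) (sdual_val z).
  by rewrite zE; apply: finB; [apply: fin_mono f; rewrite lerN2 lez_nat|exact: fin_trunc].
apply: (@le_trans _ _ (nrm q.+1%:Z (s_val (x z)))).
  by apply: nrm_mono (s_fin _ _); rewrite lez_nat.
apply: le_trans (Lss_bound Lx fz) _; rewrite -mulrA ler_wpM2l ?opn_ge0//.
by rewrite zE qS; exact: nrm_tail.
Qed.

Lemma trunc_le q x eta (c : R) : Lss x -> fin (- q%:Z) (sdual_val eta) ->
  (forall N, nrm q%:Z (s_val (x (s_to_sdual (strunc N (sdual_val eta))))) <= c) ->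
  nrm q%:Z (s_val (x eta)) <= c.
Proof.
move=> Lx f h; apply: (@ler_add_inv _ _ (opn q.+1 x * nrm (- q%:Z) (sdual_val eta))) => N.
have := trunc_density N Lx f; set v := x (s_to_sdual _) => hd.
rewrite -[x eta](subrK v) s_valD.
apply: le_trans (nrmD (s_fin _ _) (s_fin _ _)) _.
by rewrite addrC; apply: lerD => //; exact: h.
Qed.

(** It suffices to test a norm on finitely supported sequences, where the inner product of l2 is
    available. *)
Lemma opn_le_trunc q x (c : R) : 0 <= c -> Lss x ->
  (forall N eta, let u := s_to_sdual (strunc N eta) in
    nrm q%:Z (s_val (x u)) <= c * nrm (- q%:Z) (sdual_val u)) ->
  opn q x <= c.
Proof.
move=> c0 Lx h; apply: opn_le => // eta f; apply: trunc_le => // N.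
by apply: le_trans (h _ _) _; rewrite ler_wpM2l//; exact: nrm_trunc.
Qed.

Lemma Lss_eq0 x : Lss x -> (forall u, x (s_to_sdual u) = 0) -> x = 0.
Proof.
move=> Lx h; apply/funext => eta; have [q f] := sdual_fin eta.
rewrite op_0E; apply: s_val_inj; rewrite s_val0.
apply: (nrm_eq0 (s_fin q (x eta))); apply/eqP; rewrite eq_le nrm_ge0 andbT.
by apply: trunc_le => // N; rewrite h s_val0 nrm0.
Qed.

Lemma Lss_ext x y : Lss x -> Lss y ->
  (forall u, x (s_to_sdual u) = y (s_to_sdual u)) -> x = y.
Proof.
move=> Lx Ly h; apply/eqP; rewrite -subr_eq0; apply/eqP/Lss_eq0.
  exact: LssB.
by move=> u; rewrite op_subE h subrr.
Qed.

Lemma opn0_eq0 x : Lss x -> opn 0 x = 0 -> x = 0.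
Proof.
move=> Lx h; apply: Lss_eq0 => // u; apply: s_val_inj; rewrite s_val0.
apply: (nrm_eq0 (s_fin 0 _)); apply/eqP; rewrite eq_le nrm_ge0 andbT.
by apply: le_trans (Lss_bound (q := 0) Lx (s_to_sdual_fin _ _)) _; rewrite h mul0r.
Qed.

(** On [Lss] this agrees with convergence for [seminorm_nbhs op_norm]; one q at a time is enough
    since the norms increase with q. *)
Definition opcvg (u : nat -> op) x :=
  forall q (e : R), 0 < e -> exists N, forall n, (N <= n)%N -> opn q (u n - x) < e.

Definition opcauchy (u : nat -> op) :=
  forall q (e : R), 0 < e -> exists N, forall n m, (N <= n)%N -> (N <= m)%N ->
    opn q (u n - u m) < e.

Lemma opcvg_nbhs (u : nat -> op) x : (forall n, Lss (u n)) -> Lss x -> opcvg u x ->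
  u n @[n --> \oo] --> seminorm_nbhs op_norm x.
Proof.
move=> Lu Lx h U [r [e [e0 HU]]]; have [N hN] := h r e e0.
exists N => // n /= Nn; apply: HU => k kr.
have L : Lss (u n - x) by exact: LssB.
rewrite opnE ?lte_fin; last exact: Lss_op_norm.
exact: le_lt_trans (opn_mono kr L) (hN _ Nn).
Qed.

Lemma nbhs_opcvg (u : nat -> op) x : (forall n, Lss (u n)) -> Lss x ->
  u n @[n --> \oo] --> seminorm_nbhs op_norm x -> opcvg u x.
Proof.
move=> Lu Lx h q e e0.
have /h[N _ hN] : seminorm_nbhs op_norm x [set y | (op_norm q (y - x)%R < e%:E)%E].
  by exists q, e; split => // y; apply.
exists N => n /hN /=; rewrite opnE ?lte_fin//.
by apply: Lss_op_norm; exact: LssB.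
Qed.

Lemma opcvg_closed (A : set op) (u : nat -> op) x : closed_in_Lss A ->
  A `<=` Lss -> (forall n, A (u n)) -> Lss x -> opcvg u x -> A x.
Proof.
move=> cA AL Au Lx h; apply: cA => // U /(opcvg_nbhs (fun n => AL _ (Au n)) Lx h).
by move=> [N _ hN]; exists (u N); split => //; exact: hN (leqnn N).
Qed.

Lemma opcvg_unique (u : nat -> op) x y : (forall n, Lss (u n)) -> Lss x -> Lss y ->
  opcvg u x -> opcvg u y -> x = y.
Proof.
move=> Lu Lx Ly hx hy; apply/eqP; rewrite -subr_eq0; apply/eqP/opn0_eq0.
  exact: LssB.
apply/eqP; rewrite eq_le opn_ge0 andbT leNgt; apply/negP => e0.
have e2 : 0 < opn 0 (x - y) / 2 by rewrite divr_gt0.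
have [N hN] := hx 0 _ e2; have [M hM] := hy 0 _ e2.
have := hN (maxn N M) (leq_maxl _ _); have := hM (maxn N M) (leq_maxr _ _).
set v := u _ => h1 h2.
have : opn 0 (x - y) <= opn 0 (v - y) + opn 0 (v - x).
  rewrite -[x - y](_ : (v - y) - (v - x) = _); last by rewrite opprB addrC addrA subrK.
  by have Lv : Lss v := Lu _; apply: opnB; exact: LssB.
by move=> /le_lt_trans/(_ (ltrD h1 h2)); rewrite -splitr ltxx.
Qed.

End operators.

(** * Completeness and bounded sequences in L(s', s) *)

Section completeness.
Context {R : realType}.
Local Notation C := R[i].
Local Notation op := (sdual R -> sspace R).
Implicit Types (x y z : op).

Lemma real_cauchy_cvg (u : nat -> R) :
  (forall e : R, 0 < e -> exists N, forall n m, (N <= n)%N -> (N <= m)%N ->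
    `|u n - u m| <= e) ->
  u n @[n --> \oo] --> limn u.
Proof.
move=> h; apply: (@cauchy_cvg R^o); apply: cauchy_exP => e e0.
have [N hN] := h (e / 2) (divr_gt0 e0 (ltr0Sn _ 1)).
exists (u N); exists N => // n /= nN; rewrite /ball/=.
by apply: le_lt_trans (hN _ _ (leqnn N) nN) _; rewrite ltr_pdivrMr// ltr_pMr// ltr1n.
Qed.

Definition complex_lim (u : nat -> C) : C :=
  Complex (limn (fun n => complex.Re (u n))) (limn (fun n => complex.Im (u n))).

(** Only k coordinates are involved, so coordinatewise convergence suffices. Thus a bound on
    [u n - u m] is inherited by the limit minus [u m]. *)
Lemma psum_lim_le w (u : nat -> nat -> C) (v : nat -> C) k (c : R) N :
  (forall j (e : R), 0 < e -> exists N, forall n m, (N <= n)%N -> (N <= m)%N ->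
    normc (u n j - u m j) <= e) ->
  (forall n, (N <= n)%N -> psum w (u n - v) k <= c) ->
  psum w ((fun j => complex_lim (u ^~ j)) - v) k <= c.
Proof.
move=> hC hN.
have cvRe j : complex.Re (u n j) @[n --> \oo] --> limn (fun n => complex.Re (u n j)).
  apply: real_cauchy_cvg => e e0; have [M hM] := hC j e e0.
  exists M => n m nM mM; apply: le_trans (hM n m nM mM).
  by rewrite -raddfB; exact: Re_le_normc.
have cvIm j : complex.Im (u n j) @[n --> \oo] --> limn (fun n => complex.Im (u n j)).
  apply: real_cauchy_cvg => e e0; have [M hM] := hC j e e0.
  exists M => n m nM mM; apply: le_trans (hM n m nM mM).
  by rewrite -raddfB; exact: Im_le_normc.
set l := fun j => complex_lim (u ^~ j).
have cv : psum w (u n - v) k @[n --> \oo] --> psum w (l - v) k.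
  rewrite /psum; elim: k {hN} => [|k IH].
    under eq_fun do rewrite big_nil; rewrite big_nil; exact: cvg_cst.
  under eq_fun do rewrite big_nat_recr//=; rewrite big_nat_recr//=.
  apply: cvgD => //; apply: cvgM; last exact: cvg_cst.
  have E (a : nat -> C) : normc ((a - v) k) ^+ 2 =
      (complex.Re (a k) - complex.Re (v k)) ^+ 2 +
      (complex.Im (a k) - complex.Im (v k)) ^+ 2.
    by rewrite normc_sq -[complex.Re _ - _]raddfB -[complex.Im _ - _]raddfB.
  under eq_fun do rewrite E; rewrite E.
  apply: cvgD.
    by apply: cvgM; (apply: cvgB; [exact: cvRe|exact: cvg_cst]).
  by apply: cvgM; (apply: cvgB; [exact: cvIm|exact: cvg_cst]).
rewrite -(cvg_lim _ cv)//; apply: limr_le; first by apply/cvg_ex; eexists; exact: cv.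
by exists N => // n; exact: hN.
Qed.

(** Completeness of L(s', s), by coordinatewise limits. The estimate [keyE] yields membership in s,
    linearity, boundedness and convergence. *)
Lemma opcauchy_cvg (u : nat -> op) : (forall n, Lss (u n)) -> opcauchy u ->
  exists2 x, Lss x & opcvg u x.
Proof.
move=> Lu hu.
have hC eta j (e : R) : 0 < e -> exists N, forall n m, (N <= n)%N -> (N <= m)%N ->
    normc (s_val (u n eta) j - s_val (u m eta) j) <= e.
  move=> e0; have [q f] := sdual_fin eta.
  have K1 : 0 < nrm (- q%:Z) (sdual_val eta) + 1 by rewrite ltr_wpDl ?nrm_ge0.
  have [N hN] := hu q _ (divr_gt0 e0 K1).
  exists N => n m nN mN; have Lnm : Lss (u n - u m) by exact: LssB.
  have := coord_le_nrm j (s_fin q ((u n - u m) eta)).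
  have := Lss_bound Lnm f.
  have := hN n m nN mN; rewrite ltr_pdivlMr// => h1 h2 h3.
  apply: (@le_trans _ _ (normc (s_val (u n eta) j - s_val (u m eta) j) * j.+1%:R ^ q%:Z)).
    by rewrite ler_peMr ?normc_ge0// (exprn_ege1 q)// ler1n.
  apply: le_trans h3 _; apply: le_trans h2 _; apply: ltW; apply: le_lt_trans h1.
  by rewrite ler_wpM2l ?opn_ge0// lerDl.
pose lv eta : nat -> C := fun j => complex_lim (fun n => s_val (u n eta) j).
have key q (e : R) N : 0 <= e ->
    (forall n m, (N <= n)%N -> (N <= m)%N -> opn q (u n - u m) <= e) ->
    forall eta m, fin (- q%:Z) (sdual_val eta) -> (N <= m)%N ->
    fin q%:Z (lv eta - s_val (u m eta)) /\
    nrm q%:Z (lv eta - s_val (u m eta)) <= e * nrm (- q%:Z) (sdual_val eta).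
  move=> e0 hN eta m f mN; apply: fin_leP; first by rewrite mulr_ge0 ?nrm_ge0.
  move=> k; apply: (@psum_lim_le _ (fun n => s_val (u n eta)) _ _ _ N).
    exact: hC.
  move=> n nN; have Lnm : Lss (u n - u m) by exact: LssB.
  apply: le_trans (psum_le_nrm k (s_fin q ((u n - u m) eta))) _.
  rewrite ler_sqr ?nnegrE ?nrm_ge0 ?mulr_ge0 ?nrm_ge0//.
  apply: le_trans (Lss_bound Lnm f) _.
  by rewrite ler_wpM2r ?nrm_ge0//; exact: hN.
have keyE q (e : R) : 0 < e -> exists N, forall eta m,
    fin (- q%:Z) (sdual_val eta) -> (N <= m)%N ->
    fin q%:Z (lv eta - s_val (u m eta)) /\
    nrm q%:Z (lv eta - s_val (u m eta)) <= e * nrm (- q%:Z) (sdual_val eta).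
  move=> e0; have [N hN] := hu q e e0; exists N; apply: key => [|n m nN mN].
    exact: ltW.
  exact/ltW/hN.
have lv_s eta : lv eta \in in_s.
  apply/asboolP => q; have [r f] := sdual_fin eta.
  have [N /(_ eta N)] := keyE (maxn q r) 1 ltr01.
  case=> //; first by apply: fin_mono f; rewrite lerN2 lez_nat leq_maxr.
  move=> f1 _; apply: (@fin_mono _ _ (maxn q r)%:Z); first by rewrite lez_nat leq_maxl.
  by rewrite -[lv eta](subrK (s_val (u N eta))); apply: finD => //; exact: s_fin.
pose x eta : sspace R := SSpace (lv_s eta).
have lx : linear x.
  move=> a eta zeta; apply/eqP; rewrite -subr_eq0; apply/eqP.
  set d := x _ - _; apply: s_val_inj; rewrite s_val0.
  have [q1 f1] := sdual_fin eta; have [q2 f2] := sdual_fin zeta.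
  pose q := maxn q1 q2.
  have {}f1 : fin (- q%:Z) (sdual_val eta).
    by apply: fin_mono f1; rewrite lerN2 lez_nat leq_maxl.
  have {}f2 : fin (- q%:Z) (sdual_val zeta).
    by apply: fin_mono f2; rewrite lerN2 lez_nat leq_maxr.
  have f3 : fin (- q%:Z) (sdual_val (a *: eta + zeta)).
    by rewrite sdual_valD; apply: finD => //; exact: finZ.
  apply: (nrm_eq0 (s_fin q d)); apply/eqP; rewrite eq_le nrm_ge0 andbT.
  (* Each approximation error is at most 1 / (M + 1) times a dual norm, so the defect d of linearity
     has norm at most K / (M + 1) for every M. *)
  set K := nrm (- q%:Z) (sdual_val (a *: eta + zeta)) +
    (normc a * nrm (- q%:Z) (sdual_val eta) + nrm (- q%:Z) (sdual_val zeta)).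
  apply: (@ler_add_inv _ _ _ K) => M; rewrite add0r.
  have e0 : 0 < M.+1%:R^-1 :> R by rewrite invr_gt0.
  have [N hN] := keyE q _ e0.
  have [_ k1] := hN _ _ f1 (leqnn N); have [_ k2] := hN _ _ f2 (leqnn N).
  have [_ k3] := hN _ _ f3 (leqnn N).
  have dE : d = (x (a *: eta + zeta) - u N (a *: eta + zeta)) -
      (a *: (x eta - u N eta) + (x zeta - u N zeta)).
    rewrite /d (Lss_linear (Lu N)) scalerBr.
    by rewrite addrACA -opprD opprB addrA subrK.
  have fin1 zeta' : fin q%:Z (s_val (x zeta' - u N zeta')) by exact: s_fin.
  rewrite dE; apply: le_trans (nrmB (s_fin _ _) (s_fin _ _)) _.
  have := nrmD (finZ a (fin1 eta)) (fin1 zeta); rewrite nrmZ; last exact: fin1.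
  move=> h1; have : K / M.+1%:R = M.+1%:R^-1 * nrm (- q%:Z) (sdual_val (a *: eta + zeta)) +
      (normc a * (M.+1%:R^-1 * nrm (- q%:Z) (sdual_val eta)) +
       M.+1%:R^-1 * nrm (- q%:Z) (sdual_val zeta)) by rewrite /K; ring.
  move=> ->; apply: lerD; first exact: k3.
  apply: le_trans h1 _; apply: lerD; last exact: k2.
  by rewrite ler_wpM2l ?normc_ge0//; exact: k1.
have bx q : (op_norm q x < +oo)%E.
  have [N hN] := keyE q 1 ltr01.
  apply: le_lt_trans (ltry (1 + opn q (u N))); apply: op_norm_le.
    by rewrite addr_ge0 ?opn_ge0.
  move=> eta f; have [f1 h1] := hN eta N f (leqnn N).
  rewrite -[s_val (x eta)](subrK (s_val (u N eta))).
  apply: le_trans (nrmD f1 (s_fin _ _)) _.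
  by rewrite mulrDl lerD//; exact: Lss_bound.
have Lx := Lss_intro lx bx.
exists x => // q e e0; have [N hN] := keyE q _ (divr_gt0 e0 (ltr0Sn _ 1)).
exists N => n nN; rewrite opn_distC//.
apply: (@le_lt_trans _ _ (e / 2)); last by rewrite ltr_pdivrMr// ltr_pMr// ltr1n.
apply: opn_le => [|eta f]; first by rewrite divr_ge0// ltW.
by have [_] := hN eta n f nN.
Qed.

(** Makes the strong Cauchy condition simultaneous over finitely many vectors; it is applied to the
    basis vectors below a truncation index. *)
Lemma opcauchy_small (u : nat -> op) : (forall n, Lss (u n)) ->
  (forall v (e : R), 0 < e -> exists N, forall n m, (N <= n)%N -> (N <= m)%N ->
     nrm 0 (s_val ((u n - u m) (s_to_sdual v))) < e) ->
  forall N (c : nat -> R) (v : nat -> sspace R) (e : R), 0 < e -> (forall j, 0 <= c j) ->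
  exists M, forall n m, (M <= n)%N -> (M <= m)%N ->
    \sum_(0 <= j < N) c j * nrm 0 (s_val ((u n - u m) (s_to_sdual (v j)))) < e.
Proof.
move=> Lu hu; elim=> [|N IH] c v e e0 c0; first by exists 0 => n m _ _; rewrite big_nil.
have e2 : 0 < e / 2 by rewrite divr_gt0.
have [M1 h1] := IH c v _ e2 c0.
(* The summand 1 guards against a vanishing weight. *)
have d0 : 0 < e / 2 / (c N + 1) by rewrite divr_gt0// ltr_wpDl.
have [M2 h2] := hu (v N) _ d0.
exists (maxn M1 M2) => n m; rewrite !geq_max => /andP[n1 n2] /andP[m1 m2].
rewrite big_nat_recr//=; have := h1 n m n1 m1; have := h2 n m n2 m2.
rewrite ltr_pdivlMr ?ltr_wpDl//.
set p := nrm 0 _; have p0 : 0 <= p by exact: nrm_ge0.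
set S := \sum_(0 <= j < N) _; lra.
Qed.

Definition basis_vec j : sspace R := strunc j.+1 (fun k => (k == j)%:R).

Lemma basis_vecE j k : s_val (basis_vec j) k = (k == j)%:R.
Proof. by rewrite /= /trunc; case: ifPn => //; rewrite -leqNgt => jk; rewrite gtn_eqF. Qed.

Lemma strunc_basis N xi : strunc N xi = \sum_(0 <= j < N) xi j *: basis_vec j.
Proof.
elim: N => [|N IH].
  by rewrite big_nil; apply: s_val_inj; apply/funext => k.
rewrite big_nat_recr//= -IH; apply: s_val_inj; apply/funext => k.
have -> : s_val (strunc N xi + xi N *: basis_vec N) k =
  trunc N xi k + xi N * s_val (basis_vec N) k by [].
rewrite basis_vecE /= /trunc ltnS; case: ltngtP => [kN|kN|->].
- by rewrite mulr0 addr0.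
- by rewrite mulr0 addr0.
- by rewrite mulr1 add0r.
Qed.

(** A coordinate of eta is at most (j + 1)^q times its dual norm, so on truncations finitely many
    values of x decide. *)
Lemma nrm_strunc_le q N x eta : Lss x -> fin (- q%:Z) eta ->
  nrm 0 (s_val (x (s_to_sdual (strunc N eta)))) <=
  (\sum_(0 <= j < N) j.+1%:R ^ q%:Z * nrm 0 (s_val (x (s_to_sdual (basis_vec j))))) *
  nrm (- q%:Z) eta.
Proof.
move=> Lx f; have lx := Lss_linear Lx; elim: N => [|N IH].
  rewrite big_nil mul0r (_ : s_to_sdual _ = 0) ?linear_op0// ?s_val0 ?nrm0//.
  by apply: sdual_val_inj; apply/funext => k.
rewrite big_nat_recr//= mulrDl.
have -> : s_to_sdual (strunc N.+1 eta) =
    eta N *: s_to_sdual (basis_vec N) + s_to_sdual (strunc N eta).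
  rewrite -s_to_sdual_linear; congr s_to_sdual.
  by rewrite !strunc_basis big_nat_recr//= addrC.
rewrite lx s_valD s_valZ addrC.
apply: le_trans (nrmD (s_fin 0 _) (finZ _ (s_fin 0 _))) _.
rewrite lerD// nrmZ ?(s_fin 0)// mulrAC ler_wpM2r ?nrm_ge0// mulrC.
by rewrite -ler_pdivrMr ?weight_gt0// invr_expz coord_le_nrm.
Qed.

(* Bounded sets are precompact: on them strong convergence on l2 implies
   convergence in all the seminorms, by interpolation. *)
Lemma bounded_opcauchy (u : nat -> op) (B : nat -> R) : (forall n, Lss (u n)) ->
  (forall q n, opn q (u n) <= B q) ->
  (forall v (e : R), 0 < e -> exists N, forall n m, (N <= n)%N -> (N <= m)%N ->
     nrm 0 (s_val ((u n - u m) (s_to_sdual v))) < e) ->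
  opcauchy u.
Proof.
move=> Lu hB hu q e e0.
have B0 p : 0 <= B p := le_trans (opn_ge0 p (u 0)) (hB p 0).
have hB2 p n m : opn p (u n - u m) <= 2 * B p.
  apply: le_trans (opnB _ (Lu n) (Lu m)) _.
  by rewrite mulrDl mul1r lerD.
(* Interpolating an l2-norm at most d K with a norm of index 2q at most D K must give (e / 2) K,
   which dictates d; the summand 1 keeps D positive. *)
pose D := 2 * B (q + q)%N + 1; have D0 : 0 < D by rewrite ltr_wpDl// mulr_ge0.
pose d := (e / 2) ^+ 2 / D.
have d0 : 0 < d by rewrite divr_gt0// exprn_gt0// divr_gt0.
(* One half of d pays for the tail beyond N, the other for the first N basis vectors. *)
have [N hN] : exists N : nat, 2 * B q.+1 / N.+1%:R < d / 2.
  have y0 : 0 <= (d / 2)^-1 * (2 * B q.+1).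
    by rewrite mulr_ge0 ?mulr_ge0 ?invr_ge0 ?B0 ?ler0n// ltW// divr_gt0.
  exists (Num.truncn ((d / 2)^-1 * (2 * B q.+1))).
  rewrite ltr_pdivrMr// -ltr_pdivrMl; last by rewrite divr_gt0.
  by have /andP[_] := Num.Theory.truncn_itv y0.
have [M hM] := @opcauchy_small u Lu hu N (fun j => j.+1%:R ^ q%:Z) basis_vec
  (d / 2) (divr_gt0 d0 (ltr0Sn R 1))
  (fun j => weight_ge0 j q%:Z).
exists M => n m nM mM.
apply: (@le_lt_trans _ _ (e / 2)); last by rewrite ltr_pdivrMr// ltr_pMr// ltr1n.
have Lz : Lss (u n - u m) by exact: LssB.
apply: opn_le => [|eta f]; first by rewrite divr_ge0// ltW.
set z := u n - u m in Lz *; set K := nrm (- q%:Z) (sdual_val eta).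
have K0 : 0 <= K := nrm_ge0 _ _.
have small : nrm 0 (s_val (z eta)) <= d * K.
  have h1 := trunc_density N Lz f; have h2 := nrm_strunc_le N Lz f.
  have h3 := hM n m nM mM; rewrite -/z in h3; rewrite -/K in h1 h2.
  set v := z (s_to_sdual _) in h1 h2.
  rewrite -[z eta](subrK v) s_valD.
  apply: le_trans (nrmD (s_fin 0 _) (s_fin 0 _)) _.
  have -> : d * K = d / 2 * K + d / 2 * K by rewrite -mulrDl -splitr.
  apply: lerD; last by apply: le_trans h2 _; rewrite ler_wpM2r// ltW.
  apply: (@le_trans _ _ (nrm q%:Z (s_val (z eta - v)))).
    by apply: nrm_mono (s_fin q _).
  apply: le_trans h1 _; rewrite mulrAC ler_wpM2r//.
  apply: le_trans (ltW hN); rewrite ler_wpM2r ?invr_ge0//.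
  exact: hB2.
rewrite -ler_sqr ?nnegrE ?nrm_ge0 ?mulr_ge0 ?divr_ge0 ?(ltW e0)//.
have qq : q%:Z *+ 2 = (q + q)%N%:Z by rewrite mulr2n PoszD.
have fi : fin (q%:Z *+ 2) (s_val (z eta)) by rewrite qq; exact: s_fin.
apply: le_trans (nrm_interpolation _ fi) _; first by [].
have -> : (e / 2 * K) ^+ 2 = d * K * (D * K).
  by rewrite /d; field; rewrite gt_eqF.
apply: ler_pM; rewrite ?nrm_ge0// qq.
have fq : fin (- (q + q)%N%:Z) (sdual_val eta).
  by apply: fin_mono f; rewrite lerN2 lez_nat leq_addr.
apply: le_trans (Lss_bound Lz fq) _; apply: ler_pM; rewrite ?nrm_ge0 ?opn_ge0//.
  by apply: le_trans (hB2 _ _ _) _; rewrite lerDl.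
by apply: nrm_mono f; rewrite lerN2 lez_nat leq_addr.
Qed.

End completeness.

(** * Adjoints, and projections as limits of powers *)

Section projections_from_powers.
Context {R : realType}.
Local Notation C := R[i].
Local Notation op := (sdual R -> sspace R).
Implicit Types (x y z : op).

Lemma restr_bound x (xi : l2space R) : Lss x ->
  nrm 0 (l2_val (restr x xi)) <= opn 0 x * nrm 0 (l2_val xi).
Proof.
move=> Lx; have f : fin (- 0%:Z) (sdual_val (l2_to_sdual xi)).
  by rewrite oppr0; exact: l2_fin.
by have := Lss_bound Lx f; rewrite oppr0.
Qed.

Lemma restr_linear x : Lss x -> linear (restr x).
Proof.
move=> Lx a u v; apply: l2_val_inj.
have E : l2_to_sdual (a *: u + v) = a *: l2_to_sdual u + l2_to_sdual v.
  exact: sdual_val_inj.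
by rewrite l2_valD l2_valZ /restr /= E (Lss_linear Lx).
Qed.

Lemma restrZ x a u : Lss x -> restr x (a *: u) = a *: restr x u.
Proof.
move=> Lx; apply: l2_val_inj; rewrite l2_valZ.
have E : l2_to_sdual (a *: u) = a *: l2_to_sdual u by exact: sdual_val_inj.
by rewrite /restr /= E (linear_opZ _ _ (Lss_linear Lx)).
Qed.

Lemma restrD x u v : Lss x -> restr x (u + v) = restr x u + restr x v.
Proof. by move=> Lx; have := restr_linear Lx 1 u v; rewrite !scale1r. Qed.

Lemma restr0 x : Lss x -> restr x 0 = 0.
Proof. by move=> Lx; have := restrZ 0 0 Lx; rewrite !scale0r. Qed.

Lemma restrB x u v : Lss x -> restr x (u - v) = restr x u - restr x v.
Proof. by move=> Lx; rewrite restrD// -[- v]scaleN1r restrZ// scaleN1r. Qed.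

Lemma restr_mul x y u : restr (op_mul x y) u = restr x (restr y u).
Proof. by []. Qed.

Lemma restr_addE x y u : restr (x + y) u = restr x u + restr y u.
Proof. exact: l2_val_inj. Qed.

Lemma restr_subE x y u : restr (x - y) u = restr x u - restr y u.
Proof. exact: l2_val_inj. Qed.

Lemma restr_scaleE a x u : restr (a *: x) u = a *: restr x u.
Proof. exact: l2_val_inj. Qed.

Lemma restr_0E u : restr (0 : op) u = 0.
Proof. exact: l2_val_inj. Qed.

Lemma restr_ext x y : Lss x -> Lss y -> (forall u, restr x u = restr y u) -> x = y.
Proof.
move=> Lx Ly h; apply: Lss_ext => // u; apply: s_val_inj.
exact: (congr1 (@l2_val R) (h (s_to_l2 u))).
Qed.

(** The step of index 0 of s' is l2, so [opn 0] is the operator norm of the restriction. *)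
Lemma opn0_le x (c : R) : 0 <= c -> Lss x ->
  (forall u, nrm 0 (l2_val (restr x u)) <= c * nrm 0 (l2_val u)) -> opn 0 x <= c.
Proof.
move=> c0 Lx h; apply: opn_le => // eta f.
have g : sdual_val eta \in in_l2 by apply/asboolP; move: f; rewrite oppr0.
have := h (L2Space g); rewrite oppr0; congr (nrm _ _ <= _).
by rewrite /restr/=; congr (s_val (x _)); apply: sdual_val_inj.
Qed.

Lemma adjoint_sym x y : adjoint x y -> adjoint y x.
Proof. by move=> h u v; rewrite inner_conj -h -inner_conj. Qed.

Lemma adjoint_lin a x x' y y' : adjoint x x' -> adjoint y y' ->
  adjoint (a *: x + y) (a^*%C *: x' + y').
Proof.
move=> hx hy u v; rewrite !restr_addE !restr_scaleE innerDl innerDr innerZl innerZr.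
by rewrite conjcK hx hy.
Qed.

Lemma adjoint_mul x x' y y' : adjoint x x' -> adjoint y y' ->
  adjoint (op_mul x y) (op_mul y' x').
Proof. by move=> hx hy u v; rewrite !restr_mul hx hy. Qed.

Lemma adjoint_unique x y z : Lss y -> Lss z -> adjoint x y -> adjoint x z -> y = z.
Proof.
move=> Ly Lz hy hz; apply: restr_ext => // u; apply: inner_inj => v.
by rewrite inner_conj -hy hz -inner_conj.
Qed.

Lemma adjoint0 : adjoint (0 : op) 0.
Proof. by move=> u v; rewrite !restr_0E inner0l inner0r. Qed.

Lemma adjointZ a x x' : adjoint x x' -> adjoint (a *: x) (a^*%C *: x').
Proof. by move=> h; have := adjoint_lin a h adjoint0; rewrite !addr0. Qed.

Lemma adjointD x x' y y' : adjoint x x' -> adjoint y y' -> adjoint (x + y) (x' + y').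
Proof. by move=> hx hy; have := adjoint_lin 1 hx hy; rewrite conjc1 !scale1r. Qed.

Lemma adjointB x x' y y' : adjoint x x' -> adjoint y y' -> adjoint (x - y) (x' - y').
Proof.
move=> hx hy; have := adjointD hx (adjointZ (-1) hy).
have -> : ((-1 : C)^*)%C = -1 by apply: complex_ext => //=; rewrite !oppr0.
by rewrite !scaleN1r.
Qed.

Lemma adjoint_lim (u v : nat -> op) x y : (forall n, Lss (u n)) ->
  (forall n, Lss (v n)) -> Lss x -> Lss y -> opcvg u x -> opcvg v y ->
  (forall n, adjoint (u n) (v n)) -> adjoint x y.
Proof.
move=> Lu Lv Lx Ly hu hv huv xi eta; apply/eqP; rewrite -subr_eq0 -normc_eq0.
rewrite eq_le normc_ge0 andbT.
set K := nrm 0 (l2_val xi) * nrm 0 (l2_val eta).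
apply: (@ler_add_inv _ _ _ (2 * K)) => M; rewrite add0r.
have e0 : 0 < M.+1%:R^-1 :> R by rewrite invr_gt0.
have [N1 h1] := hu 0 _ e0; have [N2 h2] := hv 0 _ e0.
have {}h1 := h1 _ (leq_maxl N1 N2); have {}h2 := h2 _ (leq_maxr N1 N2).
set n := maxn N1 N2 in h1 h2.
have -> : inner (restr x xi) eta - inner xi (restr y eta) =
    inner xi (restr (v n - y) eta) - inner (restr (u n - x) xi) eta.
  by rewrite !restr_subE innerBl innerBr huv; ring.
apply: le_trans (le_normcD _ _) _; rewrite normc_opp.
have b1 : normc (inner (restr (u n - x) xi) eta) <= M.+1%:R^-1 * K.
  apply: le_trans (cauchy_schwarz _ _) _; rewrite /K mulrA ler_wpM2r ?nrm_ge0//.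
  apply: le_trans (restr_bound _ (LssB (Lu n) Lx)) _.
  by rewrite ler_wpM2r ?nrm_ge0// ltW.
have b2 : normc (inner xi (restr (v n - y) eta)) <= M.+1%:R^-1 * K.
  apply: le_trans (cauchy_schwarz _ _) _; rewrite /K mulrCA ler_wpM2l ?nrm_ge0//.
  apply: le_trans (restr_bound _ (LssB (Lv n) Ly)) _.
  by rewrite ler_wpM2r ?nrm_ge0// ltW.
have -> : 2 * K / M.+1%:R = M.+1%:R^-1 * K + M.+1%:R^-1 * K by ring.
exact: lerD.
Qed.

Lemma opcvg_mul (u v : nat -> op) x y : (forall n, Lss (u n)) ->
  (forall n, Lss (v n)) -> Lss x -> Lss y -> opcvg u x -> opcvg v y ->
  opcvg (fun n => op_mul (u n) (v n)) (op_mul x y).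
Proof.
move=> Lu Lv Lx Ly hu hv q e e0.
have c0 : 0 < opn q x + 1 by rewrite ltr_wpDl ?opn_ge0.
have d0 : 0 < opn q y + 1 by rewrite ltr_wpDl ?opn_ge0.
have e2 : 0 < e / 2 by rewrite divr_gt0.
(* The index N1' keeps [opn q (u n)] below [opn q x + 1]. *)
have [N1 h1] := hu q _ (divr_gt0 e2 d0); have [N1' h1'] := hu q 1 ltr01.
have [N2 h2] := hv q _ (divr_gt0 e2 c0).
exists (maxn N1 (maxn N1' N2)) => n; rewrite !geq_max => /and3P[n1 n1' n2].
have {}h1 := h1 n n1; have {}h1' := h1' n n1'; have {}h2 := h2 n n2.
have -> : op_mul (u n) (v n) - op_mul x y =
    op_mul (u n) (v n - y) + op_mul (u n - x) y.
  by rewrite (op_mulBr _ _ (Lu n)) op_mulBl addrA subrK.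
have Lun := Lu n; have Lvn := Lv n.
have Lv' : Lss (v n - y) by exact: LssB.
have Lu' : Lss (u n - x) by exact: LssB.
apply: le_lt_trans (opnD q (Lss_mul Lun Lv') (Lss_mul Lu' Ly)) _.
rewrite [e]splitr; apply: ltrD.
  apply: le_lt_trans (opn_mul q Lun Lv') _.
  move: h2; rewrite ltr_pdivlMr//; apply: le_lt_trans.
  rewrite mulrC ler_wpM2l ?opn_ge0//.
  rewrite -[u n](subrK x); apply: le_trans (opnD q Lu' Lx) _.
  by rewrite addrC lerD2l ltW.
apply: le_lt_trans (opn_mul q Lu' Ly) _.
move: h1; rewrite ltr_pdivlMr//; apply: le_lt_trans.
by rewrite ler_wpM2l ?opn_ge0// lerDl.
Qed.

Lemma opcvg_cst x : opcvg (fun=> x) x.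
Proof. by move=> q e e0; exists 0 => n _; rewrite subrr opn0. Qed.

Lemma opcvg_sub (u : nat -> op) x (f : nat -> nat) : (forall n, (n <= f n)%N) ->
  opcvg u x -> opcvg (u \o f) x.
Proof.
move=> hf h q e e0; have [N hN] := h q e e0; exists N => n nN.
by apply: hN; exact: leq_trans nN (hf n).
Qed.

Definition selfadjoint x := adjoint x x.

(* [pw z n] is the power of z of exponent n + 1. *)
Fixpoint pw z n : op := if n is m.+1 then op_mul z (pw z m) else z.

Lemma Lss_pw z n : Lss z -> Lss (pw z n).
Proof. by move=> Lz; elim: n => [|n IH]; [exact: Lz|exact: Lss_mul Lz IH]. Qed.

Lemma pw_mul z a b : op_mul (pw z a) (pw z b) = pw z (a + b).+1.
Proof. by elim: a => //= a IH; rewrite -op_mulA IH. Qed.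

Lemma pwSr z n : op_mul (pw z n) z = pw z n.+1.
Proof. by have := pw_mul z n 0; rewrite addn0. Qed.

Lemma pw_selfadjoint z n : selfadjoint z -> selfadjoint (pw z n).
Proof.
move=> sz; elim: n => //= n IH; rewrite /selfadjoint.
rewrite -[in X in adjoint _ X]/(pw z n.+1) -pwSr.
exact: adjoint_mul.
Qed.

Lemma opn0_pw_le z n : Lss z -> opn 0 z <= 1 -> opn 0 (pw z n) <= 1.
Proof.
move=> Lz z1; elim: n => //= n IH.
apply: le_trans (opn_mul 0 Lz (Lss_pw n Lz)) _.
by rewrite mulr_ile1 ?opn_ge0.
Qed.

(** The two outer factors z carry the index q and the inner power is an l2-contraction, so the bound
    is independent of n. *)
Lemma opn_pw_bound q z n : Lss z -> opn 0 z <= 1 ->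
  opn q (pw z n.+2) <= opn q z * opn q z.
Proof.
move=> Lz z1; rewrite /= -[op_mul z (pw z n)]/(pw z n.+1) -pwSr.
apply: le_trans (opn_mul3 q Lz (Lss_pw n Lz) Lz) _.
by rewrite ler_wpM2r ?opn_ge0// ler_piMr ?opn_ge0// opn0_pw_le.
Qed.

(** Half of the C*-identity: the squared norm of z u is the inner product of z^2 u with u. *)
Lemma opn0_square z : Lss z -> selfadjoint z ->
  opn 0 z ^+ 2 <= opn 0 (op_mul z z).
Proof.
move=> Lz sz; have n0 := opn_ge0 0 (op_mul z z).
rewrite -[leRHS]sqr_sqrtr// ler_sqr ?nnegrE ?opn_ge0 ?sqrtr_ge0//.
apply: opn0_le => [||u]; rewrite ?sqrtr_ge0//.
rewrite -ler_sqr ?nnegrE ?mulr_ge0 ?sqrtr_ge0 ?nrm_ge0// exprMn sqr_sqrtr//.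
have -> : nrm 0 (l2_val (restr z u)) ^+ 2 = normc (inner (restr (op_mul z z) u) u).
  by rewrite restr_mul sz inner_self normc_real ger0_norm ?sqr_ge0.
apply: le_trans (cauchy_schwarz _ _) _; rewrite expr2 mulrA.
by rewrite ler_wpM2r ?nrm_ge0//; exact: restr_bound (Lss_mul Lz Lz).
Qed.

(** Squaring keeps the norm at least 1, which handles arbitrarily large exponents; the others follow
    since the norms of powers decrease. It makes the limit of the powers nonzero. *)
Lemma opn0_pw_ge1 z n : Lss z -> selfadjoint z -> opn 0 z = 1 -> 1 <= opn 0 (pw z n).
Proof.
move=> Lz sz z1.
have dec a b : (a <= b)%N -> opn 0 (pw z b) <= opn 0 (pw z a).
  elim: b => [|b IH]; first by rewrite leqn0 => /eqP ->.
  rewrite leq_eqVlt => /predU1P[->//|]; rewrite ltnS => /IH; apply: le_trans.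
  apply: le_trans (opn_mul 0 Lz (Lss_pw b Lz)) _.
  by rewrite z1 mul1r.
have [m nm hm] : exists2 m, (n <= m)%N & 1 <= opn 0 (pw z m).
  elim: n => [|n [m nm hm]]; first by exists 0 => //=; rewrite z1.
  (* Indices are exponents minus one, so the square of [pw z m] has index 2m + 1. *)
  exists (m + m).+1; first by rewrite ltnS (leq_trans nm)// leq_addr.
  rewrite -pw_mul; apply: le_trans (opn0_square (Lss_pw m Lz) (pw_selfadjoint m sz)).
  by rewrite expr_ge1 ?opn_ge0.
exact: le_trans hm (dec _ _ nm).
Qed.

(** Continuity on l2 is automatic in L(s', s), so these algebraic conditions describe the orthogonal
    projections; see [is_projP]. *)
Record is_proj (p : op) : Prop := {
  proj_Lss : Lss p ; proj_idem : op_mul p p = p ; proj_sa : selfadjoint p }.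

Lemma pw_inner z a b c d u : Lss z -> selfadjoint z -> (a + b = c + d)%N ->
  inner (restr (pw z a) u) (restr (pw z b) u) =
  inner (restr (pw z c) u) (restr (pw z d) u).
Proof.
move=> Lz sz abcd; rewrite -(pw_selfadjoint b sz) -(pw_selfadjoint d sz).
by rewrite -!restr_mul !pw_mul addnC abcd addnC.
Qed.

(** The index 2k + 3 stands for the exponent 2k + 4: even, so that inner products of two terms are
    squared norms, and large enough for [opn_pw_bound]. *)
Lemma pw_cvg z : Lss z -> selfadjoint z -> opn 0 z <= 1 ->
  exists2 p, Lss p & opcvg (fun k => pw z (k + k).+3) p.
Proof.
move=> Lz sz z1; pose w k := pw z (k + k).+3.
have Lw k : Lss (w k) by exact: Lss_pw.
apply: opcauchy_cvg => //.
apply: (@bounded_opcauchy _ w (fun q => opn q z * opn q z)) => // [q n|v e e0].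
  exact: opn_pw_bound.
pose u := s_to_l2 v.
pose t n := nrm 0 (l2_val (restr (pw z n) u)) ^+ 2.
have t_dec n : t n.+1 <= t n.
  rewrite ler_sqr ?nnegrE ?nrm_ge0//.
  have -> : restr (pw z n.+1) u = restr z (restr (pw z n) u) by [].
  apply: le_trans (restr_bound _ Lz) _.
  by rewrite ler_piMl ?nrm_ge0.
(* The inner product of two terms is the squared norm of the power half way between them, so the
   squared distance is a combination of values of the decreasing, hence convergent, sequence t. *)
have tE k m : nrm 0 (l2_val (restr (w k - w m) u)) ^+ 2 =
    t (k + k).+3 - 2 * t (k + m).+3 + t (m + m).+3.
  have tI a b c : (a + b = c + c)%N -> inner (restr (pw z a) u) (restr (pw z b) u) =
      (t c)%:C%C by move=> h; rewrite (pw_inner u Lz sz h) inner_self.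
  have := inner_self (restr (w k - w m) u).
  rewrite restr_subE innerBl !innerBr.
  rewrite (@tI _ _ (k + k).+3)// (@tI _ _ (k + m).+3); last by lia.
  rewrite (@tI _ _ (k + m).+3); last by lia.
  rewrite (@tI _ _ (m + m).+3)// -!raddfB/= => -[<- ]; ring.
have cvt : t n @[n --> \oo] --> limn t.
  apply: nonincreasing_is_cvgn; first exact/nonincreasing_seqP.
  by exists 0 => _ [n _ <-]; exact: sqr_ge0.
(* The coefficients 1, -2, 1 have sum 0 and total modulus 4, hence the quarter. *)
have [N hN] : exists N, forall n, (N <= n)%N -> `|limn t - t n| < e ^+ 2 / 4.
  have : 0 < e ^+ 2 / 4 by rewrite divr_gt0// exprn_gt0.
  by move/cvgrPdist_lt: cvt => cvt /cvt[N _ hN]; exists N.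
exists N => n m nN mN.
have -> : s_val ((w n - w m) (s_to_sdual v)) = l2_val (restr (w n - w m) u) by [].
rewrite -ltr_sqr ?nnegrE ?nrm_ge0 ?(ltW e0)// tE.
have g1 : (N <= (n + n).+3)%N by lia.
have g2 : (N <= (n + m).+3)%N by lia.
have g3 : (N <= (m + m).+3)%N by lia.
move: (hN _ g1) (hN _ g2) (hN _ g3).
rewrite !ltr_norml => /andP[? ?] /andP[? ?] /andP[? ?]; lra.
Qed.

(* The even powers of z = x / ‖x‖ decrease to the projection onto the
   eigenspace of x^2 for its largest eigenvalue ‖x‖^2. *)
Lemma projection_of_selfadjoint (A : set op) x :
  closed_star_subalgebra A -> A x -> selfadjoint x -> x != 0 ->
  exists p (r : R), [/\ A p, is_proj p, p != 0, 0 < r &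
    op_mul x (op_mul x p) = r%:C%C *: p].
Proof.
move=> [sA cA] Ax sx x0; have AL := star_subalgebra_sub sA.
have Lx := AL _ Ax.
have r0 : 0 < opn 0 x.
  rewrite lt_neqAle opn_ge0 andbT eq_sym.
  by apply: contraNneq x0 => /(opn0_eq0 Lx) ->.
set r := opn 0 x in r0.
pose z := (r^-1)%:C%C *: x.
have Az : A z.
  by rewrite -[z]addr0; apply: star_subalgebra_lin => //; exact: star_subalgebra_0.
have Lz := AL _ Az.
have sz : selfadjoint z.
  have := adjointZ (r^-1)%:C%C sx; rewrite [(_^*)%C](_ : _ = (r^-1)%:C%C)//.
  by apply: complex_ext => //=; rewrite oppr0.
have z1 : opn 0 z = 1.
  by rewrite opnZE// normc_real gtr0_norm ?invr_gt0// mulVf// gt_eqF.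
have z1' : opn 0 z <= 1 by rewrite z1.
have Apw n : A (pw z n) by elim: n => //= n IH; exact: star_subalgebra_mul.
have [p Lp cp] := pw_cvg Lz sz z1'.
set w := fun k => _ in cp.
have Lw k : Lss (w k) by exact: Lss_pw.
exists p, (r ^+ 2); split.
- by apply: (opcvg_closed cA AL _ Lp cp) => k; exact: Apw.
- split=> //.
    have cpp := opcvg_mul Lw Lw Lp Lp cp cp.
    apply: (opcvg_unique (fun n => Lss_mul (Lw n) (Lw n)) (Lss_mul Lp Lp) Lp cpp).
    (* The square of z^(2n + 4) is z^(4n + 8), the term of index 2n + 2 of the same sequence; so p
       is idempotent. *)
    have -> : (fun n => op_mul (w n) (w n)) = w \o (fun n => (n + n).+2).
      apply/funext => n; rewrite [LHS]pw_mul.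
      have -> : (w \o (fun n => (n + n).+2)) n = pw z ((n + n).+2 + (n + n).+2).+3 by [].
      congr (pw z _); lia.
    apply: opcvg_sub cp => n; lia.
  by apply: (adjoint_lim Lw Lw Lp Lp cp cp) => n; exact: pw_selfadjoint.
- apply/eqP => p0; have [N hN] := cp 0 1 ltr01.
  have := hN N (leqnn N); rewrite p0 subr0.
  by rewrite ltNge opn0_pw_ge1.
- by rewrite exprn_gt0.
have zp : op_mul z (op_mul z p) = p.
  have Lzw n : Lss (op_mul z (w n)) := Lss_mul Lz (Lw n).
  have Lzp := Lss_mul Lz Lp.
  have c1 := opcvg_mul (fun=> Lz) Lw Lz Lp (opcvg_cst z) cp.
  have c2 := opcvg_mul (fun=> Lz) Lzw Lz Lzp (opcvg_cst z) c1.
  apply: (opcvg_unique (fun n => Lss_mul Lz (Lzw n)) (Lss_mul Lz Lzp) Lp c2).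
  (* Multiplication by z^2 shifts the sequence by one, so its limit is fixed by z^2. *)
  have -> : (fun n => op_mul z (op_mul z (w n))) = w \o S.
    apply/funext => n; have -> : (w \o S) n = pw z (n.+1 + n.+1).+3 by [].
    by rewrite addnS.
  exact: opcvg_sub cp.
have E : op_mul z (op_mul z p) =
    (r^-1)%:C%C *: ((r^-1)%:C%C *: op_mul x (op_mul x p)).
  by rewrite -[in RHS](op_mulZr _ _ Lx).
transitivity ((r ^+ 2)%:C%C *: op_mul z (op_mul z p)); last by rewrite zp.
rewrite E !scalerA.
have -> : (r ^+ 2)%:C%C * (r^-1)%:C%C * (r^-1)%:C%C = 1 :> C.
  by rewrite -!rmorphM/= expr2 -mulrA mulrACA mulfV ?gt_eqF// mulr1.
by rewrite scale1r.
Qed.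

End projections_from_powers.

(** * Orthonormal systems and projections *)

Section orthonormal_systems.
Context {R : realType}.
Local Notation C := R[i].
Local Notation op := (sdual R -> sspace R).

Lemma psum_cvg w (xi : nat -> C) : fin w xi ->
  psum w xi n @[n --> \oo] --> nrm w xi ^+ 2.
Proof.
move=> f; have nd : nondecreasing_seq (psum w xi).
  apply/nondecreasing_seqP => m; rewrite /psum big_nat_recr//= lerDl.
  exact: psum_term_ge0.
have cv : psum w xi n @[n --> \oo] --> limn (psum w xi).
  apply: nondecreasing_is_cvgn => //.
  by exists (nrm w xi ^+ 2) => _ [n _ <-]; exact: psum_le_nrm.
rewrite [X in _ --> X](_ : _ = limn (psum w xi))//.
apply/eqP; rewrite eq_le; apply/andP; split.
  apply: (@fin_sqleP _ _ _ _ _).2 => n; apply: nondecreasing_cvgn_le => //.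
by apply: (limn_le_cst cv) => n; exact: psum_le_nrm.
Qed.

Lemma inner_basis (u : l2space R) j :
  inner u (s_to_l2 (basis_vec j)) = l2_val u j.
Proof.
have E n : \sum_(0 <= k < n) (l2_val u k * ((k == j)%:R : C)^*%C) =
    if (j < n)%N then l2_val u j else 0.
  elim: n => [|n IH]; first by rewrite big_nil.
  rewrite big_nat_recr//= IH ltnS; case: (ltngtP j n) => [jn|jn|->].
  - by rewrite conjc0 mulr0 addr0.
  - by rewrite conjc0 mulr0 addr0.
  - by rewrite conjc1 mulr1 add0r.
have H (f : C -> R) : {morph f : a b / a + b} -> f 0 = 0 ->
    limn (series (fun k => f (l2_val u k * (l2_val (s_to_l2 (basis_vec j)) k)^*%C))) =
    f (l2_val u j).
  move=> fD f0; apply/cvg_lim => //; apply: cvg_near_cst.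
  exists j.+1 => // n /= jn; rewrite /series/=.
  rewrite -(big_morph f fD f0).
  have := E n; rewrite jn => <-; congr f.
  by apply: eq_bigr => k _; rewrite -basis_vecE.
apply: complex_ext.
  by rewrite Re_inner (H (@complex.Re R))// => -[p q] [r s].
by rewrite Im_inner (H (@complex.Im R))// => -[p q] [r s].
Qed.

Lemma nrm_basis w j : nrm w (s_val (basis_vec j : sspace R)) <= j.+1%:R ^ w.
Proof.
apply: (@fin_leP _ _ _ _ (weight_ge0 _ _) _).2 => n; rewrite psumE.
have -> : \sum_(0 <= k < n) (normc (s_val (basis_vec j : sspace R) k) * k.+1%:R ^ w) ^+ 2 =
    if (j < n)%N then (j.+1%:R ^ w) ^+ 2 else 0.
  elim: n => [|n IH]; first by rewrite big_nil.
  rewrite big_nat_recr// IH ltnS basis_vecE; case: (ltngtP j n) => [jn|jn|->].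
  - by rewrite mulr0n normc0 mul0r expr0n/= addr0.
  - by rewrite mulr0n normc0 mul0r expr0n/= addr0.
  - by rewrite mulr1n normc1 mul1r /= add0r.
by case: ifP => // _; exact: sqr_ge0.
Qed.

(** Only the first n terms count, so a system can be extended without changing its type. *)
Definition orthonormal n (f : nat -> l2space R) :=
  forall i j, (i < n)%N -> (j < n)%N -> inner (f i) (f j) = (i == j)%:R.

Definition normalize (v : l2space R) : l2space R := ((nrm 0 (l2_val v))^-1)%:C%C *: v.

Lemma inner_normalize v : v != 0 -> inner (normalize v) (normalize v) = 1.
Proof.
move=> v0; have n0 : nrm 0 (l2_val v) != 0.
  by apply: contra_neq v0 => /(nrm_eq0 (l2_fin v)) v0; exact: l2_val_inj.
rewrite innerZl innerZr inner_self.
rewrite (_ : (_^*)%C = ((nrm 0 (l2_val v))^-1)%:C%C); last first.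
  by apply: complex_ext => //=; rewrite oppr0.
rewrite -!rmorphM/= (_ : _ * (_ * _) = 1)//.
by field.
Qed.

Lemma orthonormal_extend n f g : orthonormal n f -> inner g g = 1 ->
  (forall i, (i < n)%N -> inner g (f i) = 0) ->
  orthonormal n.+1 (fun i => if (i < n)%N then f i else g).
Proof.
move=> of_ g1 gf i j; rewrite !ltnS => ilt jlt.
have [il|ig] := ltnP i n; have [jl|jg] := ltnP j n.
- exact: of_.
- by rewrite inner_conj gf// conjc0 ltn_eqF// (leq_trans il).
- by rewrite gf// gtn_eqF// (leq_trans jl).
- have -> : i = j by apply/eqP; rewrite eqn_leq (leq_trans ilt)// (leq_trans jlt).
  by rewrite eqxx.
Qed.

Lemma inner_basis_expansion n f (c : nat -> C) i : orthonormal n f -> (i < n)%N ->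
  inner (\sum_(k < n) c k *: f k) (f i) = c i.
Proof.
move=> of_ il; rewrite inner_suml (bigD1 (Ordinal il))//= big1 ?addr0.
  by rewrite innerZl of_// eqxx mulr1.
move=> k ki; rewrite innerZl of_// -[_ == _]/(k == Ordinal il) (negbTE ki).
by rewrite mulr0.
Qed.

(** As u - s is orthogonal to s, its squared norm is the difference of the two sides. *)
Lemma bessel n f (u : l2space R) : orthonormal n f ->
  \sum_(i < n) normc (inner u (f i)) ^+ 2 <= nrm 0 (l2_val u) ^+ 2.
Proof.
move=> of_; pose c i := inner u (f i).
set s := \sum_(k < n) c k *: f k.
have sv i : (i < n)%N -> inner (u - s) (f i) = 0.
  by move=> il; rewrite innerBl inner_basis_expansion// subrr.
have ss : inner s (u - s) = 0.
  rewrite /s inner_suml big1// => i _.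
  by rewrite innerZl inner_conj sv// conjc0 mulr0.
have us : inner s u = (\sum_(i < n) normc (inner u (f i)) ^+ 2)%:C%C.
  rewrite /s inner_suml rmorph_sum/=; apply: eq_bigr => i _.
  by rewrite innerZl [inner (f i) u]inner_conj mul_conj.
have := inner_self (u - s); rewrite [LHS]innerBl ss subr0 innerBr inner_self.
rewrite [inner u s]inner_conj us => E.
have {E} := congr1 (@complex.Re R) E; rewrite /= => E.
by rewrite -subr_ge0 E sqr_ge0.
Qed.

(** Summing coordinate by coordinate: for fixed j Bessel's inequality supplies [b j], and the
    weights are summed last. *)
Lemma sum_coord_le n f (b : nat -> R) (B : R) w :
  (forall i, (i < n)%N -> fin w (l2_val (f i))) ->
  (forall j, \sum_(i < n) normc (l2_val (f i) j) ^+ 2 <= b j) ->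
  (forall N, \sum_(0 <= j < N) b j * j.+1%:R ^ (w *+ 2) <= B) ->
  \sum_(i < n) nrm w (l2_val (f i)) ^+ 2 <= B.
Proof.
move=> ff hb hB.
have cv : \sum_(i < n) psum w (l2_val (f i)) N @[N --> \oo] -->
    \sum_(i < n) nrm w (l2_val (f i)) ^+ 2.
  elim: n ff {hb} => [|n IH] ff.
    under eq_fun do rewrite big_ord0; rewrite big_ord0; exact: cvg_cst.
  under eq_fun do rewrite big_ord_recr/=; rewrite big_ord_recr/=.
  apply: cvgD; first by apply: IH => i il; apply: ff; exact: leqW.
  by apply: psum_cvg; exact: ff.
apply: (limn_le_cst cv) => N; apply: le_trans (hB N).
rewrite exchange_big/=; apply: ler_sum => j _.
by rewrite -mulr_suml ler_wpM2r ?weight_ge0.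
Qed.

Lemma sum_inv_sq_le N : \sum_(0 <= j < N) (j.+1%:R ^+ 2)^-1 <= 2 :> R.
Proof.
case: N => [|N]; first by rewrite big_nil.
(* The sharper bound 2 - 1 / (N + 1) makes the induction telescope. *)
apply: (@le_trans _ _ (2 - N.+1%:R^-1)); last by rewrite gerBl invr_ge0.
elim: N => [|N IH]; first by rewrite big_nat1 expr1n invr1; lra.
rewrite big_nat_recr//=; apply: le_trans (lerD IH (lexx _)) _.
have E : N.+2%:R = N.+1%:R + 1 :> R by rewrite -natr1.
have n0 : 0 < N.+1%:R :> R by [].
rewrite E; move: (N.+1%:R : R) n0 => t t0.
have : 0 <= t^-1 - (t + 1)^-1 - ((t + 1) ^+ 2)^-1.
  have -> : t^-1 - (t + 1)^-1 - ((t + 1) ^+ 2)^-1 = (t * (t + 1) ^+ 2)^-1.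
    by field; rewrite !gt_eqF// addr_gt0.
  by rewrite invr_ge0 mulr_ge0 ?sqr_ge0// ltW.
lra.
Qed.

End orthonormal_systems.

(** * Projections in L(s', s) have finite rank *)

Section projections.
Context {R : realType}.
Local Notation C := R[i].
Local Notation op := (sdual R -> sspace R).
Implicit Types (x y z p q : op).

Lemma is_projP p : is_proj p <-> Lss p /\ orthogonal_projection (restr p).
Proof.
split=> [[Lp pp sp]|[Lp [_ _ pp sp]]]; last first.
  by split => //; apply: restr_ext => //; exact: Lss_mul.
split=> //; split => //; first exact: restr_linear.
- move=> xi U [r [e [e0 HU]]].
  have c0 : 0 < opn 0 p + 1 by rewrite ltr_wpDl ?opn_ge0.
  exists 0, (e / (opn 0 p + 1)); split; first by rewrite divr_gt0.
  move=> eta /(_ 0 (leqnn 0)) h; apply: HU => k _.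
  have E : restr p eta - restr p xi = restr p (eta - xi).
    by rewrite restrB.
  rewrite E; move: h; rewrite /l2_norm !wnormE ?l2_fin//; try exact: l2_fin.
  rewrite !lte_fin ltr_pdivlMr// mulrC; apply: le_lt_trans.
  apply: le_trans (restr_bound _ Lp) _.
  by rewrite ler_wpM2r ?nrm_ge0// lerDl.
- by move=> xi; rewrite -restr_mul pp.
Qed.

Lemma proj_unit_vector p : is_proj p -> p != 0 ->
  exists f : l2space R, restr p f = f /\ inner f f = 1.
Proof.
move=> [Lp pp sp] p0.
have [u pu] : exists u, restr p u != 0.
  apply: contrapT => /forallNP h; move/eqP: p0; apply.
  apply: restr_ext => //; first exact: Lss0.
  by move=> u; rewrite restr_0E; apply/eqP/negPn/negP; exact: h.
set v := restr p u in pu.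
exists (normalize v); split; last exact: inner_normalize.
by rewrite restrZ// -restr_mul pp.
Qed.

(** The j-th coordinate of f_i is its inner product with p e_j. Bessel's inequality bounds the
    squares by |p e_j|_0^2, hence by ||p||_1^2 / (j + 1)^2, while the squared norms of the f_i add
    up to n. *)
Lemma proj_ranP p n f : is_proj p -> orthonormal n f ->
  (forall i, (i < n)%N -> restr p (f i) = f i) -> n%:R <= 2 * opn 1 p ^+ 2.
Proof.
move=> [Lp pp sp] of_ pf.
have -> : n%:R = \sum_(i < n) nrm 0 (l2_val (f i)) ^+ 2 :> R.
  rewrite (eq_bigr (fun=> 1)) ?sumr_const ?card_ord//.
  move=> i _; have := inner_self (f i); rewrite of_// eqxx => E.
  by have := congr1 (@complex.Re R) E.
apply: (@sum_coord_le _ _ f (fun j => opn 1 p ^+ 2 * (j.+1%:R ^+ 2)^-1)).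
- by move=> i _; exact: l2_fin.
- move=> j; have := bessel (restr p (s_to_l2 (basis_vec j))) of_.
  have -> : \sum_(i < n) normc (inner (restr p (s_to_l2 (basis_vec j))) (f i)) ^+ 2 =
      \sum_(i < n) normc (l2_val (f i) j) ^+ 2.
    apply: eq_bigr => i _; rewrite sp pf// inner_conj normc_conj.
    by rewrite inner_basis.
  move=> /le_trans; apply.
  rewrite -exprVn -exprMn ler_sqr ?nnegrE ?nrm_ge0 ?mulr_ge0 ?opn_ge0 ?invr_ge0//.
  apply: (@le_trans _ _ (nrm 1%:Z (s_val (p (s_to_sdual (basis_vec j)))))).
    by apply: nrm_mono (s_fin 1 _).
  apply: le_trans (Lss_bound (q := 1) Lp (s_to_sdual_fin _ _)) _.
  by rewrite ler_wpM2l ?opn_ge0//; exact: nrm_basis.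
- move=> N; under eq_bigr do rewrite mul0rn expr0z mulr1.
  by rewrite -mulr_sumr mulrC ler_wpM2r ?sqr_ge0// sum_inv_sq_le.
Qed.

(** By [proj_ranP] there is an orthonormal system of maximal size in the range; a vector of the
    range outside its span would extend it. *)
Lemma proj_finite_rank p : is_proj p -> finite_rank p.
Proof.
move=> pp; have [Lp ip sp] := pp.
pose Q n := `[< exists2 f, orthonormal n f & forall i, (i < n)%N -> restr p (f i) = f i >].
have Q0 : exists n, Q n by exists 0; apply/asboolP; exists (fun=> 0).
have Qb n : Q n -> (n <= Num.truncn (2 * opn 1 p ^+ 2))%N.
  move=> /asboolP[f of_ pf]; rewrite Num.Theory.truncn_ge_nat; first exact: proj_ranP pf.
  by rewrite mulr_ge0 ?sqr_ge0.
have [n /asboolP[f of_ pf] nmax] := ex_maxnP Q0 Qb.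
exists n, (fun i : 'I_n => f i); apply/seteqP; split=> [_ [u _ <-]|_ [c _ <-]].
  set v := restr p u; pose c i := inner v (f i).
  set s := \sum_(k < n) c k *: f k.
  exists (fun i : 'I_n => c i) => //; rewrite -/s.
  apply/esym/eqP; rewrite -subr_eq0; apply: contraT => r0.
  have rf i : (i < n)%N -> inner (v - s) (f i) = 0.
    by move=> il; rewrite innerBl inner_basis_expansion// subrr.
  have ps : restr p s = s.
    rewrite /s (big_morph (restr p) (fun a b => restrD a b Lp) (restr0 Lp)).
    by apply: eq_bigr => i _; rewrite restrZ// pf.
  have pr : restr p (v - s) = v - s.
    by rewrite restrB// ps /v -restr_mul ip.
  have : Q n.+1.
    apply/asboolP; exists (fun i => if (i < n)%N then f i else normalize (v - s)).
      apply: orthonormal_extend; [exact: of_|exact: inner_normalize|].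
      by move=> i il; rewrite innerZl rf// mulr0.
    move=> i _; case: ifP => il; first exact: pf.
    by rewrite restrZ// pr.
  by move=> /nmax; rewrite ltnn.
exists (\sum_(i < n) c i *: f i) => //.
rewrite (big_morph (restr p) (fun a b => restrD a b Lp) (restr0 Lp)).
by apply: eq_bigr => i _; rewrite restrZ// pf.
Qed.

End projections.

(** * Minimal projections of a commutative algebra *)

Section minimal_projections.
Context {R : realType}.
Local Notation C := R[i].
Local Notation op := (sdual R -> sspace R).
Implicit Types (x y z p q : op) (A : set op).

Lemma proj_sub p q : is_proj p -> is_proj q -> op_mul p q = q -> op_mul q p = q ->
  is_proj (p - q).
Proof.
move=> [Lp pp sp] [Lq qq sq] pq qp; split; first exact: LssB.
  by rewrite op_mulBl !op_mulBr// pp pq qp qq subrr subr0.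
exact: adjointB.
Qed.

Context (A : set op) (A_alg : closed_star_subalgebra A) (A_comm : commutative_op A).

Let AL x (Ax : A x) : Lss x := star_subalgebra_sub A_alg.1 Ax.
Let A0 : A 0 := star_subalgebra_0 A_alg.1.
Let Alin a x y (Ax : A x) (Ay : A y) : A (a *: x + y) :=
  star_subalgebra_lin A_alg.1 a Ax Ay.
Let Amul x y (Ax : A x) (Ay : A y) : A (op_mul x y) :=
  star_subalgebra_mul A_alg.1 Ax Ay.

Lemma subalgZ a x : A x -> A (a *: x).
Proof. by move=> Ax; rewrite -[_ *: _]addr0; exact: Alin. Qed.

Lemma subalgD x y : A x -> A y -> A (x + y).
Proof. by move=> Ax Ay; rewrite -[x]scale1r; exact: Alin. Qed.

Lemma subalgB x y : A x -> A y -> A (x - y).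
Proof. by move=> Ax Ay; rewrite addrC -scaleN1r; exact: Alin. Qed.

Lemma subalg_sum (I : Type) (r : seq I) (P : pred I) (F : I -> op) :
  (forall i, P i -> A (F i)) -> A (\sum_(i <- r | P i) F i).
Proof.
by move=> h; elim/big_rec: _ => [|i y Pi Ay]; [exact: A0|apply: subalgD => //; exact: h].
Qed.

Lemma nonzero_projectionsP p :
  nonzero_projections A p <-> [/\ A p, is_proj p & p != 0].
Proof.
split=> [[Ap op p0]|[Ap pp p0]]; split=> //.
- by apply/is_projP; split=> //; exact: AL.
- by have /is_projP[] := pp.
Qed.

Local Notation minimal := (minimal_projections A).

Lemma minimal_in p : minimal p -> [/\ A p, is_proj p & p != 0].
Proof. by move=> [/nonzero_projectionsP]. Qed.

Lemma minimal_le p q : minimal p -> A q -> is_proj q -> q != 0 ->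
  op_mul q p = q -> q = p.
Proof.
move=> mp Aq pq q0 qp; have [Ap _ _] := minimal_in mp.
apply: mp.2; first exact/nonzero_projectionsP.
by split => //; rewrite A_comm.
Qed.

Lemma comm_proj_mul p q : A p -> A q -> is_proj p -> is_proj q -> is_proj (op_mul p q).
Proof.
move=> Ap Aq [Lp pp sp] [Lq qq sq]; split; first exact: Lss_mul.
  rewrite op_mulA -(op_mulA p q p) (A_comm Aq Ap) op_mulA pp -op_mulA.
  by rewrite qq.
by rewrite /selfadjoint [X in adjoint _ X](A_comm Ap Aq); exact: adjoint_mul.
Qed.

(** The product is a projection below both; if nonzero, minimality makes it equal to both. *)
Lemma minimal_orthogonal p q : minimal p -> minimal q -> p != q -> op_mul p q = 0.
Proof.
move=> mp mq; apply: contra_neq_eq => pq0.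
have [Ap pp _] := minimal_in mp; have [Aq qq _] := minimal_in mq.
have Apq := Amul Ap Aq; have ppq := comm_proj_mul Ap Aq pp qq.
have -> : p = op_mul p q.
  apply/esym/(minimal_le mp) => //.
  by rewrite -op_mulA (A_comm Aq Ap) op_mulA (proj_idem pp).
by apply: (minimal_le mq) => //; rewrite -op_mulA (proj_idem qq).
Qed.

(* A projection without minimal projections below it would split into
   arbitrarily many orthogonal parts, contradicting the bound on the size of
   orthonormal systems in its range. *)
Lemma exists_minimal p : A p -> is_proj p -> p != 0 ->
  exists2 q, minimal q & op_mul p q = q.
Proof.
move=> Ap pp p0; apply: contrapT => nomin.
have splits q : A q -> is_proj q -> q != 0 -> op_mul p q = q ->
    exists q', [/\ A q', is_proj q', q' != 0, op_mul q q' = q' & q' != q].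
  move=> Aq qq q0 pq; apply: contrapT => h; apply: nomin; exists q => //.
  split; first exact/nonzero_projectionsP.
  move=> q' /nonzero_projectionsP[Aq' qq' q0'] [h1 h2].
  by apply: contrapT => /eqP ne; apply: h; exists q'.
(* Each proper splitting of q adds a unit vector in the range of q - q', orthogonal to the range of
   q'. *)
have long n : forall q, A q -> is_proj q -> q != 0 -> op_mul p q = q ->
    exists2 f, orthonormal n f & forall i, (i < n)%N -> restr q (f i) = f i.
  elim: n => [|n IH] q Aq qq q0 pq; first by exists (fun=> 0).
  have [q' [Aq' qq' q0' qq'E ne]] := splits q Aq qq q0 pq.
  have q'q : op_mul q' q = q' by rewrite A_comm.
  have pq' : op_mul p q' = q' by rewrite -qq'E op_mulA pq.
  have [f of_ rf] := IH q' Aq' qq' q0' pq'.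
  have dp := proj_sub qq qq' qq'E q'q.
  have [|g [rg g1]] := proj_unit_vector dp; first by rewrite subr_eq0 eq_sym.
  exists (fun i => if (i < n)%N then f i else g).
    apply: orthonormal_extend => // i il.
    rewrite -(rf i il) -(proj_sa qq') -rg -restr_mul op_mulBr//; last exact: AL.
    by rewrite q'q (proj_idem qq') subrr restr_0E inner0l.
  move=> i _; case: ifP => il.
    by rewrite -(rf i il) -restr_mul qq'E.
  rewrite -rg -restr_mul op_mulBr//; last exact: AL.
  by rewrite (proj_idem qq) qq'E.
pose n := (Num.truncn (2 * opn 1 p ^+ 2)).+1.
have [f of_ rf] := long n p Ap pp p0 (proj_idem pp).
have := proj_ranP pp of_ rf; apply/negP; rewrite -ltNge.
have y0 : 0 <= 2 * opn 1 p ^+ 2 by rewrite mulr_ge0 ?sqr_ge0.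
by have /andP[_] := Num.Theory.truncn_itv y0.
Qed.

Lemma real_imaginary_parts x : A x -> exists a b,
  [/\ A a, A b, selfadjoint a, selfadjoint b & x = a + ('i%C : C) *: b].
Proof.
move=> Ax; have [y Ay xy] := star_subalgebra_adj A_alg.1 Ax.
have yx := adjoint_sym xy.
(* These are 1 / 2 and 1 / (2i), so that i k = h. *)
pose h : C := (2^-1)%:C%C; pose k : C := Complex 0 (- 2^-1).
have hc : (h^*)%C = h by apply: complex_ext => //=; rewrite oppr0.
have kc : (k^*)%C = - k by apply: complex_ext => //=; rewrite ?oppr0.
exists (h *: (x + y)), (k *: (x - y)); split.
- by apply: subalgZ; exact: subalgD.
- by apply: subalgZ; exact: subalgB.
- have := adjointZ h (adjointD xy yx); rewrite hc /selfadjoint.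
  by rewrite [in X in adjoint _ X](addrC y).
- have := adjointZ k (adjointB xy yx); rewrite kc /selfadjoint.
  by rewrite scaleNr -scalerN opprB.
rewrite scalerA (_ : 'i%C * k = h); last first.
  by apply: complex_ext; rewrite /=; ring.
rewrite -scalerDr addrACA subrr addr0 -mulr2n -scaler_nat scalerA.
rewrite (_ : h * 2%:R = 1) ?scale1r//.
have -> : (2%:R : C) = (2%:R : R)%:C%C by rewrite rmorph_nat.
by rewrite /h -rmorphM/= mulVf// pnatr_eq0.
Qed.

(** If a is self-adjoint and nonzero, some minimal q lies below a projection p with a^2 p = r p and
    r > 0; then a^2 q = r q is nonzero, so a is not killed by q. *)
Lemma killed_eq0 x : A x -> (forall q, minimal q -> op_mul x q = 0) -> x = 0.
Proof.
have sa_case a : A a -> selfadjoint a -> (forall q, minimal q -> op_mul a q = 0) -> a = 0.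
  move=> Aa sa kill; apply/eqP/negPn/negP => a0.
  have [p [r [Ap pp p0 r0 ap]]] := projection_of_selfadjoint A_alg Aa sa a0.
  have [q mq pq] := exists_minimal Ap pp p0.
  have [Aq qq q0] := minimal_in mq; move/eqP: q0; apply.
  have rq : r%:C%C *: q = 0.
    have : op_mul (op_mul a (op_mul a p)) q = 0.
      have -> : op_mul (op_mul a (op_mul a p)) q = op_mul a (op_mul a (op_mul p q)) by [].
      by rewrite pq (kill q mq); exact: op_mul0r (AL Aa).
    by rewrite ap op_mulZl pq.
  have := congr1 (fun z => (r%:C%C)^-1 *: z) rq.
  by rewrite scalerA mulVf ?scale1r ?scaler0// -normc_eq0 normc_real normr_eq0 gt_eqF.
move=> Ax kill; have [y Ay xy] := star_subalgebra_adj A_alg.1 Ax.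
have [a [b [Aa Ab sa sb xE]]] := real_imaginary_parts Ax.
have yE : y = a - ('i%C : C) *: b.
  apply: (adjoint_unique (AL Ay) _ xy); first by apply/AL/subalgB => //; exact: subalgZ.
  rewrite xE; have := adjointD sa (adjointZ 'i%C sb).
  by rewrite (_ : ('i^*)%C = - 'i%C :> C) ?scaleNr//; apply: complex_ext => //=; rewrite oppr0.
(* The adjoint of x q is q y, which is y q by commutativity; so y is killed too, and with it both
   self-adjoint parts of x. *)
have killy q : minimal q -> op_mul y q = 0.
  move=> mq; have [Aq qq _] := minimal_in mq.
  rewrite A_comm//; apply: (@adjoint_unique _ (op_mul x q)).
  - exact/AL/Amul.
  - exact: Lss0.
  - exact: adjoint_mul (proj_sa qq).
  - by rewrite kill//; exact: adjoint0.
have ka : a = 0.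
  apply: sa_case => // q mq.
  have h1 := kill q mq; have h2 := killy q mq.
  have : op_mul (x + y) q = 0 by rewrite op_mulDl h1 h2 addr0.
  have -> : x + y = (2 : C) *: a.
    by rewrite xE yE addrACA subrr addr0 scaler_nat mulr2n.
  rewrite op_mulZl => h3; have := congr1 (fun z => (2 : C)^-1 *: z) h3.
  by rewrite scalerA mulVf ?scale1r ?scaler0// pnatr_eq0.
have kb : b = 0.
  apply: sa_case => // q mq; have := kill q mq.
  rewrite xE ka add0r op_mulZl => h3; have := congr1 (fun z => ('i%C : C)^-1 *: z) h3.
  by rewrite scalerA mulVf ?scale1r ?scaler0// -normc_eq0 /normc /= expr0n expr1n add0r sqrtr1 oner_eq0.
by rewrite xE ka kb scaler0 addr0.
Qed.

(** Let y be the compression of x - mu to the range of q. If y is nonzero, the projection obtained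
    from y lies below q, hence is q, and y^2 = r q. Then (q + y / sqrt r) / 2 is a projection below
    q, so 0 or q, and testing it at f, where y has inner product 0, gives 1 / 2 = 0 or 1 / 2 = 1. *)
Lemma minimal_eigen_sa q x f : minimal q -> A x -> selfadjoint x ->
  restr q f = f -> inner f f = 1 ->
  op_mul x q = inner (restr x f) f *: q.
Proof.
move=> mq Ax sx qf f1; have [Aq qq q0] := minimal_in mq.
set mu := inner _ _.
have muc : (mu^*)%C = mu by rewrite /mu -inner_conj sx.
have [y yE] : exists y, y = op_mul x q - mu *: q by eexists.
have Ay : A y by rewrite yE; apply: subalgB; [exact: Amul|exact: subalgZ].
have sy : selfadjoint y.
  rewrite yE; apply: adjointB; last by have := adjointZ mu (proj_sa qq); rewrite muc.
  by rewrite /selfadjoint [X in adjoint _ X](A_comm Ax Aq); exact: adjoint_mul (proj_sa qq).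
have yq : op_mul y q = y.
  by rewrite yE op_mulBl -op_mulA (proj_idem qq) op_mulZl (proj_idem qq).
have qy : op_mul q y = y by rewrite A_comm.
have yf : inner (restr y f) f = 0.
  by rewrite yE restr_subE restr_mul restr_scaleE qf innerBl innerZl f1 mulr1 subrr.
apply/eqP; rewrite -subr_eq0 -yE; apply/negPn/negP => y0.
have [p [r [Ap pp p0 r0 yyp]]] := projection_of_selfadjoint A_alg Ay sy y0.
have rC0 : r%:C%C != 0 :> C by rewrite -normc_eq0 normc_real normr_eq0 gt_eqF.
have pq : op_mul p q = p.
  have : r%:C%C *: op_mul p q = r%:C%C *: p.
    rewrite -op_mulZl -yyp.
    have -> : op_mul (op_mul y (op_mul y p)) q = op_mul y (op_mul y (op_mul p q)) by [].
    rewrite (A_comm Ap Aq).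
    have -> : op_mul y (op_mul y (op_mul q p)) = op_mul y (op_mul (op_mul y q) p) by [].
    by rewrite yq.
  by move=> /(congr1 (fun z => (r%:C%C)^-1 *: z)); rewrite !scalerA mulVf// !scale1r.
have pE : p = q by exact: minimal_le pq.
have yy : op_mul y y = r%:C%C *: q by rewrite -[in LHS]yq -pE -yyp pE yq.
pose s := Num.sqrt r; have s0 : 0 < s by rewrite sqrtr_gt0.
have ss : s ^+ 2 = r by rewrite sqr_sqrtr// ltW.
pose h : C := (2^-1)%:C%C; pose t : C := ((2 * s)^-1)%:C%C.
have hc : (h^*)%C = h by apply: complex_ext => //=; rewrite oppr0.
have tc : (t^*)%C = t by apply: complex_ext => //=; rewrite oppr0.
have t0 : t != 0 by rewrite -normc_eq0 normc_real normr_eq0 invr_eq0 gt_eqF// mulr_gt0.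
(* Since y^2 = s^2 q, this is the projection onto the eigenspace of y for s. *)
pose e := h *: q + t *: y.
have Ae : A e by apply: Alin => //; exact: subalgZ.
have pe : is_proj e.
  split; first exact: AL.
    rewrite /e op_mulDl !op_mulZl !op_mulDr ?op_mulZr; try exact: AL.
    rewrite (proj_idem qq) qy yq yy !scalerDr !scalerA.
    rewrite [X in _ + X]addrC addrACA -!scalerDl.
    have -> : h * h + t * t * r%:C%C = h.
      rewrite /h /t -!rmorphM -rmorphD/= -ss; congr (_%:C%C).
      by field; rewrite gt_eqF.
    have -> // : h * t + t * h = t.
    have hh : h + h = 1.
      by rewrite /h -rmorphD/= (_ : 2^-1 + 2^-1 = 1 :> R)//; lra.
    by rewrite [t * h]mulrC -mulrDl hh mul1r.
  have := adjointD (adjointZ h (proj_sa qq)) (adjointZ t sy).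
  by rewrite hc tc.
have eq_ : op_mul e q = e by rewrite op_mulDl !op_mulZl (proj_idem qq) yq.
have ef c : e = c *: q -> h = c.
  move=> eE; have : inner (restr e f) f = c by rewrite eE restr_scaleE qf innerZl f1 mulr1.
  by rewrite /e restr_addE !restr_scaleE innerDl !innerZl qf f1 yf mulr0 addr0 mulr1.
have [e0|en0] := eqVneq e 0.
  have /ef : e = 0 *: q by rewrite scale0r.
  by move=> /eqP; rewrite -normc_eq0 normc_real normr_eq0 invr_eq0 pnatr_eq0.
have := ef 1; rewrite scale1r => /(_ (minimal_le mq Ae pe en0 eq_)) h1.
have : (2^-1 : R) = 1 by have := congr1 (@complex.Re R) h1.
lra.
Qed.

Lemma minimal_eigen q x f : minimal q -> A x ->
  restr q f = f -> inner f f = 1 ->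
  op_mul x q = inner (restr x f) f *: q.
Proof.
move=> mq Ax qf f1; have [a [b [Aa Ab sa sb xE]]] := real_imaginary_parts Ax.
rewrite xE op_mulDl op_mulZl (minimal_eigen_sa mq Aa sa qf f1).
rewrite (minimal_eigen_sa mq Ab sb qf f1) scalerA -scalerDl.
by rewrite restr_addE restr_scaleE innerDl innerZl.
Qed.

End minimal_projections.

(** * Norm estimates for projections *)

Section projection_estimates.
Context {R : realType}.
Local Notation C := R[i].
Local Notation op := (sdual R -> sspace R).
Implicit Types (x y z p q : op).

Lemma ran_fin p v w : restr p v = v -> fin w (l2_val v).
Proof. by move=> <-; exact: s_to_sdual_fin. Qed.

(** Duality squares the constant: with v = p u one has |v|_0^2 = <u, v> <= |u|'_k |v|_k, so |v|_0 <=
    M |u|'_k and then |v|_k <= M^2 |u|'_k. *)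
Lemma opn_proj_le k p (M : R) : is_proj p -> 0 <= M ->
  (forall v, restr p v = v -> nrm k%:Z (l2_val v) <= M * nrm 0 (l2_val v)) ->
  opn k p <= M ^+ 2.
Proof.
move=> [Lp pp sp] M0 hM; apply: opn_le_trunc => // [|N eta]; first exact: sqr_ge0.
set u := strunc N eta; set v := restr p (s_to_l2 u).
have pv : restr p v = v by rewrite /v -restr_mul pp.
rewrite /= -/u; have -> : s_val (p (s_to_sdual u)) = l2_val v by [].
set U := nrm (- k%:Z) _; have U0 : 0 <= U by exact: nrm_ge0.
have hv := hM v pv; have n0 := nrm_ge0 0 (l2_val v).
have h1 : nrm 0 (l2_val v) ^+ 2 <= U * nrm k%:Z (l2_val v).
  have -> : nrm 0 (l2_val v) ^+ 2 = normc (inner (s_to_l2 u) v).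
    rewrite -[in inner _ _]pv -sp -/v inner_self normc_real ger0_norm//.
    exact: sqr_ge0.
  have := @inner_le R (- k%:Z) (s_to_l2 u) v; rewrite opprK; apply.
    exact: (s_to_sdual_fin _ u).
  exact: ran_fin pv.
have h2 : nrm 0 (l2_val v) <= M * U.
  have [->|ne] := eqVneq (nrm 0 (l2_val v)) 0; first by rewrite mulr_ge0.
  have gt : 0 < nrm 0 (l2_val v) by rewrite lt_neqAle eq_sym ne.
  rewrite -(ler_pM2r gt); rewrite expr2 in h1; apply: le_trans h1 _.
  by rewrite [M * U]mulrC -mulrA ler_wpM2l.
apply: le_trans hv _; rewrite expr2 -mulrA ler_wpM2l//.
Qed.

(** On the range of p, x acts as mu, so |v|_(2k) <= ||x||_(2k) |v|_0 / |mu|. Interpolation allows M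
    to be the square root of ||x||_(2k) / |mu| in [opn_proj_le]. *)
Lemma eigen_estimate k x p (mu : C) : Lss x -> is_proj p ->
  op_mul x p = mu *: p -> normc mu * opn k p <= opn (k + k) x.
Proof.
move=> Lx pp xp; have [->|mu0] := eqVneq mu 0; first by rewrite normc0 mul0r opn_ge0.
have m0 : 0 < normc mu by rewrite normc_gt0.
rewrite mulrC -ler_pdivlMr//.
have c0 : 0 <= opn (k + k) x / normc mu by rewrite divr_ge0 ?opn_ge0// ltW.
rewrite -(sqr_sqrtr c0); apply: opn_proj_le => //.
move=> v pv; rewrite -ler_sqr ?nnegrE ?mulr_ge0 ?nrm_ge0 ?sqrtr_ge0//.
rewrite exprMn sqr_sqrtr//.
have kk : k%:Z *+ 2 = (k + k)%N%:Z by rewrite mulr2n PoszD.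
have := @nrm_interpolation R k%:Z (l2_val v) isT (ran_fin _ pv); rewrite kk.
move=> /le_trans; apply; rewrite expr2 mulrA mulrC ler_wpM2r ?nrm_ge0//.
rewrite mulrAC ler_pdivlMr//.
have xv : restr x v = mu *: v by rewrite -[in LHS]pv -restr_mul xp restr_scaleE pv.
have -> : nrm (k + k)%N%:Z (l2_val v) * normc mu = nrm (k + k)%N%:Z (s_val (x (l2_to_sdual v))).
  have -> : s_val (x (l2_to_sdual v)) = l2_val (restr x v) by [].
  by rewrite xv l2_valZ nrmZ ?(ran_fin _ pv)// mulrC.
have f2 : fin (- (k + k)%N%:Z) (sdual_val (l2_to_sdual v)) by exact: ran_fin pv.
apply: le_trans (Lss_bound Lx f2) _; rewrite ler_wpM2l ?opn_ge0//.
by apply: nrm_mono (l2_fin _); rewrite oppr_le0.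
Qed.

(** Two interpolations give |v|_k^4 <= |v|_0^3 |v|_(4k) <= B |v|_0^4 on the range, so the fourth
    root of B is admissible in [opn_proj_le]. *)
Lemma opn_proj_sq_le k p : is_proj p -> opn k p ^+ 2 <= opn (4 * k)%N p.
Proof.
move=> pp; have [Lp ip sp] := pp.
set B := opn (4 * k)%N p; have B0 : 0 <= B := opn_ge0 _ _.
rewrite -[leRHS]sqr_sqrtr// ler_sqr ?nnegrE ?opn_ge0 ?sqrtr_ge0//.
have sB0 := sqrtr_ge0 B.
rewrite -[leRHS]sqr_sqrtr//; apply: opn_proj_le => //.
move=> v pv.
set a := nrm k%:Z _; set b := nrm 0 _.
have a0 : 0 <= a := nrm_ge0 _ _; have b0 : 0 <= b := nrm_ge0 _ _.
set M := Num.sqrt _; have M0 : 0 <= M := sqrtr_ge0 _.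
have M4 : M ^+ 2 ^+ 2 = B by rewrite !sqr_sqrtr.
have kk : k%:Z *+ 2 = (k + k)%N%:Z by rewrite mulr2n PoszD.
have kkk : (k + k)%N%:Z *+ 2 = (4 * k)%N%:Z by rewrite mulr2n -PoszD; congr Posz; lia.
have := @nrm_interpolation R k%:Z (l2_val v) isT (ran_fin _ pv); rewrite kk.
have := @nrm_interpolation R (k + k)%N%:Z (l2_val v) isT (ran_fin _ pv); rewrite kkk.
rewrite -/a -/b; set c := nrm (k + k)%N%:Z _; set d := nrm (4 * k)%N%:Z _.
have c0 : 0 <= c := nrm_ge0 _ _.
have hd : d <= B * b.
  have := Lss_bound (q := (4 * k)%N) (eta := l2_to_sdual v) Lp (ran_fin (- (4 * k)%N%:Z) pv).
  have -> : s_val (p (l2_to_sdual v)) = l2_val (restr p v) by [].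
  rewrite pv => /le_trans; apply; rewrite ler_wpM2l//.
  by apply: nrm_mono (l2_fin _); rewrite oppr_le0.
move=> h2 h1.
rewrite -ler_sqr ?nnegrE ?mulr_ge0// -ler_sqr ?nnegrE ?sqr_ge0//.
apply: (@le_trans _ _ ((b * c) ^+ 2)); first by rewrite ler_sqr ?nnegrE ?sqr_ge0 ?mulr_ge0.
have -> : (M * b) ^+ 2 ^+ 2 = B * b ^+ 2 ^+ 2 by rewrite -M4; ring.
rewrite exprMn; apply: (@le_trans _ _ (b ^+ 2 * (b * d))); first by rewrite ler_wpM2l ?sqr_ge0.
have -> : B * b ^+ 2 ^+ 2 = b ^+ 2 * (b * (B * b)) by ring.
by rewrite ler_wpM2l ?sqr_ge0// ler_wpM2l.
Qed.

(** Combine 1 = <f, f> <= |f|'_k |f|_k with |f|_k = |p f|_k <= ||p||_k |f|'_k. *)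
Lemma opn_proj_inv_le k p f : is_proj p -> restr p f = f -> inner f f = 1 ->
  0 < opn k p /\ (opn k p)^-1 <= nrm (- k%:Z) (l2_val f) ^+ 2.
Proof.
move=> [Lp _ _] pf f1.
have h1 := Lss_bound (q := k) (eta := l2_to_sdual f) Lp (ran_fin (- k%:Z) pf).
rewrite [s_val _](_ : _ = l2_val (restr p f)) // pf in h1.
have h2 : 1 <= nrm (- k%:Z) (l2_val f) * nrm k%:Z (l2_val f).
  have := @inner_le R (- k%:Z) f f (ran_fin _ pf); rewrite opprK.
  by move=> /(_ (ran_fin _ pf)); rewrite f1 normc1.
have h3 : 1 <= opn k p * nrm (- k%:Z) (l2_val f) ^+ 2.
  apply: le_trans h2 _; rewrite expr2 mulrA mulrC ler_wpM2r ?nrm_ge0//.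
have p0 : 0 < opn k p.
  rewrite lt_neqAle opn_ge0 andbT eq_sym; apply: contraTneq h3 => ->.
  by rewrite mul0r -ltNge.
by split => //; rewrite -[_^-1]mulr1 ler_pdivrMl.
Qed.

(** By Bessel's inequality at e_j the j-th coordinates contribute at most 1, and k > 0 makes the
    remaining weights summable. *)
Lemma nuclear_sum k (P : nat -> op) f N : (0 < k)%N -> (forall n, is_proj (P n)) ->
  (forall n, restr (P n) (f n) = f n) -> orthonormal N f ->
  \sum_(0 <= n < N) (opn k (P n))^-1 <= 2.
Proof.
move=> k0 pP Pf of_; rewrite big_mkord.
apply: (@le_trans _ _ (\sum_(i < N) nrm (- k%:Z) (l2_val (f i)) ^+ 2)).
  apply: ler_sum => i _; apply: (opn_proj_inv_le k (pP i) (Pf i) _).2.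
  by rewrite of_// eqxx.
apply: (@sum_coord_le _ _ f (fun=> 1)).
- by move=> i _; exact: ran_fin (Pf i).
- move=> j; have := bessel (s_to_l2 (basis_vec j)) of_.
  rewrite (eq_bigr (fun i : 'I_N => normc (l2_val (f i) j) ^+ 2)); last first.
    by move=> i _; rewrite inner_conj normc_conj inner_basis.
  move=> /le_trans; apply; rewrite expr_le1 ?nrm_ge0//.
  by have := @nrm_basis R 0 j; rewrite expr0z.
- move=> M; apply: le_trans (sum_inv_sq_le M); apply: ler_sum => j _.
  rewrite mul1r (_ : (j.+1%:R ^+ 2)^-1 = j.+1%:R ^ (- 2%:Z))//.
  by rewrite ler_weXz2l ?ler1n// mulNrn lerN2 mulr2n -PoszD lez_nat; lia.
Qed.

End projection_estimates.

(** * Coordinates and expansions *)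

Section coordinates.
Context {R : realType}.
Local Notation C := R[i].
Local Notation op := (sdual R -> sspace R).
Implicit Types (x y : op) (c : nat -> C).

(** For x in A this is the eigenvalue of x on P_n; as an inner product it is linear on all
    operators. *)
Definition coord (f : nat -> l2space R) x n : C := inner (restr x (f n)) (f n).

Record basis_data (A : set op) (P : nat -> op) (f : nat -> l2space R) : Prop := {
  basis_min : forall n, minimal_projections A (P n) ;
  basis_inj : injective P ;
  basis_surj : forall q, minimal_projections A q -> exists n, P n = q ;
  basis_ran : forall n, restr (P n) (f n) = f n ;
  basis_unit : forall n, inner (f n) (f n) = 1 }.

Context (A : set op) (A_alg : closed_star_subalgebra A) (A_comm : commutative_op A).
Context (P : nat -> op) (f : nat -> l2space R) (Pf : basis_data A P f).

Let AL x (Ax : A x) : Lss x := star_subalgebra_sub A_alg.1 Ax.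

Lemma basis_in n : A (P n).
Proof. by have [] := minimal_in A_alg (basis_min Pf n). Qed.

Lemma basis_proj n : is_proj (P n).
Proof. by have [] := minimal_in A_alg (basis_min Pf n). Qed.

Lemma basis_neq0 n : P n != 0.
Proof. by have [] := minimal_in A_alg (basis_min Pf n). Qed.

Let LP n : Lss (P n) := proj_Lss (basis_proj n).

Lemma basis_orthogonal m n : m != n -> op_mul (P m) (P n) = 0.
Proof.
move=> mn; apply: (minimal_orthogonal A_alg A_comm (basis_min Pf m) (basis_min Pf n)).
by apply: contra_neq mn => /(basis_inj Pf).
Qed.

Lemma basis_restr m n : restr (P m) (f n) = (m == n)%:R *: f n.
Proof.
have [->|mn] := eqVneq m n; first by rewrite scale1r (basis_ran Pf).
by rewrite -(basis_ran Pf n) -restr_mul basis_orthogonal// restr_0E scale0r.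
Qed.

Lemma basis_orthonormal N : orthonormal N f.
Proof.
move=> i j _ _; have [->|ij] := eqVneq i j; first exact: basis_unit Pf _.
by rewrite -(basis_ran Pf i) (proj_sa (basis_proj i)) basis_restr (negbTE ij) scale0r inner0r.
Qed.

Lemma coordP x n : A x -> op_mul x (P n) = coord f x n *: P n.
Proof.
move=> Ax; apply: (minimal_eigen A_alg A_comm (basis_min Pf n) Ax).
  exact: basis_ran Pf n.
exact: basis_unit Pf n.
Qed.

Lemma coord_restr x n : A x -> restr x (f n) = coord f x n *: f n.
Proof.
by move=> Ax; rewrite -[in LHS](basis_ran Pf n) -restr_mul coordP// restr_scaleE (basis_ran Pf).
Qed.

Lemma coord_lin a x y n : coord f (a *: x + y) n = a * coord f x n + coord f y n.
Proof. by rewrite /coord restr_addE restr_scaleE innerDl innerZl. Qed.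

Lemma coord0 n : coord f 0 n = 0.
Proof. by rewrite /coord restr_0E inner0l. Qed.

Lemma coordZ a x n : coord f (a *: x) n = a * coord f x n.
Proof. by rewrite /coord restr_scaleE innerZl. Qed.

Lemma coordB x y n : coord f (x - y) n = coord f x n - coord f y n.
Proof. by rewrite /coord restr_subE innerBl. Qed.

Lemma coord_sum (I : Type) (r : seq I) (F : I -> op) n :
  coord f (\sum_(i <- r) F i) n = \sum_(i <- r) coord f (F i) n.
Proof.
elim/big_rec2: _ => [|i y z _ <-]; first exact: coord0.
by rewrite /coord restr_addE innerDl.
Qed.

Lemma coord_mul x y n : A x -> A y ->
  coord f (op_mul x y) n = coord f x n * coord f y n.
Proof.
move=> Ax Ay; rewrite {1}/coord restr_mul coord_restr// restrZ; last exact: AL.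
by rewrite innerZl mulrC.
Qed.

Lemma coord_adjoint x y n : adjoint x y -> coord f y n = (coord f x n)^*%C.
Proof. by move=> xy; rewrite /coord xy -inner_conj. Qed.

Lemma coord_basis m n : coord f (P m) n = (m == n)%:R.
Proof. by rewrite /coord basis_restr innerZl (basis_unit Pf) mulr1. Qed.

Lemma coord_le x n : Lss x -> normc (coord f x n) <= opn 0 x.
Proof.
move=> Lx; apply: le_trans (cauchy_schwarz _ _) _.
have n1 : nrm 0 (l2_val (f n)) = 1.
  have := inner_self (f n); rewrite (basis_unit Pf) => E.
  have {E} := congr1 (@complex.Re R) E; rewrite /= => /esym/eqP.
  by rewrite sqrp_eq1 ?nrm_ge0// => /eqP.
by have := restr_bound (f n) Lx; rewrite n1 !mulr1.
Qed.

Lemma coord_inj x y : A x -> A y -> coord f x =1 coord f y -> x = y.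
Proof.
move=> Ax Ay h; apply/eqP; rewrite -subr_eq0; apply/eqP.
have Axy : A (x - y) by exact: subalgB.
apply: (killed_eq0 A_alg A_comm) => // q mq.
have [n <-] := basis_surj Pf mq.
by rewrite coordP// coordB h subrr scale0r.
Qed.

(** Partial sum of the q-th norm of the Koethe space of the [opn q (P n)]. *)
Definition wsum (c : nat -> C) q N : R :=
  \sum_(0 <= n < N) normc (c n) * opn q (P n).

Lemma wsum_mono c q : {homo wsum c q : m n / (m <= n)%N >-> m <= n}.
Proof.
apply/nondecreasing_seqP => n; rewrite /wsum big_nat_recr//= lerDl.
by rewrite mulr_ge0 ?normc_ge0 ?opn_ge0.
Qed.

Lemma coord_weight x q n : A x -> normc (coord f x n) * opn q (P n) <= opn (q + q) x.
Proof. by move=> Ax; apply: eigen_estimate (AL Ax) (basis_proj n) (coordP n Ax). Qed.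

(* Nuclearity of the space of coordinates. *)
Lemma wsum_le_sup c q K N :
  (forall n, normc (c n) * opn (4 * q.+1)%N (P n) <= K) -> wsum c q N <= 2 * K.
Proof.
move=> hK; have K0 : 0 <= K.
  by apply: le_trans (hK 0); rewrite mulr_ge0 ?normc_ge0 ?opn_ge0.
(* Bound ||P_n||_q by ||P_n||_(q+1)^2 times the inverse of ||P_n||_(q+1): the square costs the index
   4 (q + 1), the inverse is summable. Passing to q + 1 covers q = 0. *)
apply: (@le_trans _ _ (K * \sum_(0 <= n < N) (opn q.+1 (P n))^-1)); last first.
  rewrite mulrC ler_wpM2r//; apply: (nuclear_sum _ basis_proj (basis_ran Pf)) => //.
  exact: basis_orthonormal.
rewrite mulr_sumr; apply: ler_sum => n _.
have [p0 _] := opn_proj_inv_le q.+1 (basis_proj n) (basis_ran Pf n) (basis_unit Pf n).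
rewrite ler_pdivlMr//; apply: le_trans (hK n).
rewrite -mulrA ler_wpM2l ?normc_ge0//; apply: le_trans (opn_proj_sq_le _ (basis_proj n)).
by rewrite expr2 ler_wpM2r ?opn_ge0//; exact: opn_mono.
Qed.

Lemma coord_wsum x q N : A x ->
  wsum (coord f x) q N <= 2 * opn (4 * q.+1 + 4 * q.+1)%N x.
Proof. by move=> Ax; apply: wsum_le_sup => n; exact: coord_weight. Qed.

Lemma synthesis_in c n : A (\sum_(i < n) c i *: P i).
Proof. by apply: subalg_sum => // i _; apply: subalgZ => //; exact: basis_in. Qed.

Lemma coord_synthesis c n m : (m < n)%N -> coord f (\sum_(i < n) c i *: P i) m = c m.
Proof.
move=> mn; rewrite coord_sum (bigD1 (Ordinal mn))//= big1 ?addr0.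
  by rewrite coordZ coord_basis eqxx mulr1.
move=> i im; rewrite coordZ coord_basis -[_ == _]/(i == Ordinal mn) (negbTE im).
by rewrite mulr0.
Qed.

Lemma opn_synthesis_le c q m n : (m <= n)%N ->
  opn q (\sum_(i < n) c i *: P i - \sum_(i < m) c i *: P i) <= wsum c q n - wsum c q m.
Proof.
move=> mn; rewrite -!(big_mkord xpredT (fun i => c i *: P i)).
rewrite (big_cat_nat (n := m))//= addrAC subrr add0r.
rewrite /wsum [X in _ <= X - _](big_cat_nat (n := m))//= addrAC subrr add0r.
elim: n mn => [|n IH]; first by rewrite leqn0 => /eqP ->; rewrite !big_geq// opn0.
rewrite leq_eqVlt => /predU1P[->|]; first by rewrite !big_geq// opn0.
rewrite ltnS => mn; rewrite !big_nat_recr//=.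
apply: le_trans (opnD _ _ _) _.
- by apply: Lss_sum => i _; exact: LssZ.
- exact: LssZ.
- by apply: lerD; [exact: IH|rewrite opnZE].
Qed.

Lemma synthesis c : (forall q, exists K, forall N, wsum c q N <= K) ->
  exists2 x, A x & opcvg (fun n => \sum_(i < n) c i *: P i) x.
Proof.
move=> hc; have Ls n := AL (synthesis_in c n).
have cau : opcauchy (fun n => \sum_(i < n) c i *: P i).
  move=> q e e0; have [K hK] := hc q.
  have cv : wsum c q n @[n --> \oo] --> limn (wsum c q).
    apply: nondecreasing_is_cvgn; first exact: wsum_mono.
    by exists K => _ [n _ <-]; exact: hK.
  have [N hN] : exists N, forall n, (N <= n)%N -> `|limn (wsum c q) - wsum c q n| < e / 2.
    by move/cvgrPdist_lt: cv => /(_ _ (divr_gt0 e0 (ltr0Sn R 1)))[N _ hN]; exists N.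
  exists N; suff wl n m : (N <= n)%N -> (N <= m)%N -> (m <= n)%N ->
      opn q (\sum_(i < n) c i *: P i - \sum_(i < m) c i *: P i) < e.
    move=> n m nN mN; have [mn|/ltnW nm] := leqP m n; first exact: wl.
    by rewrite opn_distC//; exact: wl.
  move=> nN mN mn; apply: le_lt_trans (opn_synthesis_le c q mn) _.
  have := hN n nN; have := hN m mN; rewrite !ltr_norml => /andP[? ?] /andP[? ?]; lra.
have [x Lx cx] := opcauchy_cvg Ls cau.
by exists x => //; apply: (opcvg_closed A_alg.2 _ (synthesis_in c) Lx cx); exact: star_subalgebra_sub A_alg.1.
Qed.

(** Coordinates are continuous for [opn 0], and those of the partial sums are eventually constant.
    This also gives uniqueness of expansions. *)
Lemma coord_lim c x : Lss x -> opcvg (fun n => \sum_(i < n) c i *: P i) x ->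
  coord f x =1 c.
Proof.
move=> Lx cx m; apply/eqP; rewrite -subr_eq0 -normc_eq0 eq_le normc_ge0 andbT.
apply/ler_addgt0Pl => e e0; rewrite addr0.
have [N hN] := cx 0 e e0; have := hN (maxn N m.+1) (leq_maxl _ _).
set n := maxn _ _ => h.
have Ls := AL (synthesis_in c n).
rewrite -(@coord_synthesis c n m) ?leq_maxr// -coordB.
apply: le_trans (coord_le _ (LssB Lx Ls)) _.
by rewrite opn_distC// ltW.
Qed.

(** The series converges to some element of A; it has the coordinates of x, hence equals x. *)
Lemma expansion x : A x -> opcvg (fun n => \sum_(i < n) coord f x i *: P i) x.
Proof.
move=> Ax; have [|y Ay cy] := @synthesis (coord f x).
  by move=> q; eexists => N; exact: coord_wsum.
have E : y = x by apply: coord_inj => // n; rewrite (coord_lim (AL Ay) cy).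
by rewrite E in cy.
Qed.

(** Gives the continuity of the inverse of the coordinate map. *)
Lemma opn_le_wsum x q K : A x -> (forall N, wsum (coord f x) q N <= K) -> opn q x <= K.
Proof.
move=> Ax hK; apply/ler_addgt0Pl => e e0.
have [N hN] := expansion Ax q e0; have := hN N (leqnn N).
set s := \sum_(i < N) _ => h; have Ls : Lss s := AL (synthesis_in _ _).
rewrite opn_distC// in h; last exact: AL.
rewrite -[x](subrK s); apply: le_trans (opnD _ (LssB (AL Ax) Ls) Ls) _.
apply: lerD; first exact: ltW.
apply: le_trans (hK N).
have := @opn_synthesis_le (coord f x) q 0 N isT.
by rewrite big_ord0 subr0 /wsum (big_geq (leqnn 0)) subr0.
Qed.

End coordinates.

(** * The minimal projections form a countably infinite set *)

Section enumeration.
Context {R : realType}.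
Local Notation C := R[i].
Local Notation op := (sdual R -> sspace R).
Context (A : set op) (A_alg : closed_star_subalgebra A) (A_comm : commutative_op A).
Local Notation minimal := (minimal_projections A).

Lemma unit_vectors : exists F : op -> l2space R, forall q, minimal q ->
  restr q (F q) = F q /\ inner (F q) (F q) = 1.
Proof.
have H q : exists v, minimal q -> restr q v = v /\ inner v v = 1.
  have [mq|nq] := pselect (minimal q); last by exists 0.
  have [_ qq q0] := minimal_in A_alg mq.
  by have [v hv] := proj_unit_vector qq q0; exists v.
by have [F hF] := choice H; exists F.
Qed.

Lemma unit_vectors_orthonormal F (s : seq op) :
  (forall q, minimal q -> restr q (F q) = F q /\ inner (F q) (F q) = 1) ->
  uniq s -> {in s, forall q, minimal q} ->
  orthonormal (size s) (fun i => F (nth 0 s i)).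
Proof.
move=> hF us ms i j il jl.
have mi := ms _ (mem_nth 0 il); have mj := ms _ (mem_nth 0 jl).
have [->|ij] := eqVneq i j; first exact: (hF _ mj).2.
have pipj : op_mul (nth 0 s i) (nth 0 s j) = 0.
  by apply: (minimal_orthogonal A_alg A_comm) => //; rewrite nth_uniq.
have [_ qq _] := minimal_in A_alg mi.
rewrite -(hF _ mi).1 (proj_sa qq) -(hF _ mj).1 -restr_mul pipj.
by rewrite restr_0E inner0r.
Qed.

(** Sort the minimal projections by a coordinate j at which their unit vector has squared modulus at
    least 1 / (m + 1); Bessel's inequality at e_j makes each class finite. *)
Lemma countable_minimal : countable minimal.
Proof.
have [F hF] := unit_vectors.
pose S (jm : nat * nat) :=
  [set q | minimal q /\ (jm.2.+1%:R)^-1 <= normc (l2_val (F q) jm.1) ^+ 2].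
(* Already m + 2 members would push the Bessel sum above 1. *)
have finS jm : finite_set (S jm).
  apply: contrapT => /(@infinite_set_fset _ _ jm.2.+2)[B BS].
  set s := finmap.enum_fset B => sB.
  have us : uniq s by exact: finmap.fset_uniq.
  have sS q : q \in s -> S jm q by move=> qs; apply: BS.
  have of_ := unit_vectors_orthonormal hF us (fun q qs => (sS q qs).1).
  have := bessel (s_to_l2 (basis_vec jm.1)) of_.
  have n1 : nrm 0 (l2_val (s_to_l2 (basis_vec jm.1 : sspace R))) ^+ 2 <= 1.
    by rewrite expr_le1 ?nrm_ge0//; have := @nrm_basis R 0 jm.1; rewrite expr0z.
  move=> /le_trans/(_ n1); apply/negP; rewrite -ltNge.
  apply: (@lt_le_trans _ _ (\sum_(i < size s) (jm.2.+1%:R : R)^-1)).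
    rewrite sumr_const card_ord -[_ *+ size s]mulr_natr ltr_pdivlMl// mulr1 ltr_nat.
    exact: leq_trans sB.
  apply: ler_sum => i _; rewrite inner_conj normc_conj inner_basis.
  exact: (sS _ (mem_nth 0 (ltn_ord i))).2.
have cS : countable (\bigcup_(jm in [set: nat * nat]) S jm).
  by apply: bigcup_countable => // jm _; exact: finite_set_countable.
apply: sub_countable cS; apply: subset_card_le => q mq.
have [j hj] : exists j, l2_val (F q) j != 0.
  apply: contrapT => /forallNP h.
  have F0 : F q = 0 by apply: l2_val_inj; apply/funext => j; apply/eqP/negPn/negP; exact: h.
  by have := (hF q mq).2; rewrite F0 inner0l => /eqP; rewrite eq_sym oner_eq0.
have n0 : 0 < normc (l2_val (F q) j) ^+ 2 by rewrite exprn_gt0// normc_gt0.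
exists (j, Num.truncn (normc (l2_val (F q) j) ^+ 2)^-1) => //; split => //=.
rewrite invf_ple ?posrE//.
by have /andP[_ /ltW] := Num.Theory.truncn_itv (ltW (etrans (invr_gt0 _) n0)).
Qed.

(** If there were finitely many, x minus the sum of its eigenvalues times them would be killed by
    all of them, and they would span A. *)
Lemma infinite_minimal : ~ finite_dim A -> infinite_set minimal.
Proof.
move=> ninf /finite_seqP[s0 sE]; apply: ninf.
pose s := undup s0.
have ms q : minimal q <-> q \in s by rewrite mem_undup sE.
have us : uniq s := undup_uniq _.
have [F hF] := unit_vectors.
have ms' i : (i < size s)%N -> minimal (nth 0 s i) by move=> il; apply/ms/mem_nth.
exists (size s), (fun i : 'I_(size s) => nth 0 s i); apply/seteqP; split=> [x Ax|_ [c _ <-]]; last first.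
  by apply: (subalg_sum A_alg) => i _; apply: (subalgZ A_alg); have [] := minimal_in A_alg (ms' i (ltn_ord i)).
pose mu q := inner (restr x (F q)) (F q).
exists (fun i : 'I_(size s) => mu (nth 0 s i)) => //.
set y := \sum_(i < size s) _.
have Ay : A y.
  by apply: (subalg_sum A_alg) => i _; apply: (subalgZ A_alg); have [] := minimal_in A_alg (ms' i (ltn_ord i)).
apply/esym/eqP; rewrite -subr_eq0; apply/eqP.
apply: (killed_eq0 A_alg A_comm); first exact: (subalgB A_alg).
move=> q mq; have qs : q \in s by apply/ms.
have ilt : (index q s < size s)%N by rewrite index_mem.
rewrite op_mulBl (minimal_eigen A_alg A_comm mq Ax (hF q mq).1 (hF q mq).2).
rewrite /y op_mul_suml (bigD1 (Ordinal ilt))//= big1 ?addr0.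
  have [_ qq _] := minimal_in A_alg mq.
  by rewrite nth_index// op_mulZl (proj_idem qq) subrr.
move=> i iq; rewrite op_mulZl (minimal_orthogonal A_alg A_comm (ms' i (ltn_ord i)) mq) ?scaler0//.
apply: contraNneq iq => iqE; apply/eqP/val_inj; rewrite /= -iqE.
by rewrite index_uniq.
Qed.

Lemma exists_basis : ~ finite_dim A -> exists P f, basis_data A P f.
Proof.
move=> /infinite_minimal /(eq_card_nat countable_minimal).
rewrite card_eq_sym => /card_bijP[g [g' gK g'K]].
have [F hF] := unit_vectors.
pose P n := set_val (g (SigSub (mem_set (I : [set: nat] n)))).
have mP n : minimal (P n) by apply: set_mem; exact: valP.
exists P, (F \o P); split=> //.
- by move=> m n /val_inj /(can_inj gK) /(congr1 val).
- move=> q mq; exists (set_val (g' (SigSub (mem_set mq)))).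
  rewrite /P (_ : SigSub _ = g' (SigSub (mem_set mq))) ?g'K//.
  exact: val_inj.
- by move=> n; exact: (hF _ (mP n)).1.
- by move=> n; exact: (hF _ (mP n)).2.
Qed.

End enumeration.

(** * Koethe spaces and auxiliary sequences *)

Section koethe_spaces.
Context {R : realType}.
Local Notation C := R[i].
Local Notation op := (sdual R -> sspace R).
Implicit Types (c : nat -> C) (a : nat -> nat -> R) (K : R).

Lemma lambda1_leP a q c K : (forall n q, 0 <= a n q) ->
  (lambda1_norm a q c <= K%:E)%E <->
  forall N, \sum_(0 <= n < N) normc (c n) * a n q <= K.
Proof.
move=> a0; have t0 n : (0 <= n)%N -> xpredT n -> (0 <= (normc (c n) * a n q)%:E)%E.
  by move=> _ _; rewrite lee_fin mulr_ge0 ?normc_ge0.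
split=> [h N|h].
  by rewrite -lee_fin -sumEFin; apply: le_trans h; exact: nneseries_lim_ge.
apply: lime_le; first exact: is_cvg_nneseries.
by apply: nearW => n; rewrite sumEFin lee_fin; exact: h.
Qed.

Lemma lambda1_ge0 a q c : (forall n q, 0 <= a n q) -> (0 <= lambda1_norm a q c)%E.
Proof. by move=> a0; apply: nneseries_ge0 => n _ _; rewrite lee_fin mulr_ge0 ?normc_ge0. Qed.

Lemma ereal_real (z : \bar R) : (0 <= z)%E -> (z < +oo)%E -> exists K, z = K%:E.
Proof. by case: z => // r _ _; exists r. Qed.

Lemma lambda1_finP a q c : (forall n q, 0 <= a n q) ->
  (lambda1_norm a q c < +oo)%E <->
  exists K, forall N, \sum_(0 <= n < N) normc (c n) * a n q <= K.
Proof.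
move=> a0; split=> [/(ereal_real (lambda1_ge0 q c a0))[K KE]|[K /(lambda1_leP _ _ _ a0) h]].
  by exists K; apply/(lambda1_leP q c K a0); rewrite KE.
exact: le_lt_trans h (ltry _).
Qed.

Lemma lambdaoo_leP a q c K :
  (lambdaoo_norm a q c <= K%:E)%E <-> forall n, normc (c n) * a n q <= K.
Proof.
split=> [h n|h].
  by rewrite -lee_fin; apply: le_trans h; apply: ereal_sup_ubound; exists n.
by apply: ge_ereal_sup => _ [n _ <-]; rewrite lee_fin.
Qed.

Lemma lambdaoo_ge0 a q c : (forall n q, 0 <= a n q) -> (0 <= lambdaoo_norm a q c)%E.
Proof.
move=> a0; apply: (@le_trans _ _ (normc (c 0) * a 0 q)%:E).
  by rewrite lee_fin mulr_ge0 ?normc_ge0.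
by apply: ereal_sup_ubound; exists 0.
Qed.

Lemma lambdaoo_le_lambda1 a q c : (forall n q, 0 <= a n q) ->
  (lambdaoo_norm a q c <= lambda1_norm a q c)%E.
Proof.
move=> a0; have [h|] := boolP (lambda1_norm a q c < +oo)%E; last first.
  by rewrite ltey negbK => /eqP ->; exact: leey.
have [K KE] := ereal_real (lambda1_ge0 q c a0) h.
rewrite KE; apply/lambdaoo_leP => n.
have : (lambda1_norm a q c <= K%:E)%E by rewrite KE.
move=> /(lambda1_leP q c K a0)/(_ n.+1); apply: le_trans.
rewrite big_nat_recr//= lerDr; apply: sumr_ge0 => i _.
by rewrite mulr_ge0 ?normc_ge0.
Qed.

(** [rad] is the index loss of the nuclearity estimate; its monotonicity handles all indices up to r
    at once. *)
Lemma same_lambda a (rad : nat -> nat) : (forall n q, 0 <= a n q) ->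
  {homo rad : m n / (m <= n)%N} ->
  (forall q c K N, (forall n, normc (c n) * a n (rad q) <= K) ->
     \sum_(0 <= n < N) normc (c n) * a n q <= 2 * K) ->
  same_frechet_star (lambda1 a) (lambdaoo a).
Proof.
move=> a0 radm nuc.
have le2 q c K : (lambdaoo_norm a (rad q) c <= K%:E)%E -> (lambda1_norm a q c <= (2 * K)%:E)%E.
  by move=> /lambdaoo_leP h; apply/lambda1_leP => // N; exact: nuc.
have carE : fcarrier (lambda1 a) = fcarrier (lambdaoo a).
  apply/seteqP; split=> c /= h q.
    exact: le_lt_trans (lambdaoo_le_lambda1 q c a0) (h q).
  have [K KE] := ereal_real (lambdaoo_ge0 (rad q) c a0) (h (rad q)).
  have /le2/le_lt_trans : (lambdaoo_norm a (rad q) c <= K%:E)%E by rewrite KE.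
  by apply; exact: ltry.
split=> // c _; rewrite /fnbhs -carE; apply/seteqP; split=> U [r [e [e0 HU]]].
  (* A third absorbs the factor 2 and leaves a strict inequality. *)
  exists (rad r), (e / 3); split; first by rewrite divr_gt0.
  move=> d /= hd; apply: HU => k kr /=.
  apply: (@le_lt_trans _ _ (2 * (e / 3))%:E); last by rewrite lte_fin; lra.
  by apply: le2; apply/ltW/hd; exact: radm.
exists r, e; split=> // d /= hd; apply: HU => k kr.
exact: le_lt_trans (lambdaoo_le_lambda1 _ _ a0) (hd k kr).
Qed.

(** A diagonal choice: g n tames the columns q <= n only, and [lam] is the product of the g's, so
    lam n * w n q <= 2^-(n+1) as soon as q <= n. *)
Lemma fast_decreasing (w : nat -> nat -> R) : (forall n q, 0 <= w n q) ->
  exists lam : nat -> R, [/\ forall n, 0 < lam n, forall n, lam n <= 1,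
    {homo lam : m n / (m < n)%N >-> n < m} &
    forall q, exists K, forall N, \sum_(0 <= n < N) lam n * w n q <= K].
Proof.
move=> w0; pose g n := 2^-1 / (1 + \sum_(0 <= q < n.+1) w n q).
have s0 n : 0 <= \sum_(0 <= q < n.+1) w n q by apply: sumr_ge0.
have s1 n : 0 < 1 + \sum_(0 <= q < n.+1) w n q by rewrite ltr_wpDr.
have g0 n : 0 < g n by rewrite divr_gt0.
have g2 n : g n <= 2^-1 by rewrite ler_pdivrMr// ler_peMr// lerDl.
have gw n q : (q <= n)%N -> g n * w n q <= 2^-1.
  move=> qn; rewrite mulrAC ler_pdivrMr// ler_wpM2l//.
  have -> : \sum_(0 <= q < n.+1) w n q = w n q + \sum_(0 <= i < n.+1 | i != q) w n i.
    by rewrite (bigD1_seq q) ?mem_index_iota ?iota_uniq//=.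
  have : 0 <= \sum_(0 <= i < n.+1 | i != q) w n i by apply: sumr_ge0.
  lra.
pose lam := fix lam n := if n is m.+1 then lam m * g m.+1 else g 0.
have l0 n : 0 < lam n by elim: n => [|n IH]; [exact: g0|apply: mulr_gt0 (g0 _)].
have ldec n : lam n.+1 <= lam n * 2^-1 by rewrite /= ler_wpM2l// ltW.
have l2 n : lam n <= 2^-1 ^+ n.+1.
  elim: n => [|n IH]; first by rewrite expr1 /=.
  by apply: le_trans (ldec n) _; rewrite exprSr ler_wpM2r.
have lamw n q : (q <= n)%N -> lam n * w n q <= 2^-1 ^+ n.+1.
  case: n => [|n] qn; first by rewrite expr1; exact: gw.
  have -> : lam n.+1 * w n.+1 q = lam n * (g n.+1 * w n.+1 q) by rewrite mulrA.
  rewrite exprSr; apply: ler_pM; [exact/ltW/l0| |exact: l2|exact: gw].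
  by rewrite mulr_ge0// ltW.
exists lam; split => // [n|m n mn|q].
- by apply: le_trans (l2 n) _; rewrite exprn_ile1// invf_le1// ler1n.
- elim: n mn => // n IH; rewrite ltnS leq_eqVlt => /predU1P[->|/IH]; last first.
    apply: lt_trans; apply: le_lt_trans (ldec n) _.
    by rewrite ltr_pdivrMr// ltr_pMr// ltr1n.
  by apply: le_lt_trans (ldec n) _; rewrite ltr_pdivrMr// ltr_pMr// ltr1n.
(* The rows n < q escape the diagonal bound and are estimated with lam n <= 1; the others add up to
   at most 1. *)
- exists (\sum_(0 <= n < q) w n q + 1) => N.
  have geo M : \sum_(0 <= n < M) 2^-1 ^+ n.+1 <= 1 - 2^-1 ^+ M :> R.
    elim: M => [|M IH]; first by rewrite big_nil expr0 subrr.
    rewrite big_nat_recr//=; apply: le_trans (lerD IH (lexx _)) _.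
    by rewrite exprS; lra.
  have l1 n : lam n <= 1.
    by apply: le_trans (l2 n) _; rewrite exprn_ile1// invf_le1// ler1n.
  apply: (@le_trans _ _ (\sum_(0 <= n < N) ((if (n < q)%N then w n q else 0) + 2^-1 ^+ n.+1))).
    apply: ler_sum => n _; case: ltnP => nq; last by rewrite add0r lamw.
    apply: (@le_trans _ _ (w n q)); last by rewrite lerDl exprn_ge0.
    by rewrite ler_piMl.
  rewrite big_split/=; apply: lerD; last first.
    by apply: le_trans (geo N) _; rewrite gerBl exprn_ge0.
  elim: N => [|N IH]; first by rewrite big_nil sumr_ge0.
  rewrite big_nat_recr//=; case: ltnP => Nq; last by rewrite addr0.
  apply: (@le_trans _ _ (\sum_(0 <= n < N.+1) w n q)).
    rewrite big_nat_recr//= lerD2r big_nat_cond [leRHS]big_nat_cond.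
    by apply: ler_sum => i /andP[/andP[_ iN] _]; rewrite (ltn_trans iN).
  by rewrite [leRHS](big_cat_nat (n := N.+1))//= lerDl sumr_ge0.
Qed.

(** A row relation of the coefficient matrix is a linear relation among the f_i, trivial by
    orthonormality; so the N rows are independent in dimension d. *)
Lemma orthonormal_span_le N (f : nat -> l2space R) d (v : 'I_d -> l2space R) :
  orthonormal N f ->
  (forall i, (i < N)%N -> exists c : 'I_d -> C, f i = \sum_(k < d) c k *: v k) ->
  (N <= d)%N.
Proof.
move=> of_ hspan.
have H (i : 'I_N) : exists c : 'I_d -> C, f i = \sum_(k < d) c k *: v k.
  exact: hspan.
have [c hc] := choice H.
pose M : 'M[C]_(N, d) := \matrix_(i, k) c i k.
suff : row_free M by rewrite -row_leq_rank => /leq_trans; apply; exact: rank_leq_col.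
rewrite -kermx_eq0; apply/eqP/matrixP => i j; rewrite [RHS]mxE.
have KM := mulmx_ker M; set K := kermx M in KM *.
have s0 : \sum_(l < N) K i l *: f l = 0.
  under eq_bigr do rewrite hc scaler_sumr.
  rewrite exchange_big/= big1// => k _.
  under eq_bigr do rewrite scalerA; rewrite -scaler_suml.
  have := congr1 (fun A : 'M[C]_(N, d) => A i k) KM.
  rewrite !mxE => E; rewrite [X in X *: _](_ : _ = 0) ?scale0r//.
  by apply: etrans E; apply: eq_bigr => l _; rewrite ?mxE.
have := congr1 (fun u => inner u (f j)) s0.
rewrite inner0l inner_suml (bigD1 j)//= big1 ?addr0.
  by rewrite innerZl of_// eqxx mulr1.
move=> l lj; rewrite innerZl of_// -[_ == _]/(l == j) (negbTE lj).
by rewrite mulr0.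
Qed.

End koethe_spaces.

(** * The representation of the algebra *)

Section basis_algebra.
Context {R : realType}.
Local Notation C := R[i].
Local Notation op := (sdual R -> sspace R).
Implicit Types (x y : op) (c : nat -> C).
Context (A : set op) (A_alg : closed_star_subalgebra A) (A_comm : commutative_op A).
Context (P : nat -> op) (f : nat -> l2space R) (Pf : basis_data A P f).

Let AL x (Ax : A x) : Lss x := star_subalgebra_sub A_alg.1 Ax.
Let a n q := opn q (P n).
Let a0 n q : 0 <= a n q := opn_ge0 q (P n).
Let As c n : A (\sum_(i < n) c i *: P i) := synthesis_in A_alg Pf c n.

Lemma canonical_basis : canonical_schauder_basis A P.
Proof.
split; first exact: basis_inj Pf.
  apply/seteqP; split=> [_ [n _ <-]|q mq]; first exact: basis_min Pf n.
  by have [n <-] := basis_surj Pf mq; exists n.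
split; first exact: (basis_in A_alg Pf).
move=> x Ax; exists (coord f x); split.
  apply: opcvg_nbhs; [by move=> n; exact: AL|exact: AL|].
  exact: (expansion A_alg A_comm Pf Ax).
move=> c hc; apply/funext => n.
have cx : opcvg (fun n => \sum_(i < n) c i *: P i) x.
  by apply: nbhs_opcvg hc; [move=> k; exact: AL|exact: AL].
exact: (coord_lim A_alg A_comm Pf (AL Ax) cx n).
Qed.

(** Reduces both descriptions of A as a generated algebra to finding the P_n in B. *)
Lemma basis_sub_alg (B : set op) : closed_star_subalgebra B ->
  (forall n, B (P n)) -> A `<=` B.
Proof.
move=> B_alg BP x Ax; have [sB cB] := B_alg.
apply: (opcvg_closed cB (star_subalgebra_sub sB) _ (AL Ax)
  (expansion A_alg A_comm Pf Ax)) => n.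
by apply: (subalg_sum B_alg) => i _; exact: (subalgZ B_alg).
Qed.

Lemma alg_basis : A = alg (range P).
Proof.
apply/seteqP; split=> [x Ax B [B_alg BP]|x h].
  by apply: (basis_sub_alg B_alg _ Ax) => n; apply: BP; exists n.
by apply: h; split => // _ [n _ <-]; exact: (basis_in A_alg Pf).
Qed.

Lemma lambda1_coord_le x q :
  A x -> (lambda1_norm a q (coord f x) <= (2 * opn (4 * q.+1 + 4 * q.+1)%N x)%:E)%E.
Proof.
move=> Ax; apply/lambda1_leP => // N.
exact: (coord_wsum A_alg A_comm Pf).
Qed.

Lemma same_lambda_basis : same_frechet_star (lambda1 a) (lambdaoo a).
Proof.
apply: (@same_lambda _ a (fun q => 4 * q.+1)%N a0) => [m n mn|q c K N h].
  by rewrite leq_mul2l ltnS mn orbT.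
exact: (wsum_le_sup A_alg A_comm Pf).
Qed.

Lemma iso_lambda1 : frechet_star_iso (op_star_algebra A) (lambda1 a).
Proof.
(* The inverse map is chosen pointwise, with default value 0 off the carrier. *)
have [S hS] : exists S : (nat -> C) -> op, forall c, fcarrier (lambda1 a) c ->
    A (S c) /\ coord f (S c) = c.
  have H c : exists x, fcarrier (lambda1 a) c -> A x /\ coord f x = c.
    have [hc|nc] := pselect (fcarrier (lambda1 a) c); last by exists 0.
    have [|x Ax cx] := @synthesis _ A A_alg P f Pf c.
      by move=> q; exact: (@lambda1_finP R a q c a0).1 (hc q).
    by exists x => _; split=> //; apply/funext; exact: (coord_lim A_alg A_comm Pf (AL Ax) cx).
  by have [S hS] := choice H; exists S.
have carT x : A x -> fcarrier (lambda1 a) (coord f x).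
  by move=> Ax q; apply: le_lt_trans (lambda1_coord_le q Ax) (ltry _).
exists (coord f), S; split; first split.
- exact: carT.
- by move=> c /hS[].
- move=> x /set_mem Ax; have [Ay yE] := hS _ (carT _ Ax).
  by apply: (coord_inj A_alg A_comm Pf) => // n; rewrite yE.
- by move=> c /set_mem /hS[].
- split=> [x Ax U [r [e [e0 HU]]]|c cc U [r [e [e0 HU]]]].
    (* The index 4 (r + 1) of nuclearity, doubled by the eigenvalue estimate; e / 3 absorbs the
       factor 2. *)
    exists (4 * r.+1 + 4 * r.+1)%N, (e / 3); split; first by rewrite divr_gt0.
    move=> y hy Ay; apply: HU; last exact: carT.
    move=> k kr /=; have Ayx : A (y - x) by exact: (subalgB A_alg).
    have -> : coord f y - coord f x = coord f (y - x).
      by apply/funext => n; rewrite coordB.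
    apply: le_lt_trans (lambda1_coord_le k Ayx) _; rewrite lte_fin.
    have := hy (4 * r.+1 + 4 * r.+1)%N (leqnn _).
    rewrite /= opnE ?lte_fin; last exact: Lss_op_norm (AL Ayx).
    have : opn (4 * k.+1 + 4 * k.+1)%N (y - x) <= opn (4 * r.+1 + 4 * r.+1)%N (y - x).
      by apply: opn_mono (AL Ayx); lia.
    lra.
  exists r, e; split=> // d hd cd.
  have [Ac cE] := hS _ cc; have [Ad dE] := hS _ cd.
  apply: HU => // k kr; have Adc : A (S d - S c) by exact: (subalgB A_alg).
  rewrite /= opnE; last exact: Lss_op_norm (AL Adc).
  apply: le_lt_trans (hd k kr) => /=.
  have cB : coord f (S d - S c) = d - c by apply/funext => n; rewrite coordB dE cE.
  have lt : (lambda1_norm a k (d - c)%R < +oo)%E by apply: lt_trans (hd k kr) (ltry _).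
  have [K KE] := ereal_real (lambda1_ge0 k (d - c) a0) lt.
  rewrite [leRHS]KE lee_fin; apply: (opn_le_wsum A_alg A_comm Pf Adc) => N.
  rewrite cB; apply: (lambda1_leP k (d - c) K a0).1.
  by rewrite KE.
- by move=> b x y _ _; apply/funext => n; rewrite coord_lin.
- move=> x y /set_mem Ax /set_mem Ay; apply/funext => n.
  exact: (coord_mul A_alg A_comm Pf).
- by move=> x y _ _ xy n; exact: coord_adjoint.
Qed.

Lemma alg_of_generator x (lam : nat -> R) : A x -> (forall n, 0 < lam n) ->
  {homo lam : m n / (m < n)%N >-> n < m} ->
  (forall q, exists K, forall N, \sum_(0 <= n < N) lam n * opn q (P n) <= K) ->
  coord f x =1 (fun n => (lam n)%:C%C) -> A = alg [set x].
Proof.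
move=> Ax l0 ldec lsum cx; apply/seteqP; split=> [|z h]; last first.
  by apply: h; split=> // _ ->.
move=> y Ay B [B_alg Bx]; have {}Bx : B x by exact: Bx.
apply: (basis_sub_alg B_alg _ Ay) => {y Ay} n.
elim/ltn_ind: n => n IH.
pose s := \sum_(i < n) (lam i)%:C%C *: P i.
have Bs : B s by apply: (subalg_sum B_alg) => i _; apply: (subalgZ B_alg); exact: IH.
have As' : A s := As (fun i => (lam i)%:C%C) n.
pose z := ((lam n)^-1)%:C%C *: (x - s).
have Bz : B z by apply: (subalgZ B_alg); exact: (subalgB B_alg).
have Az : A z by apply: (subalgZ A_alg); exact: (subalgB A_alg).
(* After removing the earlier terms and rescaling, z has eigenvalue 0 before n, 1 at n, and less
   than 1 after n. *)
have zc i : coord f z i = if (i < n)%N then 0 else (lam i / lam n)%:C%C.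
  rewrite coordZ coordB cx /s; case: ltnP => ni.
    by rewrite (coord_synthesis A_alg A_comm Pf (fun i => (lam i)%:C%C) ni) subrr mulr0.
  rewrite coord_sum big1 ?subr0; last first.
    move=> j _; rewrite coordZ (coord_basis A_alg A_comm Pf) ltn_eqF ?mulr0//.
    exact: leq_trans (ltn_ord j) ni.
  by rewrite -rmorphM/= mulrC.
have Bpw k : B (pw z k) by elim: k => //= k IHk; exact: star_subalgebra_mul B_alg.1 _ _ Bz IHk.
have Apw k : A (pw z k) by elim: k => //= k IHk; exact: star_subalgebra_mul A_alg.1 _ _ Az IHk.
have pwc k i : coord f (pw z k) i = coord f z i ^+ k.+1.
  elim: k => [|k IHk]; first by rewrite expr1.
  by rewrite [LHS](coord_mul A_alg A_comm Pf)// IHk -exprS.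
have APn := basis_in A_alg Pf n.
apply: (opcvg_closed B_alg.2 (star_subalgebra_sub B_alg.1) Bpw (AL APn)) => q e e0.
have [K hK] := lsum q.
have K0 : 0 <= K by have := hK 0; rewrite big_nil.
pose th := lam n.+1 / lam n.
have th0 : 0 <= th by rewrite divr_ge0// ltW.
have th1 : th < 1 by rewrite ltr_pdivrMr// mul1r ldec.
(* Of the k + 1 equal factors lam i / lam n, k are bounded by [th]; the last is kept so that the
   summable terms lam i ||P_i||_q remain. *)
have bound k : opn q (pw z k - P n) <= th ^+ k * (K / lam n).
  have Ad : A (pw z k - P n) by exact: (subalgB A_alg).
  apply: (opn_le_wsum A_alg A_comm Pf Ad) => N.
  apply: (@le_trans _ _ (\sum_(0 <= i < N) th ^+ k / lam n * (lam i * opn q (P i)))).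
    apply: ler_sum => i _; rewrite mulrA ler_wpM2r ?opn_ge0//.
    rewrite coordB pwc zc (coord_basis A_alg A_comm Pf).
    have r0 : 0 <= th ^+ k / lam n * lam i.
      by rewrite !mulr_ge0 ?exprn_ge0 ?invr_ge0// ltW.
    case: (ltngtP i n) => ni.
    - by rewrite exprS mul0r subrr normc0.
    - rewrite subr0 -rmorphXn normc_real ger0_norm ?exprn_ge0 ?divr_ge0 ?(ltW (l0 _))//.
      have -> : th ^+ k / lam n * lam i = th ^+ k * (lam i / lam n).
        by rewrite -!mulrA [_^-1 * _]mulrC.
      rewrite exprSr.
      rewrite ler_wpM2r ?divr_ge0 ?(ltW (l0 _))//.
      rewrite lerXn2r ?nnegrE ?divr_ge0 ?(ltW (l0 _))// ler_wpM2r ?invr_ge0 ?(ltW (l0 _))//.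
      move: ni; rewrite leq_eqVlt => /predU1P[<-//|/ldec/ltW]; exact.
    - rewrite ni divff ?gt_eqF// rmorph1 expr1n subrr normc0.
      by move: r0; rewrite ni.
  rewrite -mulr_sumr -mulrA ler_wpM2l ?exprn_ge0// mulrC ler_wpM2r ?invr_ge0 ?(ltW (l0 _))//.
have cvg0 : th ^+ k * (K / lam n) @[k --> \oo] --> (0 : R).
  rewrite -(mul0r (K / lam n)); apply: cvgM; last exact: cvg_cst.
  by apply: cvg_expr; rewrite ger0_norm.
move/cvgrPdist_lt: cvg0 => /(_ e e0)[N _ hN]; exists N => k /hN /=.
rewrite sub0r normrN => h; apply: le_lt_trans (bound k) _.
exact: le_lt_trans (ler_norm _) h.
Qed.

Lemma spectral_generator : exists x, A x /\
  exists lambda : nat -> C, spectral_representation x lambda P /\ A = alg [set x].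
Proof.
(* One weight for two demands: summability against ||P_n||_q gives convergence in L(s', s), and
   against (n + 1)^(2q) it puts the eigenvalues in s. *)
have [|lam [l0 l1 ldec lsum]] :=
    @fast_decreasing R (fun n q => opn q (P n) + n.+1%:R ^ (q%:Z *+ 2)).
  by move=> n q; rewrite addr_ge0 ?opn_ge0 ?weight_ge0.
have lsumP q : exists K, forall N, \sum_(0 <= n < N) lam n * opn q (P n) <= K.
  have [K hK] := lsum q; exists K => N; apply: le_trans (hK N).
  by apply: ler_sum => n _; rewrite ler_wpM2l ?(ltW (l0 _))// lerDl weight_ge0.
have lsumW q : exists K, forall N, \sum_(0 <= n < N) lam n * n.+1%:R ^ (q%:Z *+ 2) <= K.
  have [K hK] := lsum q; exists K => N; apply: le_trans (hK N).
  by apply: ler_sum => n _; rewrite ler_wpM2l ?(ltW (l0 _))// lerDr opn_ge0.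
pose c n : C := (lam n)%:C%C.
have nc n : normc (c n) = lam n by rewrite normc_real gtr0_norm.
have cn0 n : c n != 0 by rewrite -normc_eq0 nc gt_eqF.
have [|x Ax xc] := @synthesis _ A A_alg P f Pf c.
  move=> q; have [K hK] := lsumP q; exists K => N; rewrite /wsum.
  by under eq_bigr do rewrite nc.
have cx := coord_lim A_alg A_comm Pf (AL Ax) xc.
exists x; split=> //; exists c; split; last exact: (alg_of_generator Ax l0 ldec lsumP cx).
have LP n : Lss (P n) := AL (basis_in A_alg Pf n).
split.
- split; first exact: AL.
    have [y Ay xy] := star_subalgebra_adj A_alg.1 Ax.
    by exists y; [split=> //; exact: AL|exact: A_comm].
  (* Every f_i is an eigenvector with nonzero eigenvalue, hence in the range, and d + 1 orthonormal
     vectors do not fit in dimension d. *)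
  move=> [d [v vE]]; have of_ : orthonormal d.+1 f := basis_orthonormal A_alg A_comm Pf (N := d.+1).
  have := orthonormal_span_le of_ (v := v); rewrite ltnn => /(_ _)/negP; apply => //.
  move=> i _; have : range (restr x) (f i).
    exists ((c i)^-1 *: f i) => //; rewrite restrZ; last exact: AL.
    by rewrite (coord_restr A_alg A_comm Pf)// cx scalerA mulVf// scale1r.
  by rewrite vE => -[e _ <-]; exists e.
- split=> //.
  + move=> m n /(congr1 (@complex.Re R))/= mn; apply/eqP.
    by case: (ltngtP m n) => // /ldec; rewrite mn ltxx.
  + move=> m n; rewrite leq_eqVlt => /predU1P[->//|/ldec/ltW]; by rewrite !nc.
  + apply/asboolP => q; have [K hK] := lsumW q.
    apply: (@fin_sqleP _ _ _ K _).1 => N; apply: le_trans (hK N).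
    (* As lam n <= 1, its square is at most lam n. *)
    apply: ler_sum => n _; rewrite nc ler_wpM2r ?weight_ge0//.
    by rewrite expr2 ler_piMl// ltW.
- move=> n; have pP := basis_proj A_alg Pf n; split=> //.
  + by have /is_projP[] := pP.
  + exact: (basis_neq0 A_alg Pf).
  + exact: proj_finite_rank.
- by move=> m n; exact: (basis_orthogonal A_alg A_comm Pf).
- split; last by apply: opcvg_nbhs xc; [move=> n; exact: AL|exact: AL].
  move=> q; have [K hK] := lsumP q; apply: le_lt_trans (ltry K).
  apply: lime_le.
    by apply: is_cvg_nneseries => n _ _; exact: op_norm_ge0.
  apply: nearW => N; apply: le_trans (_ : (\sum_(0 <= n < N) lam n * opn q (P n))%:E <= _)%E.
    rewrite -sumEFin; apply: lee_sum => n _.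
    by rewrite opnE ?lee_fin ?opnZE ?nc//; apply: Lss_op_norm; exact: LssZ.
  by rewrite lee_fin.
Qed.

End basis_algebra.

Theorem theorem4p8 (R : realType) (A : set (sdual R -> sspace R))
    (A_alg : closed_star_subalgebra A) (A_comm : commutative_op A)
    (A_infdim : ~ finite_dim A) :
  exists P : nat -> sdual R -> sspace R,
  let a n q := fine (op_norm q (P n)) in
  [/\ [/\ canonical_schauder_basis A P,
          forall m n, m != n -> op_mul (P m) (P n) = 0 &
          forall n, finite_rank (P n)],
      A = alg (range P),
      frechet_star_iso (op_star_algebra A) (lambda1 a),
      same_frechet_star (lambda1 a) (lambdaoo a) &
      exists x : sdual R -> sspace R, A x /\
        exists lambda : nat -> R[i],
          spectral_representation x lambda P /\ A = alg [set x]].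
Proof.
have [P [f Pf]] := exists_basis A_alg A_comm A_infdim.
exists P => a; split.
- split; first exact: canonical_basis Pf.
    by move=> m n; exact: (basis_orthogonal A_alg A_comm Pf).
  by move=> n; exact: proj_finite_rank (basis_proj A_alg Pf n).
- exact: alg_basis Pf.
- exact: iso_lambda1 Pf.
- exact: same_lambda_basis Pf.
- exact: spectral_generator Pf.
Qed.
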